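(* Let $M$ be the Markov-modulated Ornstein-Uhlenbeck process $$M(t)=m_0+\int_0^t(\alpha_{X(s)}-\gamma_{X(s)}M(s))\,\mathrm ds+\int_0^t\sigma_{X(s)}\,\mathrm dB(s),\qquad t\ge0,$$ with $m_0\in\mathbb R$, and put $\boldsymbol Y(t):=\boldsymbol Z(t)M(t)$. Let $R\in\mathbb R^{2d\times2d}$ be the block matrix $$R:=\begin{pmatrix}Q^{\rm T}&0\\ \mathrm{diag}\{\boldsymbol\alpha\}&Q^{\rm T}-\mathrm{diag}\{\boldsymbol\gamma\}\end{pmatrix}.$$ Then for all $t,u\ge0$ $$\begin{pmatrix}\mathrm{Cov}(\boldsymbol Z(t+u),M(t))\\ \mathrm{Cov}(\boldsymbol Y(t+u),M(t))\end{pmatrix}=e^{Ru}\begin{pmatrix}\mathrm{Cov}(\boldsymbol Z(t),M(t))\\ \mathrm{Cov}(\boldsymbol Y(t),M(t))\end{pmatrix},$$ and $\mathrm{Cov}(M(t),M(t+u))=\mathbf 1^{\rm T}\,\mathrm{Cov}(\boldsymbol Y(t+u),M(t))$.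
   Context: $X$ is a continuous-time Markov chain on $\{1,\dots,d\}$ with generator $Q$ (arbitrary initial law); $B$ is a standard Brownian motion independent of $X$; $\alpha_i\in\mathbb R$, $\gamma_i>0$, $\sigma_i\in\mathbb R$ are collected in vectors $\boldsymbol\alpha,\boldsymbol\gamma,\boldsymbol\sigma$. $\boldsymbol Z(t)\in\{0,1\}^d$ is the indicator vector of $X(t)$ ($Z_i(t)=1$ if $X(t)=i$, else $0$). For a random vector $\boldsymbol W\in\mathbb R^d$ and a random variable $M$, $\mathrm{Cov}(\boldsymbol W,M)\in\mathbb R^d$ is the vector with entries $\mathrm{Cov}(W_i,M)$. $\mathbf 1$ is the all-ones vector. *)

(* Defs.v *)
From HB Require Import structures.
From mathcomp Require Import all_boot all_order all_algebra.
From mathcomp Require Import all_classical all_reals all_analysis.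

Set Implicit Arguments.
Unset Strict Implicit.
Unset Printing Implicit Defensive.

Import Order.TTheory GRing.Theory Num.Theory.
Import numFieldNormedType.Exports.

Local Open Scope classical_set_scope.
Local Open Scope ring_scope.

(* e^A = \sum_k A^k / k!, the limit being taken entrywise. *)
Definition expmx {R : realType} {n : nat} (A : 'M[R]_n) : 'M[R]_n :=
  \matrix_(i, j) limn (series (fun k : nat => (A ^+ k) i j / k`!%:R)).

Definition is_generator {R : realType} {n : nat} (Q : 'M[R]_n) : Prop :=
  (forall i j, i != j -> 0 <= Q i j) /\ (forall i, \sum_j Q i j = 0).

(* Events of the form {Y_s \in A} with s \in D and A \in G. *)
Definition process_events {T E I : Type} (G : set (set E)) (D : set I)
    (Y : I -> T -> E) : set (set T) :=
  \bigcup_(s in D) preimage_set_system setT (Y s) G.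

Section processes.
Context {R : realType} {d : measure_display} {T : measurableType d}.
Variable P : probability T R.

Definition independent_classes (F G : set (set T)) : Prop :=
  forall A B, F A -> G B -> P (A `&` B) = (P A * P B)%E.

Definition sigma_real (D : set R) (Y : R -> T -> R) : set (set T) :=
  <<s process_events measurable D Y >>.

(* The state space 'I_n carries the discrete sigma-algebra. *)
Definition sigma_states {n : nat} (D : set R) (X : R -> T -> 'I_n) :
    set (set T) :=
  <<s process_events setT D X >>.

Definition cadlag_states {n : nat} (x : R -> 'I_n) : Prop :=
  (forall t : R, 0 <= t -> \forall s \near t^'+, x s = x t) /\
  (forall t : R, 0 < t -> exists i, \forall s \near t^'-, x s = i).

(* X is specified through its finite-dimensional distributions, with
   transition function h |-> e^{hQ}; the initial law is left free. *)
Definition is_markov_chain {n : nat} (Q : 'M[R]_n) (X : R -> T -> 'I_n) :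
    Prop :=
  [/\ forall (t : R) i, 0 <= t -> measurable (X t @^-1` [set i]),
      forall (m : nat) (s : nat -> R) (i : nat -> 'I_n),
        0 <= s 0%N -> (forall k, (k < m)%N -> s k < s k.+1) ->
        P [set w | forall k, (k <= m)%N -> X (s k) w = i k] =
        (P [set w | X (s 0%N) w = i 0%N] *
         (\prod_(k < m) expmx ((s k.+1 - s k) *: Q) (i k) (i k.+1))%:E)%E
    & {ae P, forall w, cadlag_states (X ^~ w)}].

Definition is_brownian_motion (B : R -> {RV P >-> R}) : Prop :=
  [/\ {ae P, forall w, B 0 w = 0},
      forall s t : R, 0 <= s -> s < t -> forall A, measurable A ->
        pushforward P (B t \- B s) A = normal_prob 0 (Num.sqrt (t - s)) A,
      forall s t : R, 0 <= s -> s < t ->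
        independent_classes (sigma_real `[0, s] B)
          (preimage_set_system setT (B t \- B s) measurable)
    & {ae P, forall w, {within `[0, +oo[, continuous (fun t : R => B t w)}}].

Definition natural_filtration {n : nat} (X : R -> T -> 'I_n)
    (B : R -> {RV P >-> R}) (t : R) : set (set T) :=
  <<s process_events setT `[0, t] X `|` process_events measurable `[0, t] B >>.

Definition measurable_wrt (G : set (set T)) (f : T -> R) : Prop :=
  forall A, measurable A -> G (f @^-1` A).

(* The step process \sum_(k < m) xi_k 1_{(p_k, p_{k+1}]}. *)
Record step_process := StepProcess {
  step_size : nat;
  step_time : nat -> R;
  step_coef : nat -> T -> R }.

Definition step_eval (H : step_process) (s : R) (w : T) : R :=
  \sum_(k < step_size H)
    step_coef H k w * (step_time H k < s <= step_time H k.+1)%R%:R.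

Definition step_integral (B : R -> {RV P >-> R}) (H : step_process) (w : T) :
    R :=
  \sum_(k < step_size H)
    step_coef H k w * (B (step_time H k.+1) w - B (step_time H k) w).

Definition admissible_step (F : R -> set (set T)) (t : R) (H : step_process) :
    Prop :=
  [/\ 0 <= step_time H 0%N,
      forall k, (k < step_size H)%N -> step_time H k <= step_time H k.+1,
      step_time H (step_size H) <= t
    & forall k, (k < step_size H)%N ->
        measurable_wrt (F (step_time H k)) (step_coef H k) /\
        exists C : R, forall w, `|step_coef H k w| <= C].

(* I is (a version of) the Ito integral of h against B over [0, t]: the L^2(P)
   limit of integrals of F-adapted bounded step processes converging to h in
   L^2([0, t] x Omega).  By the Ito isometry I does not depend, up to almost
   sure equality, on the approximating sequence. *)
Definition is_ito_integral (F : R -> set (set T)) (B : R -> {RV P >-> R})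
    (h : R -> T -> R) (t : R) (I : {RV P >-> R}) : Prop :=
  exists H : nat -> step_process,
    [/\ forall m, admissible_step F t (H m),
        (\int[lebesgue_measure]_(s in `[0%R, t])
            'E_P[fun w => ((step_eval (H m) s w - h s w) ^+ 2)%R])%E
          @[m --> \oo] --> 0%E
      & ('E_P[fun w => ((step_integral B (H m) w - I w) ^+ 2)%R])%E
          @[m --> \oo] --> 0%E].

(* M is a strong solution of
     dM = (alpha_X - gamma_X M) dt + sigma_X dB,  M(0) = m0:
   it has continuous paths, is adapted to the P-completed filtration generated
   by (X, B), and satisfies the integral equation almost surely. *)
Definition is_mmou {n : nat} (X : R -> T -> 'I_n) (B : R -> {RV P >-> R})
    (alpha gamma sigma : 'rV[R]_n) (m0 : R) (M : R -> {RV P >-> R}) : Prop :=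
  [/\ {ae P, forall w, {within `[0, +oo[, continuous (fun t : R => M t w)}},
      forall t : R, 0 <= t -> exists f : T -> R,
        measurable_wrt (natural_filtration X B t) f /\
        {ae P, forall w, M t w = f w}
    & forall t : R, 0 <= t -> exists I : {RV P >-> R},
        is_ito_integral (natural_filtration X B) B
          (fun s w => sigma 0 (X s w)) t I /\
        {ae P, forall w,
          M t w = m0
            + \int[lebesgue_measure]_(s in `[0, t])
                (alpha 0 (X s w) - gamma 0 (X s w) * M s w)
            + I w}].

(* Z(t) and Y(t) = Z(t) M(t), componentwise. *)
Definition state_indicator {n : nat} (X : R -> T -> 'I_n) (t : R) (i : 'I_n)
    (w : T) : R := (X t w == i)%:R.

Definition modulated {n : nat} (X : R -> T -> 'I_n) (M : R -> {RV P >-> R})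
    (t : R) (i : 'I_n) (w : T) : R := state_indicator X t i w * M t w.

Definition cov (U V : T -> R) : R := fine (covariance P U V).

Definition cov_vec {n : nat} (W : 'I_n -> T -> R) (V : T -> R) : 'cV[R]_n :=
  \col_i cov (W i) V.

End processes.

Definition mmou_matrix {R : realType} {n : nat} (Q : 'M[R]_n)
    (alpha gamma : 'rV[R]_n) : 'M[R]_(n + n) :=
  block_mx Q^T 0 (diag_mx alpha) (Q^T - diag_mx gamma).

(* Main.v *)
(* The Markov property of X, applied to functions of the past of (X, B), gives
    E[Z_j(t+u) V] = sum_i (e^{uQ})_{ij} E[Z_i(t) V] for V = M(t) - E M(t).
    Conditioning on the whole path of X leaves B a Brownian motion, so the Ito
    integral over [t, t+u] is orthogonal to Z_j(t+u) V.  Multiplying the integral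
    equation for M by Z_j(t+u) V and using Fubini and the Markov property at
    time t+r yields the variation-of-constants formula
      g_j(u) = sum_i p_{ij}(u) g_i(0)
               + int_0^u sum_i p_{ij}(u-r) (alpha_i f_i(r) - gamma_i g_i(r)) dr,
    where f_i(u) = E[Z_i(t+u) V], g_i(u) = E[Y_i(t+u) V] and p(h) = e^{hQ}.  The
    blocks of e^{uR} (f(0), g(0)) satisfy it too, and Gronwall's inequality makes
    bounded solutions unique.

    Square integrability of M is not assumed.  On the event where int_0^t M^2 is
    at most K, the integral equation and Cauchy-Schwarz bound E[M(s)^2] by
    a + b int_0^s E[M(r)^2] dr with a, b independent of K; Gronwall's inequality
    and monotone convergence then remove the truncation. *)

From HB Require Import structures.
Require Import Defs.
From mathcomp Require Import all_boot all_order all_algebra.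
From mathcomp Require Import all_classical all_reals all_analysis.
From mathcomp Require Import measurable_realfun ring lra.

Set Implicit Arguments.
Unset Strict Implicit.
Unset Printing Implicit Defensive.

Import Order.TTheory GRing.Theory Num.Theory.
Import numFieldNormedType.Exports.

Local Open Scope classical_set_scope.
Local Open Scope ring_scope.

(** * Matrix exponentials *)

(** The Ito integral is available only as an L^2 limit of step integrals, separately at each time,
    so the difference of the integrals at t + u and t is not given as an integral over [t, t + u];
    and V Z_j(t + u) is not known at time t in the natural filtration. Both obstacles are met by the
    sigma-algebras generated by the whole path of X and by B up to a. They contain the natural
    filtration, so admissible step processes remain adapted, and V Z_j(t + u) is measurable for them
    already at a = t. No conditional expectation is formed: independence and the Markov property are
    identities P(E & A) = c P(E & B) on a pi-system, extended to a sigma-algebra and then to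
    integrals. Two further gaps are bridged by versions. X and M are measurable time by time, with
    regular paths only almost surely, so Fubini's theorem is applied to jointly measurable versions
    set to 0 on a null set. M(t) is adapted only up to null sets, so V is built from an exactly
    adapted function that equals M(t) almost surely. *)

Lemma cvg_bigsum {R : realType} {T : Type} {F : set_system T} {FF : Filter F}
    {I : Type} (r : seq I) (f : I -> T -> R) (l : I -> R) :
  (forall i, f i @ F --> l i) ->
  (fun x => \sum_(i <- r) f i x) @ F --> \sum_(i <- r) l i.
Proof.
move=> fl; elim: r => [|i r IH].
  by under eq_fun do rewrite big_nil; rewrite big_nil; exact: cvg_cst.
by under eq_fun do rewrite big_cons; rewrite big_cons; exact: cvgD.
Qed.

Section expmx_derivative.
Context {R : realType} {n : nat}.
Implicit Types A : 'M[R]_n.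

Definition expmx_coef A (i j : 'I_n) (k : nat) : R := (A ^+ k) i j / k`!%:R.

(** The total absolute mass of [A] dominates every row sum, so each further factor [A] costs at most
    one factor [c]. The exponential series is thereby dominated by that of exp(c |u|). *)
Lemma entry_expmx_bound A :
  exists2 c : R, 0 <= c & forall k i j, `|(A ^+ k) i j| <= c ^+ k.
Proof.
exists (1 + \sum_i \sum_j `|A i j|).
  by rewrite addr_ge0// sumr_ge0// => i _; rewrite sumr_ge0.
elim=> [|k IH] i j.
  rewrite !expr0 mxE; case: eqP => _; rewrite ?normr1// normr0 //.
rewrite exprS mxE.
set c := 1 + _ in IH *.
have c0 : 0 <= c by rewrite addr_ge0// sumr_ge0// => l _; rewrite sumr_ge0.
rewrite (le_trans (ler_norm_sum _ _ _))//.
apply: (@le_trans _ _ (\sum_l `|A i l| * c ^+ k)).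
  by apply: ler_sum => l _; rewrite normrM ler_wpM2l.
rewrite -mulr_suml exprS ler_wpM2r ?exprn_ge0//.
rewrite /c [X in _ <= 1 + X](bigD1 i)//= addrCA lerDl addr_ge0// sumr_ge0// => l _.
by rewrite sumr_ge0.
Qed.

Lemma pseries_diffs_expmx_coef A i j :
  pseries_diffs (expmx_coef A i j) = (fun k => (A ^+ k.+1) i j / k`!%:R).
Proof.
apply/funext => k; rewrite /pseries_diffs /expmx_coef factS natrM invfM.
by rewrite mulrCA mulVKf// pnatr_eq0.
Qed.

(** The shift [h] is there for termwise differentiation, which asks for convergence of the series
    and of its first two formal derivatives; the [h]-th one has coefficients A^(k+h) / k!. *)
Lemma is_cvg_pseries_expmx A (h : nat) i j (u : R) :
  cvgn (pseries (fun k => (A ^+ (k + h)) i j / k`!%:R) u).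
Proof.
have [c c0 Ac] := entry_expmx_bound A.
apply: normed_cvg => /=.
apply: (@series_le_cvg _ _ (fun k => c ^+ h * exp_coeff (c * `|u|) k)).
- by move=> k; exact: normr_ge0.
- by move=> k; rewrite mulr_ge0 ?exprn_ge0// exp_coeff_ge0// mulr_ge0.
- move=> k; rewrite /exp_coeff /= exprMn normrM normrX normrM normfV.
  rewrite (ger0_norm (ler0n _ _)) -mulrA.
  apply: (@le_trans _ _ (c ^+ (k + h) * (k`!%:R^-1 * `|u| ^+ k))).
    by rewrite ler_wpM2r// mulr_ge0// ?invr_ge0// exprn_ge0.
  by rewrite exprD le_eqVlt; apply/orP; left; apply/eqP; ring.
- exact/is_cvg_seriesZ/is_cvg_series_exp_coeff.
Qed.

Lemma expr_scalemx A (u : R) k : (u *: A) ^+ k = u ^+ k *: A ^+ k.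
Proof.
elim: k => [|k IH]; first by rewrite !expr0 scale1r.
by rewrite !exprS IH -!mulmxE -scalemxAl -scalemxAr scalerA.
Qed.

Lemma expmxZE A (u : R) i j :
  expmx (u *: A) i j = limn (pseries (expmx_coef A i j) u).
Proof.
rewrite mxE /pseries /expmx_coef; congr (limn (series _)); apply/funext => k.
by rewrite expr_scalemx mxE -mulrA mulrC.
Qed.

Global Instance is_derive_expmx A i j (u : R) :
  is_derive u (1 : R) (fun u => expmx (u *: A) i j)
    (\sum_k A i k * expmx (u *: A) k j).
Proof.
rewrite (_ : (fun u => _) = (fun u => limn (pseries (expmx_coef A i j) u)));
  last by apply/funext => v; rewrite expmxZE.
have E h : (fun k => (A ^+ (k + h)) i j / k`!%:R) =
           iter h (@pseries_diffs R) (expmx_coef A i j).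
  elim: h => [|h IH]/=; first by apply/funext => k; rewrite addn0.
  rewrite -IH; apply/funext => k.
  rewrite /pseries_diffs factS natrM invfM addSnnS.
  by rewrite mulrCA mulVKf// pnatr_eq0.
rewrite (_ : \sum_k _ = limn (pseries (pseries_diffs (expmx_coef A i j)) u)).
  (* Termwise differentiation at [u] needs convergence at a point strictly beyond |u|. *)
  apply: (@pseries_snd_diffs _ _ (`|u| + 1)).
  - by have := @is_cvg_pseries_expmx A 0 i j (`|u| + 1); rewrite E.
  - by have := @is_cvg_pseries_expmx A 1 i j (`|u| + 1); rewrite E.
  - by have := @is_cvg_pseries_expmx A 2 i j (`|u| + 1); rewrite E.
  - by rewrite [ltRHS]ger0_norm// ltrDl.
under eq_bigr do rewrite expmxZE.
rewrite pseries_diffs_expmx_coef; apply/esym/cvg_lim => //.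
rewrite (_ : pseries _ u = (fun m => \sum_l A i l * pseries (expmx_coef A l j) u m)).
  apply: cvg_bigsum => l; apply: cvgM; first exact: cvg_cst.
  have := @is_cvg_pseries_expmx A 0 l j u.
  by rewrite (_ : (fun k => _) = expmx_coef A l j)//; apply/funext => k;
     rewrite addn0.
apply/funext => m; rewrite /pseries /series /=.
under [RHS]eq_bigr do rewrite mulr_sumr.
rewrite exchange_big/=; apply: eq_bigr => k _.
by rewrite exprS mxE !mulr_suml; apply: eq_bigr => l _; rewrite /expmx_coef !mulrA.
Qed.

Lemma expmx0 : expmx (0 : 'M[R]_n) = 1%:M.
Proof.
apply/matrixP => i j; rewrite mxE; apply/cvg_lim => //.
apply/cvg_ballP => e e0; near=> k.
have k0 : (0 < k)%N by near: k; exists 1%N.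
rewrite /series/= big_ltn// big1_seq ?addr0; last first.
  by move=> l /andP[_]; rewrite mem_index_iota => /andP[l0 _];
     rewrite expr0n gtn_eqF// mxE mul0r.
by rewrite expr0 fact0 divr1; exact: ballxx.
Unshelve. all: by end_near. Qed.

Lemma continuous_expmx A i j : continuous (fun u : R => expmx (u *: A) i j).
Proof.
move=> u; apply: differentiable_continuous; apply/derivable1_diffP.
exact: (@ex_derive _ _ _ _ _ _ _ (is_derive_expmx A i j u)).
Qed.

End expmx_derivative.

(** * Gronwall's inequality and the variation-of-constants formula *)

Lemma integrable_itv_bounded {R : realType} (a b K : R) (f : R -> R) :
  measurable_fun `[a, b] f -> (forall x, a <= x <= b -> `|f x| <= K) ->
  lebesgue_measure.-integrable `[a, b] (EFin \o f).
Proof.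
move=> mf fK; apply: measurable_bounded_integrable => //.
  by rewrite /= lebesgue_measure_itv/=; case: ifPn => // _; rewrite ltry.
exists K; split; rewrite ?num_real// => y Ky x /=; rewrite in_itv/= => xab.
exact: le_trans (fK _ xab) (ltW Ky).
Qed.

Lemma Rintegral_sum {d} {T : measurableType d} {R : realType}
    (mu : {measure set T -> \bar R}) (D : set T) {I : Type} (r : seq I)
    (f : I -> T -> R) : measurable D ->
  (forall i, mu.-integrable D (EFin \o f i)) ->
  \int[mu]_(x in D) (\sum_(i <- r) f i x) =
  \sum_(i <- r) \int[mu]_(x in D) f i x.
Proof.
move=> mD fi.
(* Integrability of the partial sums is carried along, since additivity of the integral asks for it
   at each step. *)
suff [] : \int[mu]_(x in D) (\sum_(i <- r) f i x) =
          \sum_(i <- r) \int[mu]_(x in D) f i x /\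
   mu.-integrable D (EFin \o (fun x => \sum_(i <- r) f i x)) by [].
elim: r => [|i r [IH1 IH2]].
  rewrite big_nil; split.
    by under eq_Rintegral do rewrite big_nil; rewrite Rintegral_cst// mul0r.
  rewrite (_ : _ \o _ = cst 0%E); first exact: integrable0.
  by apply/funext => x /=; rewrite big_nil.
rewrite big_cons -IH1; split.
  under eq_Rintegral do rewrite big_cons.
  by rewrite RintegralD.
rewrite (_ : _ \o _ = (EFin \o f i) \+ (EFin \o (fun x => \sum_(i <- r) f i x))).
  exact: integrableD.
by apply/funext => x /=; rewrite big_cons EFinD.
Qed.

Lemma integrable_bigsum {d} {T : measurableType d} {R : realType}
    (mu : {measure set T -> \bar R}) (D : set T) {I : Type} (r : seq I)
    (f : I -> T -> R) : measurable D ->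
  (forall i, mu.-integrable D (EFin \o f i)) ->
  mu.-integrable D (EFin \o (fun x => \sum_(i <- r) f i x)).
Proof.
move=> mD fi; elim: r => [|i r IH].
  rewrite (_ : _ \o _ = cst 0%E); first exact: integrable0.
  by apply/funext => x /=; rewrite big_nil.
rewrite (_ : _ \o _ = (EFin \o f i) \+ (EFin \o (fun x => \sum_(i <- r) f i x))).
  exact: integrableD.
by apply/funext => x /=; rewrite big_cons EFinD.
Qed.

Section integrable_EFin.
Context {d} {T : measurableType d} {R : realType}.
Context (mu : {measure set T -> \bar R}) (D : set T) (mD : measurable D).
Implicit Types f g : T -> R.

Lemma integrable_EFinZ k f : mu.-integrable D (EFin \o f) ->
  mu.-integrable D (EFin \o (fun x => k * f x)).
Proof. by move=> fi; exact: (integrableZl mD k fi). Qed.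

Lemma integrable_EFinD f g : mu.-integrable D (EFin \o f) ->
  mu.-integrable D (EFin \o g) -> mu.-integrable D (EFin \o (fun x => f x + g x)).
Proof. by move=> fi gi; exact: (integrableD mD fi gi). Qed.

End integrable_EFin.

Lemma Rintegral_derive {R : realType} (F f : R -> R) (a b : R) : a <= b ->
  (forall x : R, is_derive x (1 : R) F (f x)) -> continuous f ->
  \int[lebesgue_measure]_(x in `[a, b]) f x = F b - F a.
Proof.
move=> + dF cf; rewrite le_eqVlt => /predU1P[->|ab].
  by rewrite set_itv1 Rintegral_set1 subrr.
have cF : continuous F.
  move=> x; apply: differentiable_continuous; apply/derivable1_diffP.
  exact: (@ex_derive _ _ _ _ _ _ _ (dF x)).
rewrite /Rintegral (@continuous_FTC2 _ f F)//.
- exact: continuous_subspaceT.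
- split.
  + by move=> x _; exact: (@ex_derive _ _ _ _ _ _ _ (dF x)).
  + exact/cvg_at_right_filter/cF.
  + exact/cvg_at_left_filter/cF.
- by move=> x _; rewrite derive1E; exact: derive_val.
Qed.

Lemma is_derive_expRM {R : realType} (k x : R) :
  is_derive x (1 : R) (fun x => expR (k * x)) (k * expR (k * x)).
Proof.
have -> : k * expR (k * x) = expR (k * x) * (k *: (1 : R)).
  by rewrite /GRing.scale/= mulr1 mulrC.
exact: (@is_derive1_comp _ expR ( *%R k)).
Qed.

(* The weighted supremum S of e^{-2bs} phi(s) satisfies S <= a + S / 2. *)
Lemma gronwall {R : realType} (phi : R -> R) (a b K U : R) :
  0 <= a -> 0 < b -> measurable_fun `[0, U] phi ->
  (forall s, 0 <= s <= U -> 0 <= phi s <= K) ->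
  (forall s, 0 <= s <= U ->
     phi s <= a + b * \int[lebesgue_measure]_(r in `[0, s]) phi r) ->
  forall s, 0 <= s <= U -> phi s <= 2 * a * expR (2 * b * s).
Proof.
move=> a0 b0 mphi phiK phile s sU.
have [s0 s1] := andP sU.
pose E := [set expR (- (2 * b * r)) * phi r | r in `[0, U]].
have K0 : 0 <= K by have /andP[] := phiK _ sU => /le_trans; apply.
have e1 r : 0 <= r -> expR (- (2 * b * r)) <= 1.
  by move=> r0; rewrite -expR0 ler_expR oppr_le0 !mulr_ge0// ltW.
(* The bound [K] only makes the supremum finite; it is absent from the conclusion, which later
   allows a truncation level to be removed. *)
have EK : has_ubound E.
  exists K => y [r /=]; rewrite in_itv/= => /[dup] rU /andP[r0 _] <-.
  have /andP[p0 pK] := phiK _ rU.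
  by rewrite -[K]mul1r ler_pM// ?expR_ge0// e1.
set S := sup E.
have phiS r : 0 <= r <= U -> phi r <= S * expR (2 * b * r).
  move=> rU; rewrite -ler_pdivrMr ?expR_gt0// mulrC -expRN.
  by apply: ub_le_sup => //; exists r.
have S0 : 0 <= S.
  apply: (@le_trans _ _ (expR (- (2 * b * s)) * phi s)).
    by rewrite mulr_ge0// ?expR_ge0//; case/andP: (phiK _ sU).
  by apply: ub_le_sup => //; exists s.
have cexp : continuous (fun x => S * expR (2 * b * x)).
  move=> x; apply: cvgM; first exact: cvg_cst.
  apply: continuous_comp; last exact: continuous_expR.
  by apply: cvgM; [exact: cvg_cst|exact: cvg_id].
have int_exp r : 0 <= r -> \int[lebesgue_measure]_(x in `[0, r])
    (S * expR (2 * b * x)) = S / (2 * b) * (expR (2 * b * r) - 1).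
  move=> r0; have dF x : is_derive x (1 : R)
      (fun x => S / (2 * b) * expR (2 * b * x)) (S * expR (2 * b * x)).
    have -> : S * expR (2 * b * x) = S / (2 * b) *: (2 * b * expR (2 * b * x)).
      by rewrite /GRing.scale/=; field; rewrite gt_eqF.
    exact: (is_deriveZ _ (is_derive_expRM (2 * b) x)).
  by rewrite (Rintegral_derive r0 dF cexp) mulr0 expR0; ring.
have SE : S <= a + S / 2.
  apply: ge_sup; first by exists (expR (- (2 * b * s)) * phi s); exists s.
  move=> y [r /=]; rewrite in_itv/= => /[dup] rU /andP[r0 r1] <-.
  apply: (@le_trans _ _ (expR (- (2 * b * r)) * (a + S / 2 * expR (2 * b * r)))).
    rewrite ler_wpM2l ?expR_ge0//.
    apply: le_trans (phile _ rU) _; rewrite lerD2l.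
    have subr0U : `[0, r] `<=` `[0, U].
      by apply: subset_itvl; rewrite bnd_simp.
    have : \int[lebesgue_measure]_(x in `[0, r]) phi x <=
           \int[lebesgue_measure]_(x in `[0, r]) (S * expR (2 * b * x)).
      apply: le_Rintegral => //.
      - apply: (@integrable_itv_bounded _ _ _ K).
          exact: measurable_funS mphi.
        move=> x /andP[x0 xr]; have /phiK/andP[p0 pK] : 0 <= x <= U.
          by rewrite x0 (le_trans xr).
        by rewrite ger0_norm.
      - apply: continuous_compact_integrable; first exact: segment_compact.
        exact: continuous_subspaceT.
      - by move=> x /subr0U/=; rewrite in_itv/=; exact: phiS.
    rewrite int_exp// => /(ler_wpM2l (ltW b0))/le_trans; apply.
    rewrite [leLHS](_ : _ = S / 2 * (expR (2 * b * r) - 1)).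
      by rewrite mulrBr mulr1 gerBl divr_ge0.
    by field; rewrite gt_eqF.
  rewrite mulrDr mulrCA [expR (- _) * expR _]mulrC -expRD subrr expR0 mulr1 lerD2r.
  by rewrite -[leRHS]mul1r ler_wpM2r// e1.
apply: le_trans (phiS _ sU) _; rewrite ler_wpM2r ?expR_ge0//.
by lra.
Qed.

Lemma is_derive_bigsum {R : realType} {I : Type} (r : seq I)
    (f : I -> R -> R) (df : I -> R) (x : R) :
  (forall i, is_derive x (1 : R) (f i) (df i)) ->
  is_derive x (1 : R) (fun y => \sum_(i <- r) f i y) (\sum_(i <- r) df i).
Proof.
move=> H; elim: r => [|i r IH].
  by under eq_fun do rewrite big_nil; rewrite big_nil; exact: is_derive_cst.
under eq_fun do rewrite big_cons.
by rewrite big_cons; exact: is_deriveD.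
Qed.

Lemma is_derive_mulr {R : realType} (f g : R -> R) (df dg x : R) :
  is_derive x (1 : R) f df -> is_derive x (1 : R) g dg ->
  is_derive x (1 : R) (fun y => f y * g y) (df * g x + f x * dg).
Proof.
move=> Hf Hg; have -> : df * g x + f x * dg = f x *: dg + g x *: df.
  by rewrite /GRing.scale/= addrC [g x * _]mulrC.
exact: is_deriveM.
Qed.

Lemma is_derive_continuous {R : realType} (f df : R -> R) :
  (forall x : R, is_derive x (1 : R) f (df x)) -> continuous f.
Proof.
move=> dF x; apply: differentiable_continuous; apply/derivable1_diffP.
exact: (@ex_derive _ _ _ _ _ _ _ (dF x)).
Qed.

Section duhamel.
Context {R : realType} {n : nat} (Q : 'M[R]_n).

Local Notation p i j u := (expmx (u *: Q) i j).

Lemma is_derive_expmxB i j (u r : R) :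
  is_derive r (1 : R) (fun r => p i j (u - r)) (- \sum_k Q i k * p k j (u - r)).
Proof.
have -> : - \sum_k Q i k * p k j (u - r) =
    (\sum_k Q i k * p k j (u - r)) * (0 - 1) by ring.
exact: (@is_derive1_comp _ (fun v => p i j v) (fun r => u - r)).
Qed.

Lemma continuous_expmxB i j (u : R) : continuous (fun r => p i j (u - r)).
Proof. exact: (is_derive_continuous (is_derive_expmxB i j u)). Qed.

(** The function F(r) = sum_i p_ij(u - r) phi_i(r) runs from the first sum at r = 0 to phi_j(u) at r
    = u. In F' the backward equation for p(u - r) cancels the terms of phi' that contain [Q], so
    only [psi] is left to integrate. *)
Lemma duhamel (phi psi : 'I_n -> R -> R) (u : R) (j : 'I_n) : 0 <= u ->
  (forall i, continuous (psi i)) ->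
  (forall i (r : R), is_derive r (1 : R) (phi i)
     (psi i r + \sum_k Q k i * phi k r)) ->
  phi j u = \sum_i p i j u * phi i 0 +
    \int[lebesgue_measure]_(r in `[0, u]) (\sum_i p i j (u - r) * psi i r).
Proof.
move=> u0 cpsi dphi.
pose F r := \sum_i p i j (u - r) * phi i r.
have dF (r : R) : is_derive r (1 : R) F (\sum_i p i j (u - r) * psi i r).
  have -> : \sum_i p i j (u - r) * psi i r =
      \sum_i ((- \sum_k Q i k * p k j (u - r)) * phi i r +
              p i j (u - r) * (psi i r + \sum_k Q k i * phi k r)).
    apply/esym; rewrite big_split/=.
    under [X in _ + X]eq_bigr do rewrite mulrDr.
    rewrite [X in _ + X]big_split/= addrCA -[RHS]addr0; congr +%R.
    under eq_bigr do rewrite mulNr.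
    rewrite sumrN; apply/eqP; rewrite addrC subr_eq0; apply/eqP.
    under eq_bigr do rewrite mulr_sumr.
    rewrite exchange_big/=; apply: eq_bigr => k _.
    by rewrite mulr_suml; apply: eq_bigr => i _; ring.
  exact: (is_derive_bigsum _ (fun i => is_derive_mulr (is_derive_expmxB i j u r)
    (dphi i r))).
rewrite (Rintegral_derive u0 dF); last first.
  move=> r; apply: (@cvg_bigsum _ _ _ _ _ _ (fun i r => p i j (u - r) * psi i r)).
  by move=> i; apply: cvgM; [exact: continuous_expmxB|exact: cpsi].
rewrite /F subr0 subrr scale0r expmx0 addrCA subrr addr0.
rewrite (bigD1 j)//= mxE eqxx mul1r big1 ?addr0// => i ij.
by rewrite mxE (negbTE ij) mul0r.
Qed.

Lemma expmx_bounded (U : R) :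
  exists2 C : R, 0 < C & forall i j r, 0 <= r <= U -> `|p i j r| <= C.
Proof.
have H i j : exists C : R, forall r, 0 <= r <= U -> `|p i j r| <= C.
  have /compact_bounded[M [_ HM]] : compact ((fun r : R => p i j r) @` `[0, U]).
    apply: continuous_compact; last exact: segment_compact.
    exact: (continuous_subspaceT (@continuous_expmx _ _ Q i j)).
  by exists (M + 1) => r rU; apply: HM; [rewrite ltrDl|exists r].
have [c Hc] := choice (fun ij => H ij.1 ij.2).
exists (1 + \sum_ij `|c ij|); first by rewrite ltr_pwDl// sumr_ge0.
move=> i j r rU; apply: le_trans (Hc (i, j) r rU) _.
by rewrite (bigD1 (i, j))//= addrCA (le_trans (ler_norm _))// lerDl addr_ge0// sumr_ge0.
Qed.

(** Differentiability of [g] is not assumed, so uniqueness is settled on the integral equation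
    itself: the difference from the exponential solution satisfies a homogeneous Volterra equation,
    which Gronwall's inequality forces to vanish. *)
Lemma mmou_duhamel_unique (alpha gamma : 'rV[R]_n) (f g : 'I_n -> R -> R)
    (U K : R) :
  (forall j u, 0 <= u <= U -> f j u = \sum_i p i j u * f i 0) ->
  (forall i, measurable_fun `[0, U] (g i)) ->
  (forall i u, 0 <= u <= U -> `|g i u| <= K) ->
  (forall j u, 0 <= u <= U ->
    g j u = \sum_i p i j u * g i 0 +
    \int[lebesgue_measure]_(r in `[0, u])
      (\sum_i p i j (u - r) * (alpha 0 i * f i r - gamma 0 i * g i r))) ->
  forall u, 0 <= u <= U ->
  col_mx (\col_i f i u) (\col_i g i u) =
  expmx (u *: mmou_matrix Q alpha gamma) *m
    col_mx (\col_i f i 0) (\col_i g i 0).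
Proof.
move=> fE mg gK gE u uU.
set A := mmou_matrix Q alpha gamma; set v := col_mx (\col_i f i 0) (\col_i g i 0).
pose w k r := (expmx (r *: A) *m v) k 0.
pose fs i r := w (lshift n i) r; pose gs i r := w (rshift n i) r.
have dw k (r : R) : is_derive r (1 : R) (w k) (\sum_l A k l * w l r).
  have -> : w k = fun r => \sum_l expmx (r *: A) k l * v l 0.
    by apply/funext => x; rewrite /w [(_ *m _) _ _]mxE.
  have -> : \sum_l A k l * w l r =
      \sum_l ((\sum_m A k m * expmx (r *: A) m l) * v l 0 + expmx (r *: A) k l * 0).
    under [RHS]eq_bigr do rewrite mulr0 addr0 mulr_suml.
    rewrite exchange_big/=; apply: eq_bigr => l _; rewrite /w [(_ *m _) _ _]mxE mulr_sumr.
    by apply: eq_bigr => m _; rewrite mulrA.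
  exact: (is_derive_bigsum _ (fun l => is_derive_mulr (is_derive_expmx A k l r)
    (is_derive_cst (v l 0) r 1))).
have dfs i (r : R) : is_derive r (1 : R) (fs i) (0 + \sum_k Q k i * fs k r).
  have -> : 0 + \sum_k Q k i * fs k r = \sum_l A (lshift n i) l * w l r.
    rewrite add0r big_split_ord/= [X in _ + X]big1 ?addr0.
      by apply: eq_bigr => k _; rewrite /A /mmou_matrix block_mxEul mxE.
    by move=> k _; rewrite /A /mmou_matrix block_mxEur mxE mul0r.
  exact: dw.
(* This is the lower block row of R; the transpose of [Q] puts the summation on its first index, as
   [duhamel] expects. *)
have dgs i (r : R) : is_derive r (1 : R) (gs i)
    (alpha 0 i * fs i r - gamma 0 i * gs i r + \sum_k Q k i * gs k r).
  have -> : alpha 0 i * fs i r - gamma 0 i * gs i r + \sum_k Q k i * gs k r =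
      \sum_l A (rshift n i) l * w l r.
    rewrite big_split_ord/= -addrA; congr +%R.
      rewrite (bigD1 i)//= big1 ?addr0 => [|k ki].
        by rewrite /A /mmou_matrix block_mxEdl mxE eqxx mulr1n.
      by rewrite /A /mmou_matrix block_mxEdl mxE eq_sym (negbTE ki) mulr0n mul0r.
    apply/esym.
    under eq_bigr do rewrite /A /mmou_matrix block_mxEdr 3!mxE mulrDl.
    rewrite big_split/= addrC; congr +%R.
    rewrite (bigD1 i)//= big1 ?addr0 => [|k ki].
      by rewrite mxE eqxx mulr1n mulNr.
    by rewrite mxE eq_sym (negbTE ki) mulr0n oppr0 mul0r.
  exact: dw.
have w0 k : w k 0 = v k 0 by rewrite /w scale0r expmx0 mul1mx.
have fs0 i : fs i 0 = f i 0 by rewrite /fs w0 col_mxEu mxE.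
have gs0 i : gs i 0 = g i 0 by rewrite /gs w0 col_mxEd mxE.
have cw k : continuous (w k) := is_derive_continuous (dw k).
have fsE j r : 0 <= r <= U -> fs j r = f j r.
  move=> /[dup] rU /andP[r0 _].
  rewrite fE// (@duhamel fs (fun _ _ => 0) r j r0)//; last first.
    by move=> i x; exact: cvg_cst.
  under [X in _ + X]eq_Rintegral do under eq_bigr do rewrite mulr0.
  under [X in _ + X]eq_Rintegral do rewrite big1//.
  rewrite Rintegral_cst// mul0r addr0.
  by apply: eq_bigr => i _; rewrite fs0.
have [C C0 HC] := expmx_bounded U.
pose del i r := g i r - gs i r.
have mp i j r : measurable_fun `[0, U] (fun x => p i j (r - x)).
  by apply: measurable_funTS; apply: continuous_measurable_fun;
    exact: continuous_expmxB.
have mgs i : measurable_fun `[0, U] (gs i).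
  by apply: measurable_funTS; apply: continuous_measurable_fun; exact: cw.
have mdel i : measurable_fun `[0, U] (del i) by exact: measurable_funB.
have [D D0 HD] : exists2 D : R, 0 <= D &
    forall i r, 0 <= r <= U -> `|del i r| <= D.
  have H i : exists D : R, forall r, 0 <= r <= U -> `|gs i r| <= D.
    have /compact_bounded[M [_ HM]] : compact (gs i @` `[0, U]).
      apply: continuous_compact; last exact: segment_compact.
      exact: (continuous_subspaceT (cw _)).
    by exists (M + 1) => r rU; apply: HM; [rewrite ltrDl|exists r].
  have [c Hc] := choice H.
  exists (`|K| + \sum_i `|c i|); first by rewrite addr_ge0// sumr_ge0.
  move=> i r rU; rewrite (le_trans (ler_normB _ _))// lerD//.
    by rewrite (le_trans (gK i r rU))// ler_norm.
  rewrite (le_trans (Hc i r rU))// (bigD1 i)//= (le_trans (ler_norm _))//.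
  by rewrite lerDl sumr_ge0.
have idel r i : 0 <= r <= U ->
    lebesgue_measure.-integrable `[0, r] (EFin \o del i).
  move=> /andP[r0 rU]; apply: (@integrable_itv_bounded _ _ _ D).
    apply: measurable_funS (mdel i) => //.
    by apply: subset_itvl; rewrite bnd_simp.
  by move=> x /andP[x0 xr]; rewrite HD// x0 (le_trans xr).
have idel' r j i : 0 <= r <= U -> lebesgue_measure.-integrable `[0, r]
    (EFin \o (fun x => p i j (r - x) * (gamma 0 i * del i x))).
  move=> /[dup] rU01 /andP[r0 rU].
  apply: (@integrable_itv_bounded _ _ _ (C * (`|gamma 0 i| * D))).
    apply: (@measurable_funS _ _ _ _ `[0, U]) => //.
      by apply: subset_itvl; rewrite bnd_simp.
    by apply: measurable_funM => //; exact: measurable_funM.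
  move=> x /andP[x0 xr]; rewrite !normrM ler_pM ?mulr_ge0//.
    by apply: HC; rewrite subr_ge0 xr/= lerBlDr (le_trans rU)// lerDl.
  by rewrite ler_wpM2l// HD// x0 (le_trans xr).
(* Both functions solve the same equation with the same initial values and, by [fsE], the same
   [alpha] terms, so only the [gamma] term survives in the difference. *)
have delE j r : 0 <= r <= U -> del j r =
    - \int[lebesgue_measure]_(x in `[0, r])
      (\sum_i p i j (r - x) * (gamma 0 i * del i x)).
  move=> /[dup] rU01 /andP[r0 rU].
  pose psi i x := alpha 0 i * fs i x - gamma 0 i * gs i x.
  have cpsi i : continuous (psi i).
    by move=> x; apply: cvgB; apply: cvgM; try exact: cvg_cst; exact: cw.
  have ipsi : lebesgue_measure.-integrable `[0, r]
      (EFin \o (fun x => \sum_i p i j (r - x) * psi i x)).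
    apply: continuous_compact_integrable; first exact: segment_compact.
    apply: continuous_subspaceT => x.
    apply: (@cvg_bigsum _ _ _ _ _ _ (fun i x => p i j (r - x) * psi i x)) => i.
    by apply: cvgM; [exact: continuous_expmxB|exact: cpsi].
  rewrite /del gE// (@duhamel gs psi r j r0 cpsi dgs).
  under [X in _ - (X + _)]eq_bigr do rewrite gs0.
  rewrite opprD addrACA subrr add0r.
  under eq_Rintegral => x.
    rewrite inE/= in_itv/= => /andP[x0 xr].
    under eq_bigr => i _.
      have -> : alpha 0 i * f i x - gamma 0 i * g i x = psi i x - gamma 0 i * del i x.
        by rewrite /psi fsE ?x0 ?(le_trans xr)// /del; ring.
      rewrite mulrBr.
      over.
    rewrite sumrB.
    over.
  rewrite RintegralB//; first by rewrite addrAC subrr add0r.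
  by apply: integrable_bigsum => // i; exact: idel'.
pose Phi r := \sum_j `|del j r|.
have Phi0 : forall r, 0 <= r <= U -> Phi r <= 0.
  (* The equation for one coordinate contributes C times the sum of the |gamma_i|, the factor [n]
     comes from adding the coordinates, and the 1 makes the rate positive. With constant term 0,
     Gronwall's inequality gives Phi <= 0. *)
  pose G := 1 + n%:R * C * \sum_i `|gamma 0 i|.
  have G0 : 0 < G by rewrite ltr_pwDl// !mulr_ge0 ?(ltW C0)// sumr_ge0.
  move=> r rU; have := @gronwall _ Phi 0 G (n%:R * D) U (lexx 0) G0 _ _ _ r rU.
  rewrite mulr0 mul0r; apply.
  - apply: measurable_sum => i; exact: measurableT_comp.
  - move=> s sU; rewrite sumr_ge0//=.
    rewrite (@le_trans _ _ (\sum_(j < n) D))// ?ler_sum// => [j _|].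
      exact: HD.
    by rewrite sumr_const card_ord mulr_natl.
  move=> s /[dup] sU01 /andP[s0 sU]; rewrite add0r.
  have iPhi : lebesgue_measure.-integrable `[0, s] (EFin \o Phi).
    apply: integrable_bigsum => // i.
    by apply: integrable_norm; exact: idel.
  apply: (@le_trans _ _ (\sum_(j < n) (C * (\sum_i `|gamma 0 i|)) *
     \int[lebesgue_measure]_(x in `[0, s]) Phi x)).
    apply: ler_sum => j _; rewrite delE// normrN.
    rewrite (le_trans (le_normr_Rintegral _ _))//.
      by apply: integrable_bigsum => // i; exact: idel'.
    rewrite -RintegralZl//; apply: le_Rintegral => //.
    - apply: integrable_norm => //.
      by apply: integrable_bigsum => // i; exact: idel'.
    - exact: integrable_EFinZ.
    move=> x /=; rewrite in_itv/= => /andP[x0 xs].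
    rewrite (le_trans (ler_norm_sum _ _ _))// -mulrA mulr_suml mulr_sumr.
    apply: ler_sum => i _; rewrite !normrM ler_pM ?mulr_ge0//.
      by apply: HC; rewrite subr_ge0 xs/= lerBlDr (le_trans sU)// lerDl.
    rewrite ler_wpM2l// /Phi (bigD1 i)//= lerDl sumr_ge0//.
  rewrite -mulr_suml sumr_const card_ord ler_wpM2r ?Rintegral_ge0//.
    by move=> x _; rewrite sumr_ge0.
  by rewrite -mulr_natl mulrA /G lerDr.
apply/matrixP => k z; rewrite (ord1 z) -/(w k u).
have [i ->|i ->] := split_ordP k.
  by rewrite col_mxEu mxE -/(fs i u) fsE.
rewrite col_mxEd mxE -/(gs i u).
have : Phi u == 0 by rewrite eq_le Phi0//= sumr_ge0.
rewrite psumr_eq0// => /allP/(_ i); rewrite mem_index_enum => /(_ isT)/=.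
by rewrite normr_eq0 subr_eq0 => /eqP.
Qed.

End duhamel.

(** * Square-integrable functions and monotone classes *)

(** Integrating (f - l g)^2 >= 0 gives 2 l H <= F + l^2 G for every l, and l = H / G is the optimal
    choice. *)
Lemma cauchy_schwarz_Rintegral {d} {T : measurableType d} {R : realType}
    (mu : {measure set T -> \bar R}) (D : set T) (f g : T -> R) :
  measurable D ->
  mu.-integrable D (EFin \o (fun x => f x ^+ 2)) ->
  mu.-integrable D (EFin \o (fun x => g x ^+ 2)) ->
  mu.-integrable D (EFin \o (fun x => f x * g x)) ->
  (\int[mu]_(x in D) (f x * g x)) ^+ 2 <=
  \int[mu]_(x in D) (f x ^+ 2) * \int[mu]_(x in D) (g x ^+ 2).
Proof.
move=> mD f2 g2 fg.
set H := \int[mu]_(x in D) (f x * g x).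
set F := \int[mu]_(x in D) (f x ^+ 2); set G := \int[mu]_(x in D) (g x ^+ 2).
have key l : 2 * l * H <= F + l ^+ 2 * G.
  rewrite /H /F /G -!RintegralZl//.
  rewrite -RintegralD//; last exact: integrable_EFinZ.
  apply: le_Rintegral => //.
  - exact: integrable_EFinZ.
  - by apply: integrable_EFinD => //; exact: integrable_EFinZ.
  - move=> x _; rewrite -subr_ge0.
    have -> : f x ^+ 2 + l ^+ 2 * g x ^+ 2 - 2 * l * (f x * g x) =
      (f x - l * g x) ^+ 2 by ring.
    exact: sqr_ge0.
have G0 : 0 <= G by apply: Rintegral_ge0 => x _; exact: sqr_ge0.
move: G0; rewrite le_eqVlt => /predU1P[G0|G0].
  have [->|H0] := eqVneq H 0; first by rewrite expr0n/= -G0 mulr0.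
  (* When G = 0 and H is nonzero, this l turns the inequality into F + 1 <= F. *)
  have := key ((F + 1) / (2 * H)); rewrite -G0 mulr0 addr0.
  rewrite (_ : _ * H = F + 1); last by field.
  by rewrite gerDl ler10.
have := key (H / G).
rewrite (_ : 2 * _ * _ = 2 * (H ^+ 2 / G)); last by ring.
rewrite (_ : _ ^+ 2 * G = H ^+ 2 / G); last by field; rewrite gt_eqF.
rewrite mulr2n mulrDl mul1r lerD2r => h.
by rewrite -ler_pdivrMr.
Qed.

Section Lfun2.
Context {d} {T : measurableType d} {R : realType}.
Variable P : probability T R.
Implicit Types f g : T -> R.

Lemma Lfun_measurable p f : f \in Lfun P p -> measurable_fun setT f.
Proof. by rewrite inE => /andP[]; rewrite inE. Qed.

Lemma Lfun2_lty f : measurable_fun setT f ->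
  (\int[P]_w (f w ^+ 2)%:E < +oo)%E -> f \in Lfun P 2%:E.
Proof.
move=> mf foo; rewrite inE; apply/andP; split; rewrite inE//=.
rewrite /finite_norm unlock poweR_lty//.
apply: le_lt_trans foo; rewrite le_eqVlt; apply/orP; left; apply/eqP.
apply: eq_integral => x _ /=.
by rewrite powR_mulrn// -normrX ger0_norm// sqr_ge0.
Qed.

Lemma Lfun2_sqr_lty f : f \in Lfun P 2%:E -> (\int[P]_w (f w ^+ 2)%:E < +oo)%E.
Proof.
move=> /Lfun2_integrable_sqr/integrableP[_]; apply: le_lt_trans.
by rewrite le_eqVlt; apply/orP; left; apply/eqP; apply: eq_integral => x _ /=;
  rewrite ger0_norm// sqr_ge0.
Qed.

Lemma bounded_Lfun2 f (C : R) : measurable_fun setT f -> (forall w, `|f w| <= C) ->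
  f \in Lfun P 2%:E.
Proof.
move=> mf fC; apply: Lfun2_lty => //.
apply: (@le_lt_trans _ _ (\int[P]_w (C ^+ 2)%:E)%E).
  apply: ge0_le_integral => //.
  - by move=> x _; rewrite lee_fin sqr_ge0.
  - by apply/measurable_EFinP; exact: measurable_funX.
  - move=> x _; rewrite lee_fin -(real_normK (num_real (f x))).
    by rewrite ler_pXn2r// nnegrE// (le_trans _ (fC x)).
by rewrite integral_cst//= probability_setT mule1 ltry.
Qed.

Lemma Lfun2_mul f g : f \in Lfun P 2%:E -> g \in Lfun P 2%:E ->
  P.-integrable setT (EFin \o (fun w => f w * g w)).
Proof. by move=> f2 g2; apply/Lfun1_integrable; exact: Lfun2_mul_Lfun1. Qed.

Lemma Lfun2_integrable f : f \in Lfun P 2%:E -> P.-integrable setT (EFin \o f).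
Proof.
move=> f2; apply/Lfun1_integrable; apply: Lfun_subset12 => //.
exact: fin_num_measure.
Qed.

Lemma Lfun2_bounded_mul f g (C : R) : measurable_fun setT g ->
  (forall w, `|g w| <= C) -> f \in Lfun P 2%:E ->
  (fun w => g w * f w) \in Lfun P 2%:E.
Proof.
move=> mg gC f2; have mf := Lfun_measurable f2.
apply: Lfun2_lty; first exact: measurable_funM.
apply: (@le_lt_trans _ _ (\int[P]_w ((C ^+ 2)%:E * (f w ^+ 2)%:E))%E).
  apply: ge0_le_integral => //.
  - by move=> x _; rewrite lee_fin sqr_ge0.
  - by apply/measurable_EFinP; apply: measurable_funX; exact: measurable_funM.
  - apply: measurable_funeM; apply/measurable_EFinP; exact: measurable_funX.
  - move=> x _; rewrite -EFinM lee_fin exprMn ler_wpM2r ?sqr_ge0//.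
    rewrite -(real_normK (num_real (g x))).
    by rewrite ler_pXn2r// nnegrE// (le_trans _ (gC x)).
rewrite ge0_integralZl//; last 3 first.
- by apply/measurable_EFinP; exact: measurable_funX.
- by move=> x _; rewrite lee_fin sqr_ge0.
- by rewrite lee_fin sqr_ge0.
by rewrite lte_mul_pinfty// ?lee_fin ?sqr_ge0//; exact: Lfun2_sqr_lty.
Qed.

Let le12 : (1 <= 2%:E :> \bar R)%E. Proof. by rewrite lee1n. Qed.

Lemma Lfun2_add f g : f \in Lfun P 2%:E -> g \in Lfun P 2%:E ->
  (fun w => f w + g w) \in Lfun P 2%:E.
Proof. exact: (Lfun_addr_closed P le12).2. Qed.

Lemma Lfun2_sub f g : f \in Lfun P 2%:E -> g \in Lfun P 2%:E ->
  (fun w => f w - g w) \in Lfun P 2%:E.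
Proof.
by move=> f2 g2; apply: Lfun2_add => //; exact: (Lfun_oppr_closed g2).
Qed.

Lemma Lfun2_sum {I : Type} (r : seq I) (f : I -> T -> R) :
  (forall i, f i \in Lfun P 2%:E) -> (fun w => \sum_(i <- r) f i w) \in Lfun P 2%:E.
Proof.
move=> f2; elim: r => [|i r IH].
  by under eq_fun do rewrite big_nil; exact: (Lfun_addr_closed P le12).1.
by under eq_fun do rewrite big_cons; exact: Lfun2_add.
Qed.

End Lfun2.

Import HBNNSimple.

Section sigma_algebra_agreement.
Context {d} {T : measurableType d} {R : realType}.
Variables (P : probability T R) (G : set (set T)).
Hypotheses (Gm : G `<=` measurable) (GI : setI_closed G).

Lemma g_sigma_algebra_measurable : <<s G >> `<=` @measurable _ T.
Proof. by apply: smallest_sub => //; exact: sigma_algebra_measurable. Qed.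

(** Dynkin's pi-lambda argument. The shape with two sets and a constant serves twice: independence
    of an event A is the case where B is the whole space and c = P(A), and the Markov property is
    the case A = {X_s = i, X_(s+h) = j}, B = {X_s = i}, c = p_ij(h). The relation between P(A) and
    P(B) is the instance E = whole space, on which complements rely. *)
Lemma g_sigma_algebra_agree (A B : set T) (c : R) :
  measurable A -> measurable B -> P A = (c%:E * P B)%E ->
  (forall E, G E -> P (E `&` A) = (c%:E * P (E `&` B))%E) ->
  forall E, <<s G >> E -> P (E `&` A) = (c%:E * P (E `&` B))%E.
Proof.
move=> mA mB AB GAB E.
rewrite -(setI_closed_g_dynkin_g_sigma_algebra GI) => GE.
suff [] : measurable E /\ P (E `&` A) = (c%:E * P (E `&` B))%E by [].
apply: (GE [set E | measurable E /\ P (E `&` A) = (c%:E * P (E `&` B))%E]).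
split; last first.
  by move=> F GF; split; [exact: Gm|exact: GAB].
split => /=.
- by split => //; rewrite !setTI.
- move=> F [mF PF]; split; first exact: measurableC.
  have D C : measurable C -> (P (~` F `&` C) = P C - P (F `&` C))%E.
    move=> mC; rewrite setIC -setDE measureD//; last by rewrite ltey_eq fin_num_measure.
    by rewrite setIC.
  by rewrite !D// PF AB muleBr// fin_num_adde_defr// fin_num_measure.
- move=> F tF FAB; have mF k : measurable (F k) by have [] := FAB k.
  split; first exact: bigcupT_measurable.
  have S C : measurable C ->
      (fun k => \sum_(0 <= i < k) P (F i `&` C))%E @ \oo --> P (\bigcup_k F k `&` C).
    move=> mC; rewrite setI_bigcupl; apply: measure_semi_sigma_additive.
    - by move=> k; exact: measurableI.
    - exact: trivIset_setIr.
    - by apply: bigcupT_measurable => k; exact: measurableI.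
  apply: cvg_unique (S _ mA) _ => //.
  rewrite (_ : (fun k => _) =
      (fun k => c%:E * \sum_(0 <= i < k) P (F i `&` B))%E); last first.
    apply/funext => k; rewrite ge0_sume_distrr//.
    by apply: eq_bigr => i _; have [] := FAB i.
  by apply: cvgeZl => //; exact: S.
Qed.

Lemma ge0_integral_agree (A B : set T) (c : R) (f : T -> \bar R) :
  measurable A -> measurable B ->
  (forall E, <<s G >> E -> P (E `&` A) = (c%:E * P (E `&` B))%E) ->
  measurable_fun setT (f : g_sigma_algebraType G -> \bar R) ->
  (forall w, 0 <= f w)%E ->
  (\int[P]_(w in A) f w = c%:E * \int[P]_(w in B) f w)%E.
Proof.
move=> mA mB AB mf f0.
have PAB : P A = (c%:E * P B)%E.
  rewrite -[A]setTI -[B in RHS]setTI; apply: AB.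
  exact: (@measurableT _ (g_sigma_algebraType G)).
have mfT : measurable_fun setT f.
  move=> _ Y mY; apply: g_sigma_algebra_measurable.
  exact: (mf measurableT).
have [c0|c0] := ltP c 0.
  have PB : P B = 0%E.
    apply/eqP; rewrite eq_le measure_ge0 andbT.
    have : (0 <= P A)%E by [].
    by rewrite PAB nmule_rge0// lte_fin.
  have PA : P A = 0%E by rewrite PAB PB mule0.
  by rewrite !null_set_integral ?mule0//; exact: measurable_funTS.
(* The approximation is made on the type carrying the smaller sigma-algebra, so that level sets lie
   in it; [gf] views the same functions on [T]. *)
pose g := nnsfun_approx (@measurableT _ (g_sigma_algebraType G)) mf.
pose gf k : T -> R := fun w => g k (w : g_sigma_algebraType G).
have Gg k Y : measurable Y -> <<s G >> (gf k @^-1` Y).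
  by move=> mY; rewrite -[X in <<s _ >> X]setTI;
    exact: (@measurable_funPT _ _ (g_sigma_algebraType G) _ (g k) _ Y mY).
have mg k : measurable_fun setT (gf k).
  by move=> _ Y mY; rewrite setTI; apply: g_sigma_algebra_measurable; exact: Gg.
have g0 k w : 0 <= gf k w by [].
have nd_g w m k : (m <= k)%N -> gf m w <= gf k w.
  move=> mk; have /lefP := @nd_nnsfun_approx _ (g_sigma_algebraType G) _ _
    measurableT _ mf _ _ mk.
  by move=> /(_ w).
have cvg_g C : measurable C -> (\int[P]_(w in C) f w =
    limn (fun k => \int[P]_(w in C) (gf k w)%:E))%E.
  move=> mC; rewrite -monotone_convergence//.
  - apply: eq_integral => y _; apply/esym/cvg_lim => //.
    by apply: (@cvg_nnsfun_approx _ (g_sigma_algebraType G)).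
  - by move=> k; apply/measurable_EFinP; exact: measurable_funTS.
  - by move=> k y _; rewrite lee_fin.
  - by move=> y _ m k mk; rewrite lee_fin nd_g.
have gfE k w : gf k w = \sum_(y \in range (gf k)) y * \1_(gf k @^-1` [set y]) w.
  exact: (fimfunE (g k) w).
have fin_g k : finite_set (range (gf k)) by exact: (fimfunP (g k)).
have gE k C : measurable C -> (\int[P]_(w in C) (gf k w)%:E =
    \sum_(y \in range (gf k)) y%:E * P ((gf k @^-1` [set y]) `&` C))%E.
  move=> mC.
  have mgy y : measurable (gf k @^-1` [set y]).
    by rewrite -[X in measurable X]setTI; exact: mg.
  under eq_integral do rewrite gfE -fsumEFin//.
  rewrite ge0_integral_fsum//; last 2 first.
  - by move=> y; apply/measurable_EFinP; apply: measurable_funM.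
  - move=> y x _; rewrite lee_fin indicE.
    by have [|_] := boolP (x \in _); rewrite ?mulr0// mulr1 inE/= => <-.
  apply: eq_fsbigr => y /[!inE] -[x _ <-].
  under eq_integral do rewrite EFinM.
  rewrite ge0_integralZl ?integral_indic ?lee_fin//.
  by apply/measurable_EFinP; exact: measurable_indic.
rewrite !cvg_g//.
rewrite (_ : (fun k => \int[P]_(w in A) _)%E =
    (fun k => c%:E * \int[P]_(w in B) (gf k w)%:E)%E); last first.
  apply/funext => k; rewrite !gE// ge0_mule_fsumr; last first.
    move=> y; have [->|/set0P[w /= <-]] := eqVneq (gf k @^-1` [set y]) set0.
      by rewrite set0I measure0 mule0.
    by rewrite mule_ge0// lee_fin.
  by apply: eq_fsbigr => y _; rewrite AB; [rewrite muleCA|exact: Gg].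
rewrite limeMl//.
apply: ereal_nondecreasing_is_cvgn => a b ab.
apply: ge0_le_integral => //.
- by move=> x _; rewrite lee_fin.
- by apply/measurable_EFinP; exact: measurable_funTS.
- by apply/measurable_EFinP; exact: measurable_funTS.
- by move=> x _; rewrite lee_fin nd_g.
Qed.

Lemma Rintegral_agree (A B : set T) (c : R) (f : T -> R) :
  measurable A -> measurable B ->
  (forall E, <<s G >> E -> P (E `&` A) = (c%:E * P (E `&` B))%E) ->
  measurable_wrt <<s G >> f -> P.-integrable setT (EFin \o f) ->
  \int[P]_(w in A) f w = c * \int[P]_(w in B) f w.
Proof.
move=> mA mB AB mf fi.
have mf' : measurable_fun setT (EFin \o f : g_sigma_algebraType G -> \bar R).
  by apply/measurable_EFinP => _ Y mY; rewrite setTI; exact: mf.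
rewrite /Rintegral -[c in RHS]/(fine c%:E) -fineM//; last first.
  by apply: integrable_fin_num => //; exact: integrableS fi.
congr fine; rewrite integralE [in RHS]integralE muleBr//; last first.
  by apply: integrable_add_def => //; exact: integrableS fi.
congr (_ - _)%E; apply: ge0_integral_agree => //.
  exact: measurable_funepos.
exact: measurable_funeneg.
Qed.

End sigma_algebra_agreement.

(** The joint law and the product of the marginal laws agree on rectangles, hence everywhere, and
    Fubini's theorem factors the integral of the product of the coordinates. *)
Lemma indep_RintegralM {d} {T : measurableType d} {R : realType}
    (P : probability T R) (V W : T -> R) :
  (forall A B, measurable A -> measurable B ->
    P (V @^-1` A `&` W @^-1` B) = (P (V @^-1` A) * P (W @^-1` B))%E) ->
  P.-integrable setT (EFin \o V) -> P.-integrable setT (EFin \o W) ->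
  P.-integrable setT (EFin \o (fun w => V w * W w)) /\
  \int[P]_w (V w * W w) = (\int[P]_w V w) * (\int[P]_w W w).
Proof.
move=> VW iV iW.
have mV : measurable_fun setT V by apply/measurable_EFinP; exact: measurable_int iV.
have mW : measurable_fun setT W by apply/measurable_EFinP; exact: measurable_int iW.
have mVW : measurable_fun setT (fun w => (V w, W w)) by exact: measurable_fun_pair.
pose V' : {RV P >-> R} := HB.pack V (isMeasurableFun.Build _ _ _ _ V mV).
pose W' : {RV P >-> R} := HB.pack W (isMeasurableFun.Build _ _ _ _ W mW).
pose VW' : {RV P >-> (R * R)%type} :=
  HB.pack (fun w => (V w, W w)) (isMeasurableFun.Build _ _ _ _ _ mVW).
have law : forall E, measurable E ->
    (distribution P V' \x distribution P W')%E E = distribution P VW' E.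
  by apply: product_measure_unique => A B mA mB; exact: VW.
pose f (z : R * R) := (z.1 * z.2)%:E.
have mf : measurable_fun setT f by apply/measurable_EFinP; exact: measurable_funM.
have iV' : (distribution P V').-integrable setT EFin.
  apply/integrableP; split; first exact: EFin_measurable.
  rewrite ge0_integral_distribution//; last exact: measurableT_comp.
  by case/integrableP: iV.
have iW' : (distribution P W').-integrable setT EFin.
  apply/integrableP; split; first exact: EFin_measurable.
  rewrite ge0_integral_distribution//; last exact: measurableT_comp.
  by case/integrableP: iW.
have ifp : (distribution P V' \x distribution P W')%E.-integrable setT f.
  apply/integrable12ltyP => //.
  under eq_integral => x _.
    under eq_integral do rewrite /f/= normrM EFinM.
    rewrite ge0_integralZl//; last by apply/measurable_EFinP; exact: normr_measurable.
    rewrite muleC.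
    over.
  rewrite ge0_integralZl//; last 2 first.
  - apply/measurable_EFinP; exact: normr_measurable.
  - exact: integral_ge0.
  apply: lte_mul_pinfty.
  - exact: integral_ge0.
  - rewrite ge0_fin_numE ?integral_ge0//; by case/integrableP: iW'.
  - by case/integrableP: iV'.
have iVW : P.-integrable setT (EFin \o (fun w => V w * W w)).
  apply/integrableP; split; first exact/measurable_EFinP/measurable_funM.
  have -> : (\int[P]_w `|(EFin \o (fun w => (V w * W w)%R)) w| =
      \int[distribution P VW']_z `|f z|)%E.
    by rewrite ge0_integral_distribution//; exact: measurableT_comp.
  rewrite (eq_measure_integral (distribution P V' \x distribution P W')%E).
    by case/integrableP: ifp.
  by move=> E mE _; apply/esym; exact: law.
split => //.
have -> : \int[P]_w (V w * W w) = fine (\int[distribution P VW']_z f z).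
  by rewrite integral_distribution//.
rewrite (eq_measure_integral (distribution P V' \x distribution P W')%E); last first.
  by move=> E mE _; apply/esym; exact: law.
rewrite -integral12_prod_meas1// /fubini_F.
have -> : \int[P]_w V w = \int[distribution P V']_x x.
  by rewrite /Rintegral integral_distribution.
have -> : \int[P]_w W w = \int[distribution P W']_x x.
  by rewrite /Rintegral integral_distribution.
rewrite /Rintegral -fineM ?integrable_fin_num//; congr fine.
under [LHS]eq_integral => x _.
  under eq_integral do rewrite /f/= EFinM.
  rewrite integralZl// -[X in (_ * X)%E]fineK ?integrable_fin_num// muleC.
  over.
by rewrite integralZl// muleC fineK ?integrable_fin_num.
Qed.

(** * Moments of the normal law *)

Import HBNNSimple.

Section normal_moments.
Context {R : realType}.
Notation mu := lebesgue_measure.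

(** On indicators this is the definition of [normal_prob]; simple functions and monotone convergence
    extend it. *)
Lemma ge0_integral_normal_prob (m s : R) (f : R -> \bar R) :
  measurable_fun setT f -> (forall x, 0 <= f x)%E ->
  (\int[normal_prob m s]_x f x = \int[mu]_x (f x * (normal_pdf m s x)%:E))%E.
Proof.
move=> mf f0; pose g := nnsfun_approx measurableT mf.
have mpdf : measurable_fun setT (EFin \o normal_pdf m s).
  by apply/measurable_EFinP; exact: measurable_normal_pdf.
have pdf0 x : (0 <= (normal_pdf m s x)%:E)%E by rewrite lee_fin normal_pdf_ge0.
have mg k : measurable_fun setT (EFin \o g k) by exact/measurable_EFinP.
have nd_g x a b : (a <= b)%N -> g a x <= g b x.
  by move=> ab; have /lefP := nd_nnsfun_approx measurableT mf ab; apply.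
have cvg_g x : EFin \o g ^~ x @ \oo --> f x by exact: cvg_nnsfun_approx.
have -> : (\int[normal_prob m s]_x f x =
    limn (fun k => \int[normal_prob m s]_x (g k x)%:E))%E.
  rewrite -monotone_convergence//.
  - by apply: eq_integral => x _; apply/esym/cvg_lim => //; exact: cvg_g.
  - by move=> k x _; rewrite lee_fin.
  - by move=> x _ a b ab; rewrite lee_fin nd_g.
have -> : (\int[mu]_x (f x * (normal_pdf m s x)%:E) =
    limn (fun k => \int[mu]_x ((g k x)%:E * (normal_pdf m s x)%:E)))%E.
  rewrite -monotone_convergence//.
  - apply: eq_integral => x _; apply/esym/cvg_lim => //.
    by apply: cvgeZr => //; exact: cvg_g.
  - by move=> k; apply: emeasurable_funM; [exact: mg|exact: mpdf].
  - by move=> k x _; rewrite mule_ge0// lee_fin.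
  - by move=> x _ a b ab; rewrite lee_wpmul2r// lee_fin nd_g.
congr (limn _); apply/funext => k.
have mgy y : measurable (g k @^-1` [set y]).
  by rewrite -[X in measurable X]setTI; exact: measurable_funPT.
have y0 x : 0 <= g k x by [].
under eq_integral do rewrite fimfunE -fsumEFin//.
rewrite ge0_integral_fsum//; last 2 first.
- move=> y; apply/measurable_EFinP; apply: measurable_funM; first exact: measurable_cst.
  by apply: measurable_indic; exact: mgy.
- by move=> y x _; rewrite nnfun_muleindic_ge0.
under [RHS]eq_integral => x _.
  rewrite fimfunE -fsumEFin// ge0_mule_fsuml; last first.
    by move=> y; exact: nnfun_muleindic_ge0.
  over.
rewrite ge0_integral_fsum//; last 2 first.
- move=> y; apply: emeasurable_funM => //.
  apply/measurable_EFinP; apply: measurable_funM; first exact: measurable_cst.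
  by apply: measurable_indic; exact: mgy.
- by move=> y x _; rewrite mule_ge0// nnfun_muleindic_ge0.
apply: eq_fsbigr => y /[!inE] -[x _ <-].
under eq_integral do rewrite EFinM.
under [RHS]eq_integral do rewrite EFinM -muleA.
have m1 : measurable_fun setT (EFin \o (\1_(g k @^-1` [set g k x]) : R -> R)).
  by apply/measurable_EFinP; apply: measurable_indic; exact: mgy.
rewrite ge0_integralZl//.
rewrite ge0_integralZl//; last 3 first.
- by apply: emeasurable_funM; [exact: m1|exact: mpdf].
- by move=> z _; rewrite mule_ge0// lee_fin.
- by rewrite lee_fin.
rewrite integral_indic//; last exact: mgy.
rewrite setIT; congr (_ * _)%E.
transitivity (\int[mu]_(z in g k @^-1` [set g k x]) (normal_pdf m s z)%:E)%E => //.
rewrite [LHS]integral_mkcond; apply: eq_integral => z _.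
  by rewrite patchE indicE; case: ifPn => _; rewrite ?mul1e ?mul0e.
by rewrite lee_fin.
Qed.

Section variance.
Variable s : R.
Hypothesis s0 : 0 < s.
Notation q := (normal_pdf 0 s).
Let sN0 : s != 0. Proof. by rewrite gt_eqF. Qed.

(* Both comparisons are e^y >= 1 + y applied to a quotient of densities. *)
Lemma normal_pdf_ge_dilated (e x : R) : -1 < e ->
  q x * (1 + x ^+ 2 / (2 * s ^+ 2) * (e / (1 + e))) <=
  Num.sqrt (1 + e) * normal_pdf 0 (s * Num.sqrt (1 + e)) x.
Proof.
move=> e1; have e0 : 0 < 1 + e by lra.
have r0 : 0 < Num.sqrt (1 + e) by rewrite sqrtr_gt0.
rewrite !normal_pdfE ?mulf_neq0 ?gt_eqF// /normal_peak /normal_fun !subr0.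
have e0' := ltW e0.
rewrite exprMn sqr_sqrtr//.
have -> : s ^+ 2 * (1 + e) * pi *+ 2 = (1 + e) * (s ^+ 2 * pi *+ 2) by ring.
rewrite sqrtrM// [(_ * Num.sqrt _)^-1]invfM -[X in _ <= _ * X]mulrA.
rewrite mulVKf ?gt_eqF// -[leLHS]mulrA.
rewrite ler_pM2l ?normal_peak_gt0//.
apply: (@le_trans _ _ (expR (- x ^+ 2 / (s ^+ 2 *+ 2)) *
    expR (x ^+ 2 / (2 * s ^+ 2) * (e / (1 + e))))).
  by rewrite ler_wpM2l ?expR_ge0// expR_ge1Dx.
rewrite -expRD ler_expR le_eqVlt; apply/orP; left; apply/eqP.
by field; rewrite (gt_eqF e0) sN0.
Qed.

Lemma normal_pdf_ge_shifted (m x : R) :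
  q x * (1 + (2 * m * x - m ^+ 2) / (2 * s ^+ 2)) <= normal_pdf m s x.
Proof.
rewrite !normal_pdfE// /normal_fun !subr0 -[leLHS]mulrA.
rewrite ler_pM2l ?normal_peak_gt0//.
apply: (@le_trans _ _ (expR (- x ^+ 2 / (s ^+ 2 *+ 2)) *
    expR ((2 * m * x - m ^+ 2) / (2 * s ^+ 2)))).
  by rewrite ler_wpM2l ?expR_ge0// expR_ge1Dx.
rewrite -expRD ler_expR le_eqVlt; apply/orP; left; apply/eqP.
by field; rewrite sN0.
Qed.

Let iq : mu.-integrable setT (EFin \o q) := integrable_normal_pdf 0 s.
Let Iq : \int[mu]_x q x = 1.
Proof. by rewrite /Rintegral integral_normal_pdf. Qed.

(** At e = 1 the dilated comparison bounds q(x) (1 + x^2 / (4 s^2)) by sqrt 2 times a normal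
    density; multiplied by 4 s^2 this dominates x^2 q(x). *)
Lemma integrable_sqr_normal_pdf : mu.-integrable setT (EFin \o (fun x => x ^+ 2 * q x)).
Proof.
have c0 : 0 <= 4 * s ^+ 2 by rewrite mulr_ge0 ?sqr_ge0.
apply: (@le_integrable _ _ _ mu setT _ _ (EFin \o (fun x => 4 * s ^+ 2 *
    (Num.sqrt (1 + 1) * normal_pdf 0 (s * Num.sqrt (1 + 1)) x)))) => //.
- apply/measurable_EFinP; apply: measurable_funM; last exact: measurable_normal_pdf.
  exact: measurable_funX.
- move=> x _; rewrite lee_fin ger0_norm; last first.
    by rewrite mulr_ge0 ?sqr_ge0// normal_pdf_ge0.
  rewrite ger0_norm; last first.
    by rewrite mulr_ge0// mulr_ge0 ?sqrtr_ge0 ?normal_pdf_ge0.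
  have e1 : (-1 : R) < 1 by lra.
  apply: le_trans (ler_wpM2l c0 (normal_pdf_ge_dilated x e1)).
  rewrite (_ : 4 * _ * _ = 4 * s ^+ 2 * q x + x ^+ 2 * q x).
    by rewrite lerDr mulr_ge0// normal_pdf_ge0.
  by field; rewrite sN0.
- apply: integrable_EFinZ => //; apply: integrable_EFinZ => //.
  exact: integrable_normal_pdf.
Qed.

(** Integrating the dilated comparison and using sqrt(1 + e) <= 1 + e / 2 gives V e <= s^2 e (1 + e)
    for every e > -1. Small positive e yield V <= s^2, small negative e the converse. *)
Lemma integral_sqr_normal_pdf : \int[mu]_x (x ^+ 2 * q x) = s ^+ 2.
Proof.
set V := \int[mu]_x _.
have ine e : -1 < e -> V * e <= s ^+ 2 * e * (1 + e).
  move=> e1; have e0 : 0 < 1 + e by lra.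
  have r0 : 0 < Num.sqrt (1 + e) by rewrite sqrtr_gt0.
  have : \int[mu]_x (q x + e / (1 + e) / (2 * s ^+ 2) * (x ^+ 2 * q x)) <=
      \int[mu]_x (Num.sqrt (1 + e) * normal_pdf 0 (s * Num.sqrt (1 + e)) x).
    apply: le_Rintegral => //.
    - apply: integrable_EFinD => //; apply: integrable_EFinZ => //.
      exact: integrable_sqr_normal_pdf.
    - by apply: integrable_EFinZ => //; exact: integrable_normal_pdf.
    - move=> x _; apply: le_trans (normal_pdf_ge_dilated x e1).
      rewrite le_eqVlt; apply/orP; left; apply/eqP.
      by field; rewrite (gt_eqF e0) sN0.
  rewrite RintegralD//; last first.
    by apply: integrable_EFinZ => //; exact: integrable_sqr_normal_pdf.
  rewrite !RintegralZl//; first last.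
  - exact: integrable_sqr_normal_pdf.
  - exact: integrable_normal_pdf.
  rewrite Iq -/V {1}/Rintegral integral_normal_pdf/= mulr1 => h.
  have : 1 + e / (1 + e) / (2 * s ^+ 2) * V <= 1 + e / 2.
    apply: le_trans h _.
    rewrite -(@ler_pXn2r _ 2) ?nnegrE ?sqrtr_ge0//; last lra.
    rewrite sqr_sqrtr; last exact: ltW.
    rewrite -subr_ge0.
    have -> : (1 + e / 2) ^+ 2 - (1 + e) = (e / 2) ^+ 2 by field.
    exact: sqr_ge0.
  rewrite lerD2l => /(ler_wpM2l (_ : 0 <= (1 + e) * (2 * s ^+ 2))) h2.
  have {}h2 := h2 (mulr_ge0 (ltW e0) (mulr_ge0 (ler0n _ 2) (sqr_ge0 s))).
  rewrite (_ : V * e = (1 + e) * (2 * s ^+ 2) * (e / (1 + e) / (2 * s ^+ 2) * V)).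
    apply: le_trans h2 _; rewrite le_eqVlt; apply/orP; left; apply/eqP; by field.
  by field; rewrite (gt_eqF e0) sN0.
have s20 : 0 < s ^+ 2 by rewrite exprn_gt0.
apply/eqP; rewrite eq_le; apply/andP; split; apply/ler_addgt0Pr => d d0.
  pose e := d / s ^+ 2.
  have e0 : 0 < e by rewrite divr_gt0.
  have e1 : -1 < e by lra.
  have := ine e e1; rewrite mulrAC ler_pM2r// => /le_trans; apply.
  by rewrite mulrDr mulr1 /e mulrCA divff ?mulr1// gt_eqF.
(* The cap 1/2 keeps -e above -1, where the comparison is valid. *)
pose e := Num.min (2^-1) (d / s ^+ 2).
have e0 : 0 < e by rewrite lt_min divr_gt0// invr_gt0 ltr0n.
have e2 : e <= 2^-1 by rewrite ge_min lexx.
have ed : e * s ^+ 2 <= d by rewrite -ler_pdivlMr// ge_min lexx orbT.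
have e1 : -1 < - e by lra.
have := ine (- e) e1.
rewrite mulrN -mulrA mulNr mulrN lerN2 mulrCA [V * e]mulrC ler_pM2l//.
rewrite mulrBr mulr1 [s ^+ 2 * e]mulrC => h.
lra.
Qed.

Lemma integrable_normal_pdf_mulx : mu.-integrable setT (EFin \o (fun x => x * q x)).
Proof.
apply: (@le_integrable _ _ _ mu setT _ _ (EFin \o (fun x => q x + x ^+ 2 * q x))) => //.
- apply/measurable_EFinP; apply: measurable_funM; last exact: measurable_normal_pdf.
  exact: measurable_id.
- move=> x _; rewrite lee_fin normrM (ger0_norm (normal_pdf_ge0 _ _ _)).
  have q0 := normal_pdf_ge0 0 s x.
  rewrite [in leRHS]ger0_norm; last by rewrite addr_ge0// mulr_ge0// sqr_ge0.
  rewrite -{2}[q x]mul1r -mulrDl ler_wpM2r ?normal_pdf_ge0//.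
  rewrite -(real_normK (num_real x)); have := sqr_ge0 (`|x| - 1).
  by have := normr_ge0 x; nra.
- by apply: integrable_EFinD => //; exact: integrable_sqr_normal_pdf.
Qed.

(** Integrating the shifted comparison gives 2 m E <= m^2 for every shift m; taking m = E leaves E^2
    <= 0. *)
Lemma integral_normal_pdf_mulx : \int[mu]_x (x * q x) = 0.
Proof.
set E := \int[mu]_x _.
have ine m : 2 * m * E <= m ^+ 2.
  have : \int[mu]_x ((1 - m ^+ 2 / (2 * s ^+ 2)) * q x +
       m / s ^+ 2 * (x * q x)) <= \int[mu]_x normal_pdf m s x.
    apply: le_Rintegral => //.
    - apply: integrable_EFinD => //; apply: integrable_EFinZ => //.
      exact: integrable_normal_pdf_mulx.
    - exact: integrable_normal_pdf.
    - move=> x _; apply: le_trans (normal_pdf_ge_shifted m x).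
      rewrite le_eqVlt; apply/orP; left; apply/eqP.
      by field; rewrite sN0.
  have i1 : mu.-integrable setT (EFin \o (fun x => (1 - m ^+ 2 / (2 * s ^+ 2)) * q x)).
    exact: integrable_EFinZ.
  have i2 : mu.-integrable setT (EFin \o (fun x => m / s ^+ 2 * (x * q x))).
    by apply: integrable_EFinZ => //; exact: integrable_normal_pdf_mulx.
  rewrite RintegralD// RintegralZl// RintegralZl//; last exact: integrable_normal_pdf_mulx.
  rewrite Iq -/E [X in _ <= X]/Rintegral integral_normal_pdf/= mulr1 => h.
  have s20 : 0 < s ^+ 2 by rewrite exprn_gt0.
  have : (2 * s ^+ 2) * (m / s ^+ 2 * E) <= (2 * s ^+ 2) * (m ^+ 2 / (2 * s ^+ 2)).
    by rewrite ler_pM2l ?mulr_gt0//; lra.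
  rewrite (_ : _ * (_ * E) = 2 * m * E); last by field; rewrite sN0.
  by rewrite (_ : _ * (m ^+ 2 / _) = m ^+ 2)//; field; rewrite sN0.
have := ine E; rewrite expr2 -subr_ge0 => h.
have : E ^+ 2 <= 0 by rewrite expr2; lra.
by rewrite le_eqVlt ltNge sqr_ge0 orbF sqrf_eq0 => /eqP.
Qed.

End variance.

Lemma normal_moments {d} {T : measurableType d} (P : probability T R)
    (U : T -> R) (s : R) : 0 < s -> measurable_fun setT U ->
  (forall A, measurable A -> pushforward P U A = normal_prob 0 s A) ->
  [/\ U \in Lfun P 2%:E, \int[P]_w U w = 0 & \int[P]_w (U w ^+ 2) = s ^+ 2].
Proof.
move=> s0 mU lawU.
have ge0U (f : R -> R) : measurable_fun setT f -> (forall x, 0 <= f x) ->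
    (\int[P]_w (f (U w))%:E = \int[mu]_x (f x * normal_pdf 0 s x)%:E)%E.
  move=> mf f0.
  have mf' : measurable_fun setT (EFin \o f) by exact/measurable_EFinP.
  rewrite -(@ge0_integral_pushforward _ _ _ (measurableTypeR R) _ U mU P setT (EFin \o f))//.
    transitivity (\int[normal_prob 0 s]_x (f x)%:E)%E.
      by apply: eq_measure_integral => A mA _; exact: lawU.
    by rewrite ge0_integral_normal_prob// => x; rewrite lee_fin.
  by move=> x _; rewrite lee_fin.
have sq : (\int[P]_w (U w ^+ 2)%:E = (s ^+ 2)%:E)%E.
  rewrite (ge0U (fun x => x ^+ 2)); last 2 first.
  - exact: measurable_funX.
  - by move=> x; exact: sqr_ge0.
  rewrite -(integral_sqr_normal_pdf s0) fineK//.
  by apply: integrable_fin_num => //; exact: integrable_sqr_normal_pdf.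
have U2 : U \in Lfun P 2%:E by apply: Lfun2_lty => //; rewrite sq ltry.
split => //; last by rewrite /Rintegral sq.
have iU := Lfun2_integrable U2.
(* The transfer [ge0U] to the density holds for nonnegative functions, so the mean is computed from
   positive and negative parts. *)
pose pos (x : R) := Num.max x 0; pose neg (x : R) := Num.max (- x) 0.
have mpos : measurable_fun setT pos by exact: measurable_maxr.
have mneg : measurable_fun setT neg by apply: measurable_maxr => //; exact: measurable_funN.
have pos0 x : 0 <= pos x by rewrite le_max lexx orbT.
have neg0 x : 0 <= neg x by rewrite le_max lexx orbT.
have pn x : x = pos x - neg x by rewrite /pos /neg; case: (leP x 0); case: (leP (-x) 0); lra.
have pnn x : pos x <= `|x| /\ neg x <= `|x|.
  by rewrite /pos /neg; split; rewrite ge_max normr_ge0 andbT ?ler_norm// -normrN ler_norm.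
(* The weight [k] lets one statement cover both sides: the density under Lebesgue measure and the
   constant 1 under [P]. *)
have posneg_int d' (T' : measurableType d') (nu : {measure set T' -> \bar R})
    (h k : T' -> R) (f : R -> R) : measurable_fun setT f ->
    (forall x, 0 <= f x <= `|x|) -> measurable_fun setT h -> measurable_fun setT k ->
    (forall x, 0 <= k x) ->
    nu.-integrable setT (EFin \o (fun x => h x * k x)) ->
    nu.-integrable setT (EFin \o (fun x => f (h x) * k x)).
  move=> mf fle mh mk k0 ih; apply: (le_integrable _ _ _ ih) => //.
    by apply/measurable_EFinP; apply: measurable_funM => //; exact: measurableT_comp.
  move=> x _; rewrite lee_fin !normrM ler_wpM2r//.
  by have /andP[? ?] := fle (h x); rewrite ger0_norm.
have mpdf := measurable_normal_pdf 0 s.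
have p0 := normal_pdf_ge0 0 s.
have pos1 x : 0 <= pos x <= `|x| by rewrite pos0 (pnn x).1.
have neg1 x : 0 <= neg x <= `|x| by rewrite neg0 (pnn x).2.
have ix := integrable_normal_pdf_mulx s0.
have mid : measurable_fun setT (id : R -> R) by exact: measurable_id.
have ip := @posneg_int _ _ mu id _ pos mpos pos1 mid mpdf p0 ix.
have im := @posneg_int _ _ mu id _ neg mneg neg1 mid mpdf p0 ix.
have iU1 : P.-integrable setT (EFin \o (fun w => U w * cst 1 w)).
  by apply: eq_integrable iU => // w _ /=; rewrite mulr1.
have m1 : measurable_fun setT (cst 1 : T -> R) by exact: measurable_cst.
have l01 : forall w : T, 0 <= (cst 1 w : R) by [].
have ipU := @posneg_int _ _ P U _ pos mpos pos1 mU m1 l01 iU1.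
have imU := @posneg_int _ _ P U _ neg mneg neg1 mU m1 l01 iU1.
have -> : \int[P]_w U w = \int[P]_w (pos (U w) * cst 1 w - neg (U w) * cst 1 w).
  by apply: eq_Rintegral => w _; rewrite /= !mulr1 -pn.
rewrite RintegralB//.
have -> : \int[P]_w (pos (U w) * cst 1 w) = \int[mu]_x (pos x * normal_pdf 0 s x).
  by rewrite /Rintegral -ge0U//; congr fine; apply: eq_integral => w _ /=; rewrite mulr1.
have -> : \int[P]_w (neg (U w) * cst 1 w) = \int[mu]_x (neg x * normal_pdf 0 s x).
  by rewrite /Rintegral -ge0U//; congr fine; apply: eq_integral => w _ /=; rewrite mulr1.
rewrite -RintegralB// -[RHS](integral_normal_pdf_mulx s0).
by apply: eq_Rintegral => x _; rewrite -mulrBl -pn.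
Qed.

End normal_moments.

(** * Filtrations and Brownian increments *)

Section right_continuous_processes.
Context {R : realType} {d} {T : measurableType d}.

(* Phi is the pointwise limit of its values at the next point of the grid
   (1/(k+1)) Z, which are countably-valued in time. *)
Lemma right_continuous_measurable_prod (Phi : R -> T -> R) :
  (forall r, measurable_fun setT (Phi r)) ->
  (forall w r, Phi s w @[s --> r^'+] --> Phi r w) ->
  measurable_fun setT (fun z : R * T => Phi z.1 z.2).
Proof.
move=> mPhi cPhi.
(* Floor plus one rather than ceiling: the grid point must lie strictly to the right of r even when
   r is on the grid, since the right limit sees only s > r. *)
pose a (k : nat) (z : int) : R := (z + 1)%:~R / k.+1%:R.
pose fl (k : nat) (r : R) : int := Num.floor (r * k.+1%:R).
apply: (@measurable_fun_cvg _ _ _ _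
    (fun k (z : R * T) => Phi (a k (fl k z.1)) z.2)); last first.
  move=> [r w] _ /=.
  have H := (@cvg_at_rightP R (Phi ^~ w) r (Phi r w)).1 (cPhi w r).
  apply: H; split => [k|].
    rewrite /a ltr_pdivlMr ?ltr0n//; exact: floorD1_gt.
  apply/cvgrPdist_lt => e e0; near=> k.
  have lo : r < a k (fl k r) by rewrite /a ltr_pdivlMr ?ltr0n//; exact: floorD1_gt.
  rewrite distrC ger0_norm ?subr_ge0 ?(ltW lo)//.
  have hi : a k (fl k r) - r <= k.+1%:R^-1.
    rewrite /a lerBlDr ler_pdivrMr ?ltr0n// mulrDl mulVf ?pnatr_eq0//.
    by rewrite intrD addrC lerD2l floor_le.
  apply: le_lt_trans hi _.
  near: k; exact: (near_infty_natSinv_lt (PosNum e0)).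
move=> k _ Y mY; rewrite setTI.
rewrite (_ : _ @^-1` _ = \bigcup_(z : int)
    ([set r : R | fl k r = z] `*` (Phi (a k z) @^-1` Y))); last first.
  apply/seteqP; split => [[r w] /= Yw|[r w] [z _ [/= <-]]//].
  by exists (fl k r).
apply: countable_bigcupT_measurable => [|z]; first exact: countableP.
apply: measurableX; last by rewrite -[X in measurable X]setTI; exact: mPhi.
rewrite (_ : [set r | _] = `[z%:~R / k.+1%:R, (z + 1)%:~R / k.+1%:R[%classic)//.
apply/seteqP; split => r /=; rewrite in_itv/= ler_pdivrMr ?ltr0n// ltr_pdivlMr ?ltr0n//.
  by move=> <-; rewrite floor_le floorD1_gt.
by move=> h; apply/eqP; rewrite floor_eq.
Unshelve. all: by end_near. Qed.

End right_continuous_processes.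

(** Intersections rather than unions: two classes closed under intersection yield a pi-system, and
    when both contain the whole space it generates their join. *)
Definition setI_classes {T : Type} (F G : set (set T)) : set (set T) :=
  [set E | exists A C, [/\ F A, G C & E = A `&` C]].

Lemma setI_classes_closed {T : Type} (F G : set (set T)) :
  setI_closed F -> setI_closed G -> setI_closed (setI_classes F G).
Proof.
move=> FI GI _ _ [A [C [FA GC ->]]] [A' [C' [FA' GC' ->]]].
exists (A `&` A'), (C `&` C'); split; [exact: FI|exact: GI|].
by rewrite setIACA.
Qed.

Lemma g_sigma_algebra_setI_closed {d} {T : measurableType d} (F : set (set T)) :
  setI_closed <<s F >>.
Proof.
move=> A C FA FC.
have := @measurableI _ (g_sigma_algebraType F) A C; exact.
Qed.

Lemma g_sigma_algebraT {d} {T : measurableType d} (F : set (set T)) : <<s F >> setT.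
Proof. exact: (@measurableT _ (g_sigma_algebraType F)). Qed.

Lemma measurable_wrtP {R : realType} {d} {T : measurableType d}
    (G : set (set T)) (f : T -> R) :
  measurable_wrt <<s G >> f <->
  measurable_fun setT (f : g_sigma_algebraType G -> R).
Proof.
split=> [mf _ Y mY|mf Y mY]; first by rewrite setTI; exact: mf.
by rewrite -[X in <<s _ >> X]setTI; exact: mf.
Qed.

Lemma measurable_wrt_sub {R : realType} {d} {T : measurableType d}
    (F G : set (set T)) (f : T -> R) : F `<=` G ->
  measurable_wrt F f -> measurable_wrt G f.
Proof. by move=> FG mf Y mY; apply: FG; exact: mf. Qed.

Section filtrations.
Context {R : realType} {d} {T : measurableType d} (P : probability T R).
Context {n : nat} (X : R -> T -> 'I_n) (B : R -> {RV P >-> R}).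

Lemma process_event_real (D : set R) (s : R) (Y : set R) : D s -> measurable Y ->
  process_events measurable D (B : R -> T -> R) (B s @^-1` Y).
Proof. by move=> Ds mY; exists s => //; exists Y => //; rewrite setTI. Qed.

Lemma process_event_state (D : set R) (s : R) (Y : set 'I_n) : D s ->
  process_events setT D X (X s @^-1` Y).
Proof. by move=> Ds; exists s => //; exists Y => //; rewrite setTI. Qed.

Lemma sigma_real_measurable D : sigma_real D B `<=` measurable.
Proof.
apply: smallest_sub; first exact: sigma_algebra_measurable.
by move=> _ [s _ [Y mY <-]]; exact: measurable_funPT.
Qed.

Lemma sigma_real_sub D D' : D `<=` D' -> sigma_real D B `<=` sigma_real D' B.
Proof.
move=> DD'; apply: sub_sigma_algebra2 => _ [s Ds [Y mY <-]].
by exists s; [exact: DD'|exists Y].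
Qed.

Lemma sigma_real_wrt D s : D s -> measurable_wrt (sigma_real D B) (B s).
Proof.
by move=> Ds Y mY; apply: sub_sigma_algebra; exact: process_event_real.
Qed.

Lemma sigma_states_measurable D :
  (forall (t : R) i, D t -> measurable (X t @^-1` [set i])) ->
  sigma_states D X `<=` measurable.
Proof.
move=> mX; apply: smallest_sub; first exact: sigma_algebra_measurable.
move=> _ [s Ds [Y _ <-]]; rewrite setTI.
rewrite (_ : X s @^-1` Y = \bigcup_(i in Y) (X s @^-1` [set i])).
  by apply: fin_bigcup_measurable => // i _; exact: mX.
by apply/seteqP; split => [w Yw|w [i Yi /= ->]//]; exists (X s w).
Qed.

Hypothesis mX : forall (t : R) i, 0 <= t -> measurable (X t @^-1` [set i]).
Hypothesis hB : is_brownian_motion B.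
Hypothesis hXB : independent_classes P (sigma_states `[0, +oo[ X)
  (sigma_real `[0, +oo[ B).

(* Enlarging the filtration by the whole path of X keeps B a Brownian motion. *)
Definition enlarged_past (a : R) : set (set T) :=
  setI_classes (sigma_states `[0, +oo[ X) (sigma_real `[0, a] B).

Local Notation G a := <<s enlarged_past a >>.

Let sX : sigma_states `[0, +oo[ X `<=` measurable.
Proof.
by apply: sigma_states_measurable => t i /=; rewrite in_itv/= andbT; exact: mX.
Qed.

Lemma enlarged_past_measurable a : enlarged_past a `<=` measurable.
Proof.
move=> _ [A [C [/sX mA /sigma_real_measurable mC ->]]]; exact: measurableI.
Qed.

Lemma enlarged_past_setI a : setI_closed (enlarged_past a).
Proof. by apply: setI_classes_closed; exact: g_sigma_algebra_setI_closed. Qed.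

Lemma sigma_enlarged_past_measurable a : G a `<=` @measurable _ T.
Proof. exact: g_sigma_algebra_measurable (@enlarged_past_measurable a). Qed.

Lemma measurable_wrt_fun a (f : T -> R) : measurable_wrt (G a) f ->
  measurable_fun setT f.
Proof. by move=> mf _ Y mY; rewrite setTI; apply: sigma_enlarged_past_measurable; exact: mf. Qed.

Lemma sigma_real_enlarged_past a : sigma_real `[0, a] B `<=` G a.
Proof.
move=> C hC; apply: sub_sigma_algebra; exists setT, C; split => //.
  exact: g_sigma_algebraT.
by rewrite setTI.
Qed.

Lemma sigma_states_enlarged_past a : sigma_states `[0, +oo[ X `<=` G a.
Proof.
move=> C hC; apply: sub_sigma_algebra; exists C, setT; split => //.
  exact: g_sigma_algebraT.
by rewrite setIT.
Qed.

Lemma sigma_enlarged_past_mono a b : a <= b -> G a `<=` G b.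
Proof.
move=> ab; apply: sub_sigma_algebra2 => _ [A [C [hA hC ->]]].
exists A, C; split => //; apply: sigma_real_sub hC.
by apply: subset_itvl; rewrite bnd_simp.
Qed.

Lemma sigma_algebra_enlarged_past a : sigma_algebra setT (G a).
Proof. exact: smallest_sigma_algebra. Qed.

Lemma natural_filtration_enlarged_past a : natural_filtration X B a `<=` G a.
Proof.
apply: smallest_sub; first exact: sigma_algebra_enlarged_past.
move=> E [[s /=]|hE].
  rewrite in_itv/= => /andP[s0 _] hE; apply: sigma_states_enlarged_past; apply: sub_sigma_algebra.
  by exists s => //=; rewrite in_itv/= s0.
by apply: sigma_real_enlarged_past; exact: sub_sigma_algebra.
Qed.

Lemma brownian_wrt_enlarged_past s a : 0 <= s <= a -> measurable_wrt (G a) (B s).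
Proof.
move=> sa Y mY; apply: sigma_real_enlarged_past.
by apply: sigma_real_wrt => //=; rewrite in_itv/=.
Qed.

Lemma increment_wrt_enlarged_past s t a : 0 <= s <= a -> 0 <= t <= a ->
  measurable_wrt (G a) (fun w => B t w - B s w).
Proof.
move=> sa ta; apply/measurable_wrtP/measurable_funB; apply/measurable_wrtP;
  exact: brownian_wrt_enlarged_past.
Qed.

Lemma state_wrt_enlarged_past s a i : 0 <= s -> measurable_wrt (G a) (state_indicator X s i).
Proof.
move=> s0 Y mY; apply: sigma_states_enlarged_past; apply: sub_sigma_algebra.
exists s => /=; first by rewrite in_itv/= s0.
by exists [set j | Y (j == i)%:R] => //; rewrite setTI.
Qed.

Local Notation dB a b := (fun w => (B b w - B a w)%R).

(** On a generator A & C, with A from [X] and C from the past of [B], independence of [X] and [B]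
    separates A from C & D, and the independent increments of [B] separate C from D. The pi-lambda
    argument extends this to the generated sigma-algebra. *)
Lemma increment_indep a b E Y : 0 <= a -> a < b -> G a E -> measurable Y ->
  P (E `&` dB a b @^-1` Y) = (P E * P (dB a b @^-1` Y))%E.
Proof.
move=> a0 ab GE mY; set D := _ @^-1` Y.
have mD : measurable D.
  by rewrite -[D]setTI; apply: measurable_funB.
have sD : sigma_real `[0, +oo[ B D.
  suff : measurable_wrt (sigma_real `[0, +oo[ B) (fun w => B b w - B a w) by apply.
  apply/measurable_wrtP/measurable_funB; apply/measurable_wrtP;
    by apply: sigma_real_wrt; rewrite /= in_itv/= ?a0 ?(le_trans a0 (ltW ab)).
have PDf : P D \is a fin_num by exact: fin_num_measure.
have key F : enlarged_past a F ->
    P (F `&` D) = ((fine (P D))%:E * P (F `&` setT))%E.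
  move=> [A [C [hA hC ->]]]; rewrite fineK// setIT -setIA.
  have hC' : sigma_real `[0, +oo[ B C.
    by apply: sigma_real_sub hC; apply: subset_itvl.
  rewrite [P (A `&` (C `&` D))]hXB//; last exact: g_sigma_algebra_setI_closed.
  rewrite [P (A `&` C)]hXB//.
  have [_ _ /(_ _ _ a0 ab) hind _] := hB.
  rewrite (hind C D)//; first by rewrite muleA muleC.
  by exists Y => //; rewrite setTI.
have PDT : P D = ((fine (P D))%:E * P setT)%E.
  by rewrite probability_setT mule1 fineK.
rewrite (@g_sigma_algebra_agree _ _ _ P _ (@enlarged_past_measurable a)
  (@enlarged_past_setI a) D setT (fine (P D)) mD measurableT PDT key E GE).
by rewrite setIT fineK// muleC.
Qed.

Lemma increment_Lfun2 a b : 0 <= a <= b -> dB a b \in Lfun P 2%:E.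
Proof.
move=> /andP[a0]; rewrite le_eqVlt => /predU1P[<-|ab].
  by apply: (@bounded_Lfun2 _ _ _ _ _ 0) => [|w];
     [exact: measurable_funB|rewrite subrr normr0].
have [_ /(_ _ _ a0 ab) hlaw _ _] := hB.
have s0 : 0 < Num.sqrt (b - a) by rewrite sqrtr_gt0 subr_gt0.
have mU : measurable_fun setT (dB a b) by exact: measurable_funB.
by have [] := normal_moments s0 mU hlaw.
Qed.

(** These are the martingale properties of B_t and of B_t^2 - t in the enlarged filtration, tested
    against [V]; they hold because [V] is independent of the increment. *)
Lemma increment_orth a b (V : T -> R) : 0 <= a <= b ->
  measurable_wrt (G a) V -> P.-integrable setT (EFin \o V) ->
  [/\ P.-integrable setT (EFin \o (fun w => V w * (B b w - B a w))),
      \int[P]_w (V w * (B b w - B a w)) = 0,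
      P.-integrable setT (EFin \o (fun w => V w * (B b w - B a w) ^+ 2)) &
      \int[P]_w (V w * (B b w - B a w) ^+ 2) = (\int[P]_w V w) * (b - a)].
Proof.
move=> ab GV iV; have /andP[a0] := ab; rewrite le_eqVlt => /predU1P[<-|altb].
  have i0 : P.-integrable setT (EFin \o (fun _ : T => 0 : R)) by exact: integrable0.
  have e1 : (fun w => V w * (B a w - B a w)) = fun=> 0.
    by apply/funext => w; rewrite subrr mulr0.
  have e2 : (fun w => V w * (B a w - B a w) ^+ 2) = fun=> 0.
    by apply/funext => w; rewrite subrr expr0n mulr0.
  by rewrite e1 e2 subrr mulr0 Rintegral_cst// mul0r.
have [_ /(_ _ _ a0 altb) hlaw _ _] := hB.
have s0 : 0 < Num.sqrt (b - a) by rewrite sqrtr_gt0 subr_gt0.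
have mU : measurable_fun setT (dB a b) by exact: measurable_funB.
have [U2 U0 Us] := normal_moments s0 mU hlaw.
have [i1 ->] := indep_RintegralM (fun A C mA mC => increment_indep a0 altb (GV _ mA) mC)
  iV (Lfun2_integrable U2).
have ind2 A C : measurable A -> measurable C ->
    P (V @^-1` A `&` (fun w => (B b w - B a w) ^+ 2) @^-1` C) =
    (P (V @^-1` A) * P ((fun w => (B b w - B a w) ^+ 2)%R @^-1` C))%E.
  move=> mA mC; rewrite -[(fun w => (B b w - B a w) ^+ 2) @^-1` C]/
    (dB a b @^-1` ((fun x : R => x ^+ 2) @^-1` C)).
  apply: increment_indep => //; first exact: GV.
  by rewrite -[X in measurable X]setTI; exact: exprn_measurable.
have [i2 ->] := indep_RintegralM ind2 iV (Lfun2_integrable_sqr U2).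
rewrite U0 mulr0 Us sqr_sqrtr//; last by rewrite subr_ge0 ltW.
Qed.

End filtrations.

(** * The Ito isometry *)

Section ito_isometry.
Context {R : realType} {d} {T : measurableType d} (P : probability T R).
Context {n : nat} (X : R -> T -> 'I_n) (B : R -> {RV P >-> R}).
Hypothesis mX : forall (t : R) i, 0 <= t -> measurable (X t @^-1` [set i]).
Hypothesis hB : is_brownian_motion B.
Hypothesis hXB : independent_classes P (sigma_states `[0, +oo[ X)
  (sigma_real `[0, +oo[ B).

Local Notation G a := <<s enlarged_past X B a >>.
Local Notation dB a b := (fun w => (B b w - B a w)%R).
Local Notation mu := lebesgue_measure.

(** Adaptedness is asked on nonempty intervals only: cutting a step process at time u can collapse
    an interval to the point u before its coefficient is known, and there the increment is 0
    anyway. *)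
Definition elementary_block (xi : T -> R) (a b : R) :=
  [/\ 0 <= a <= b, measurable_fun setT xi, (a < b -> measurable_wrt (G a) xi) &
    exists C : R, forall w, `|xi w| <= C].

(** The length of the intersection of ]a, b] and ]a', b']. *)
Definition overlap (a b a' b' : R) : R := Num.max 0 (Num.min b b' - Num.max a a').

Lemma elementary_block_Lfun2 xi a b : elementary_block xi a b ->
  (fun w => xi w * (B b w - B a w)) \in Lfun P 2%:E.
Proof.
move=> [ab mxi _ [C xiC]]; apply: (Lfun2_bounded_mul mxi xiC).
exact: increment_Lfun2.
Qed.

Lemma measurable_wrtM (F : set (set T)) (f g : T -> R) :
  measurable_wrt <<s F >> f -> measurable_wrt <<s F >> g ->
  measurable_wrt <<s F >> (fun w => f w * g w).
Proof.
by move=> /measurable_wrtP mf /measurable_wrtP mg; apply/measurable_wrtP/measurable_funM.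
Qed.

(** The longer increment is split at c: its part after c is orthogonal to V (B_c - B_a), and the
    square of the common part contributes c - a. *)
Lemma nested_increments_orth (V : T -> R) (C a c e : R) : 0 <= a <= c -> c <= e ->
  measurable_wrt (G a) V -> (forall w, `|V w| <= C) ->
  \int[P]_w (V w * ((B c w - B a w) * (B e w - B a w))) = (\int[P]_w V w) * (c - a).
Proof.
move=> /[dup] ac /andP[a0 ac'] ce GV VC.
have mV := measurable_wrt_fun mX GV.
have iV : P.-integrable setT (EFin \o V).
  by apply: Lfun2_integrable; exact: bounded_Lfun2 mV VC.
have [_ _ i2 E2] := increment_orth mX hB hXB ac GV iV.
have GV' : measurable_wrt (G c) (fun w => V w * (B c w - B a w)).
  apply: measurable_wrtM; first exact: measurable_wrt_sub (sigma_enlarged_past_mono ac') GV.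
  by apply: increment_wrt_enlarged_past; rewrite ?a0 ?ac' ?(le_trans a0 ac') ?lexx.
have iV' : P.-integrable setT (EFin \o (fun w => V w * (B c w - B a w))).
  by apply: Lfun2_integrable; apply: (Lfun2_bounded_mul mV VC); exact: increment_Lfun2.
have ce' : 0 <= c <= e by rewrite ce (le_trans a0).
have [i3 E3 _ _] := increment_orth mX hB hXB ce' GV' iV'.
rewrite -E2 -[RHS]addr0 -[X in _ + X]E3 -RintegralD//.
by apply: eq_Rintegral => w _; ring.
Qed.

(** The earlier block is cut at a'. Its part before a' is known at a', hence orthogonal to the
    second increment; its part after a' starts together with the second increment, which leaves
    nested increments. *)
Lemma elementary_block_orth_le xi a b xi' a' b' :
  elementary_block xi a b -> elementary_block xi' a' b' -> a <= a' ->
  \int[P]_w ((xi w * (B b w - B a w)) * (xi' w * (B b' w - B a' w))) =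
  (\int[P]_w (xi w * xi' w)) * overlap a b a' b'.
Proof.
move=> [ab mxi Gxi [C xiC]] [ab' mxi' Gxi' [C' xiC']] aa'.
(* Degenerate blocks are removed first, as their coefficients need not be adapted. *)
have /andP[a0] := ab; rewrite le_eqVlt => /predU1P[<-|altb].
  rewrite /overlap (_ : Num.max _ _ = 0).
    by under eq_Rintegral do rewrite subrr mulr0 mul0r; rewrite Rintegral_cst// mul0r mulr0.
  by apply/max_idPl; rewrite subr_le0 le_max ge_min lexx.
have /andP[a0'] := ab'; rewrite le_eqVlt => /predU1P[<-|altb'].
  rewrite /overlap (_ : Num.max _ _ = 0).
    by under eq_Rintegral do rewrite subrr !mulr0; rewrite Rintegral_cst// mul0r mulr0.
  by apply/max_idPl; rewrite subr_le0 le_max !ge_min lexx !orbT.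
pose V w := xi w * xi' w.
have VC w : `|V w| <= C * C' by rewrite normrM ler_pM.
have GV : measurable_wrt (G a') V.
  apply: measurable_wrtM; last exact: Gxi'.
  exact: measurable_wrt_sub (sigma_enlarged_past_mono aa') (Gxi altb).
have mV := measurable_wrt_fun mX GV.
have ab1 : 0 <= a' <= b' by [].
have far c : 0 <= a <= c -> c <= a' ->
    P.-integrable setT (EFin \o (fun w => V w * (B c w - B a w) * (B b' w - B a' w))) /\
    \int[P]_w (V w * (B c w - B a w) * (B b' w - B a' w)) = 0.
  move=> /[dup] ac /andP[_ ac'] ca'.
  have GV' : measurable_wrt (G a') (fun w => V w * (B c w - B a w)).
    apply: measurable_wrtM => //; apply: increment_wrt_enlarged_past; rewrite ?a0 ?aa'//=.
    by rewrite ca' (le_trans a0 ac').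
  have iV' : P.-integrable setT (EFin \o (fun w => V w * (B c w - B a w))).
    by apply: Lfun2_integrable; apply: (Lfun2_bounded_mul mV VC); exact: increment_Lfun2.
  by have [] := increment_orth mX hB hXB ab1 GV' iV'.
have -> : \int[P]_w (xi w * (B b w - B a w) * (xi' w * (B b' w - B a' w))) =
    \int[P]_w (V w * (B b w - B a w) * (B b' w - B a' w)).
  by apply: eq_Rintegral => w _; rewrite /V; ring.
rewrite /overlap (max_idPr aa').
have [ba'|a'b] := leP b a'.
  have [_ ->] := far b ab ba'.
  rewrite (_ : Num.max _ _ = 0) ?mulr0//.
  by apply/max_idPl; rewrite subr_le0 ge_min ba'.
have aa1 : 0 <= a <= a' by rewrite a0.
have [i1 E1] := far a' aa1 (lexx _).
have i2 : P.-integrable setT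
    (EFin \o (fun w => V w * ((B b w - B a' w) * (B b' w - B a' w)))).
  have -> : (fun w => V w * ((B b w - B a' w) * (B b' w - B a' w))) =
      (fun w => (V w * (B b w - B a' w)) * (B b' w - B a' w)).
    by apply/funext => w; rewrite mulrA.
  apply: Lfun2_mul; last exact: increment_Lfun2.
  by apply: (Lfun2_bounded_mul mV VC); apply: increment_Lfun2 => //; rewrite a0' ltW.
have -> : \int[P]_w (V w * (B b w - B a w) * (B b' w - B a' w)) =
    \int[P]_w (V w * ((B b w - B a' w) * (B b' w - B a' w))).
  rewrite -[RHS]add0r -[X in X + _]E1 -RintegralD//.
  by apply: eq_Rintegral => w _; ring.
have mab : 0 <= Num.min b b' - a' by rewrite subr_ge0 le_min !ltW.
rewrite (max_idPr mab).
have [bb'|b'b] := leP b b'.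
  apply: nested_increments_orth GV VC => //; by rewrite a0' ltW.
under eq_Rintegral do rewrite [X in _ * X]mulrC.
by apply: nested_increments_orth GV VC => //; rewrite ltW.
Qed.

Lemma overlapC a b a' b' : overlap a b a' b' = overlap a' b' a b.
Proof. by rewrite /overlap minC [Num.max a a']maxC. Qed.

Lemma elementary_block_orth xi a b xi' a' b' :
  elementary_block xi a b -> elementary_block xi' a' b' ->
  \int[P]_w ((xi w * (B b w - B a w)) * (xi' w * (B b' w - B a' w))) =
  (\int[P]_w (xi w * xi' w)) * overlap a b a' b'.
Proof.
move=> h h'; have [aa'|a'a] := leP a a'; first exact: elementary_block_orth_le.
rewrite overlapC.
under eq_Rintegral do rewrite mulrC.
under [X in X * _]eq_Rintegral do rewrite mulrC.
by apply: elementary_block_orth_le => //; exact: ltW.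
Qed.

Section isometry.
Context {I : finType} (xi : I -> T -> R) (a b : I -> R) (t : R).
Hypothesis blk : forall i, elementary_block (xi i) (a i) (b i).
Hypothesis bt : forall i, b i <= t.

(** Any finite index type and overlapping intervals are allowed, so that the difference of two step
    integrals on unrelated partitions is again such an integral, over a sum type, without a common
    refinement. *)
Definition block_integral w : R := \sum_i xi i w * (B (b i) w - B (a i) w).
Definition block_eval (s : R) w : R := \sum_i xi i w * (a i < s <= b i)%R%:R.

Lemma block_integral_Lfun2 : block_integral \in Lfun P 2%:E.
Proof.
by apply: Lfun2_sum => i; exact: elementary_block_Lfun2.
Qed.

Let ixi i j : P.-integrable setT (EFin \o (fun w => xi i w * xi j w)).
Proof.
have [_ mi _ [C iC]] := blk i; have [_ mj _ [C' jC]] := blk j.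
by apply: Lfun2_mul; apply: bounded_Lfun2; eassumption.
Qed.

Lemma sqr_bigsum (f : I -> R) : (\sum_i f i) ^+ 2 = \sum_i \sum_j f i * f j.
Proof. by rewrite expr2 mulr_suml; apply: eq_bigr => i _; rewrite mulr_sumr. Qed.

Lemma block_integral_sqr : \int[P]_w (block_integral w ^+ 2) =
  \sum_i \sum_j (\int[P]_w (xi i w * xi j w)) * overlap (a i) (b i) (a j) (b j).
Proof.
under eq_Rintegral do rewrite /block_integral sqr_bigsum.
rewrite Rintegral_sum//; last first.
  move=> i; apply: integrable_bigsum => // j.
  by apply: Lfun2_mul; exact: elementary_block_Lfun2.
apply: eq_bigr => i _; rewrite Rintegral_sum//; last first.
  by move=> j; apply: Lfun2_mul; exact: elementary_block_Lfun2.
by apply: eq_bigr => j _; exact: elementary_block_orth.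
Qed.

Lemma block_eval_sqr s : \int[P]_w (block_eval s w ^+ 2) =
  \sum_i \sum_j (\int[P]_w (xi i w * xi j w)) *
    ((a i < s <= b i) && (a j < s <= b j))%R%:R.
Proof.
have E w : block_eval s w ^+ 2 = \sum_i \sum_j
    ((a i < s <= b i) && (a j < s <= b j))%R%:R * (xi i w * xi j w).
  rewrite /block_eval sqr_bigsum; apply: eq_bigr => i _; apply: eq_bigr => j _.
  by case: (a i < s <= b i); case: (a j < s <= b j);
    rewrite /= ?mulr1 ?mulr0 ?mul0r ?mul1r.
under eq_Rintegral do rewrite E.
rewrite Rintegral_sum//; last first.
  by move=> i; apply: integrable_bigsum => // j; exact: integrable_EFinZ.
apply: eq_bigr => i _; rewrite Rintegral_sum//; last first.
  by move=> j; exact: integrable_EFinZ.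
by apply: eq_bigr => j _; rewrite RintegralZl// mulrC.
Qed.

Lemma block_eval_Lfun2 s : block_eval s \in Lfun P 2%:E.
Proof.
apply: Lfun2_sum => i.
have [_ mi _ [C iC]] := blk i.
rewrite (_ : (fun w => _) = (fun w => (cst ((a i < s <= b i)%R%:R : R) : T -> R) w * xi i w)).
  apply: (@Lfun2_bounded_mul _ _ _ _ _ _ 1) => //; last exact: bounded_Lfun2 iC.
  by move=> w /=; rewrite ger0_norm// lern1 leq_b1.
by apply/funext => w; rewrite /= mulrC.
Qed.

Lemma integral_overlap i j : \int[mu]_(s in `[0, t])
    ((a i < s <= b i) && (a j < s <= b j))%R%:R = overlap (a i) (b i) (a j) (b j).
Proof.
pose c := Num.max (a i) (a j); pose e := Num.min (b i) (b j).
have E (s : R) : ((a i < s <= b i) && (a j < s <= b j))%R = (s \in `]c, e]).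
  rewrite in_itv/= /c /e gt_max le_min.
  by case: (a i < s); case: (a j < s); case: (s <= b i); case: (s <= b j).
have [/andP[a0 _] _ _ _] := blk i.
have -> : \int[mu]_(s in `[0, t]) ((a i < s <= b i) && (a j < s <= b j))%R%:R =
    fine (\int[mu]_(s in `[0, t]) (\1_`]c, e]%classic s)%:E).
  by congr fine; apply: eq_integral => s _; rewrite E indicE mem_setE.
rewrite integral_indic// setIidl; last first.
  move=> s /=; rewrite !in_itv/= => /andP[cs se].
  rewrite (le_trans a0)/=; last by rewrite (le_trans _ (ltW cs))// /c le_max lexx.
  by rewrite (le_trans se)// /e ge_min bt.
rewrite /= lebesgue_measure_itv/= lte_fin /overlap -/c -/e.
have [ce|ec] := ltP c e; first by rewrite (max_idPr _)// subr_ge0 ltW.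
by rewrite (max_idPl _)// subr_le0.
Qed.

(** Both sides expand into the double sum of E[xi_i xi_j] times the overlap of the intervals i and
    j: on the left through the products of increments, on the right by integrating a product of
    indicators over time. *)
Lemma block_isometry : (\int[P]_w (block_integral w ^+ 2)%:E =
  \int[mu]_(s in `[0%R, t]) \int[P]_w (block_eval s w ^+ 2)%:E)%E.
Proof.
rewrite -[LHS]fineK; last first.
  apply: integrable_fin_num => //; apply: Lfun2_integrable_sqr.
  exact: block_integral_Lfun2.
have -> : (\int[mu]_(s in `[0%R, t]) \int[P]_w (block_eval s w ^+ 2)%:E =
    \int[mu]_(s in `[0%R, t]) (\sum_i \sum_j (\int[P]_w (xi i w * xi j w))%R *
    ((a i < s <= b i) && (a j < s <= b j))%R%:R)%R%:E)%E.
  apply: eq_integral => s _; rewrite -block_eval_sqr fineK//.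
  apply: integrable_fin_num => //; apply: Lfun2_integrable_sqr.
  exact: block_eval_Lfun2.
have iov i j : mu.-integrable `[0, t] (EFin \o (fun s =>
    ((a i < s <= b i) && (a j < s <= b j))%R%:R)).
  apply: (@integrable_itv_bounded _ _ _ 1).
    rewrite (_ : (fun s => _) = \1_(`]a i, b i] `&` `]a j, b j])).
      by apply: measurable_indic; exact: measurableI.
    by apply/funext => s; rewrite indicE in_setI !mem_setE/= !in_itv.
  by move=> s _; rewrite ger0_norm// lern1 leq_b1.
rewrite -[RHS]fineK; last first.
  apply: integrable_fin_num => //; apply: integrable_bigsum => // i.
  by apply: integrable_bigsum => // j; exact: integrable_EFinZ.
congr EFin; rewrite -/(Rintegral _ _ _) block_integral_sqr -/(Rintegral _ _ _).
rewrite Rintegral_sum//; last first.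
  by move=> i; apply: integrable_bigsum => // j; exact: integrable_EFinZ.
apply: eq_bigr => i _; rewrite Rintegral_sum//; last first.
  by move=> j; exact: integrable_EFinZ.
by apply: eq_bigr => j _; rewrite RintegralZl// integral_overlap.
Qed.

End isometry.

End ito_isometry.

(** * Ito integrals *)

Lemma ge0_integral_le2 {d} {T : measurableType d} {R : realType}
    (mu : {measure set T -> \bar R}) (D : set T) (F G K : T -> \bar R) :
  measurable D -> measurable_fun D F -> measurable_fun D G -> measurable_fun D K ->
  (forall x, 0 <= F x)%E -> (forall x, 0 <= G x)%E -> (forall x, 0 <= K x)%E ->
  (forall x, D x -> F x <= 2%:E * G x + 2%:E * K x)%E ->
  (\int[mu]_(x in D) F x <=
   2%:E * \int[mu]_(x in D) G x + 2%:E * \int[mu]_(x in D) K x)%E.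
Proof.
move=> mD mF mG mK F0 G0 K0 le; rewrite -!ge0_integralZl//.
rewrite -ge0_integralD//; try (by apply: measurable_funeM);
  try (by move=> x _; rewrite mule_ge0).
apply: ge0_le_integral => //.
- by apply: emeasurable_funD; exact: measurable_funeM.
Qed.

Lemma sqrD_le2 {R : realDomainType} (x y : R) : (x + y) ^+ 2 <= 2 * x ^+ 2 + 2 * y ^+ 2.
Proof.
rewrite -subr_ge0 (_ : _ - _ = (x - y) ^+ 2) ?sqr_ge0//; ring.
Qed.

Section time_space_integral.
Context {R : realType} {d} {T : measurableType d} (P : probability T R).
Local Notation mu := lebesgue_measure.

(** The squared norm of L^2([0, t] x Omega), iterated as in [is_ito_integral], and extended-valued
    so that inequalities can be stated before integrability. *)
Definition time_sqr (t : R) (f : R -> T -> R) : \bar R :=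
  (\int[mu]_(s in `[0%R, t]) \int[P]_w (f s w ^+ 2)%:E)%E.

Definition jointly_measurable (f : R -> T -> R) :=
  measurable_fun setT (fun z : R * T => f z.1 z.2).

Lemma jointly_measurable_section f s : jointly_measurable f ->
  measurable_fun setT (f s).
Proof.
move=> mf.
have mp : measurable_fun setT (fun w : T => (s, w)) by exact: measurable_fun_pair.
exact: (measurableT_comp mf mp).
Qed.

Lemma measurable_sqr_section f : jointly_measurable f ->
  measurable_fun setT (fun s => \int[P]_w (f s w ^+ 2)%:E)%E.
Proof.
move=> mf; apply: (measurable_fun_fubini_tonelli_F
    (fun z : R * T => (f z.1 z.2 ^+ 2)%:E)).
  by apply/measurable_EFinP; exact: measurable_funX.
by move=> z; rewrite lee_fin sqr_ge0.
Qed.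

Lemma time_sqr_le2 t f g h : jointly_measurable f -> jointly_measurable g ->
  jointly_measurable h -> (forall s w, 0 <= s <= t -> f s w = g s w + h s w) ->
  (time_sqr t f <= 2%:E * time_sqr t g + 2%:E * time_sqr t h)%E.
Proof.
move=> mf mg mh E.
have m2 k (s : R) : jointly_measurable k -> measurable_fun setT (fun w => (k s w ^+ 2)%:E).
  move=> mk; apply/measurable_EFinP; apply: measurable_funX.
  exact: jointly_measurable_section.
apply: ge0_integral_le2 => //.
- by apply: measurable_funTS; exact: measurable_sqr_section.
- by apply: measurable_funTS; exact: measurable_sqr_section.
- by apply: measurable_funTS; exact: measurable_sqr_section.
- by move=> s; apply: integral_ge0 => w _; rewrite lee_fin sqr_ge0.
- by move=> s; apply: integral_ge0 => w _; rewrite lee_fin sqr_ge0.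
- by move=> s; apply: integral_ge0 => w _; rewrite lee_fin sqr_ge0.
move=> s /=; rewrite in_itv/= => st.
apply: ge0_integral_le2 => //.
- exact: m2.
- exact: m2.
- exact: m2.
- by move=> w; rewrite lee_fin sqr_ge0.
- by move=> w; rewrite lee_fin sqr_ge0.
- by move=> w; rewrite lee_fin sqr_ge0.
by move=> w _; rewrite -!EFinM -EFinD lee_fin E// sqrD_le2.
Qed.

Lemma time_sqr_bounded t f (C : R) : 0 <= t -> jointly_measurable f ->
  (forall s w, `|f s w| <= C) -> (time_sqr t f <= (C ^+ 2 * t)%:E)%E.
Proof.
move=> t0 mf fC.
apply: (@le_trans _ _ (\int[mu]_(s in `[0%R, t]) (C ^+ 2)%:E)%E); last first.
  by rewrite integral_cst//= lebesgue_measure_itv/= lte_fin; case: ifPn => _;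
    [rewrite -EFinB subr0 -EFinM|rewrite mule0 lee_fin mulr_ge0 ?sqr_ge0].
apply: ge0_le_integral => //.
- by move=> s _; apply: integral_ge0 => w _; rewrite lee_fin sqr_ge0.
- by apply: measurable_funTS; exact: measurable_sqr_section.
move=> s _.
apply: (@le_trans _ _ (\int[P]_w (C ^+ 2)%:E)%E); last first.
  by rewrite integral_cst//= probability_setT mule1.
apply: ge0_le_integral => //.
- by move=> w _; rewrite lee_fin sqr_ge0.
- apply/measurable_EFinP; apply: measurable_funX.
  exact: jointly_measurable_section.
move=> w _; rewrite lee_fin -(real_normK (num_real (f s w))).
by rewrite ler_pXn2r// nnegrE// (le_trans _ (fC s w)).
Qed.

Lemma time_sqr_mono t t' f : jointly_measurable f -> t <= t' ->
  (time_sqr t f <= time_sqr t' f)%E.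
Proof.
move=> mf tt'; apply: ge0_subset_integral => //.
- by apply: measurable_funTS; exact: measurable_sqr_section.
- by move=> s _; apply: integral_ge0 => w _; rewrite lee_fin sqr_ge0.
- by apply: subset_itvl; rewrite bnd_simp.
Qed.

End time_space_integral.

Section ito_integral.
Context {R : realType} {d} {T : measurableType d} (P : probability T R).
Context {n : nat} (X : R -> T -> 'I_n) (B : R -> {RV P >-> R}).
Hypothesis mX : forall (t : R) i, 0 <= t -> measurable (X t @^-1` [set i]).
Hypothesis hB : is_brownian_motion B.
Hypothesis hXB : independent_classes P (sigma_states `[0, +oo[ X)
  (sigma_real `[0, +oo[ B).

Local Notation G a := <<s enlarged_past X B a >>.
Local Notation mu := lebesgue_measure.
Local Notation nf := (natural_filtration X B).
Local Notation block := (elementary_block X B).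

Section step.
Variables (H : @step_process R d T) (t : R).
Hypothesis admH : admissible_step nf t H.
Local Notation p := (step_time H).

Lemma step_time_bounds k : (k <= step_size H)%N -> 0 <= p k <= t.
Proof.
have [p0 pS pt _] := admH.
move=> kH; apply/andP; split.
  elim: k kH => // k IH kH; apply: le_trans (IH (ltnW kH)) _; exact: pS.
apply: le_trans pt.
have mono j : (k + j <= step_size H)%N -> p k <= p (k + j).
  elim: j => [|j IH]; first by rewrite addn0.
  rewrite addnS => kj; apply: le_trans (IH (ltnW kj)) _; exact: pS.
by have := mono (step_size H - k)%N; rewrite subnKC//; apply.
Qed.

Lemma step_coef_block (k : 'I_(step_size H)) (a b : R) : 0 <= a <= b ->
  (a < b -> p k <= a) -> block (step_coef H k) a b.
Proof.
have [_ _ _ /(_ _ (ltn_ord k))[mc bc]] := admH.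
move=> ab pa.
have Gc : measurable_wrt (G (p k)) (step_coef H k).
  exact: measurable_wrt_sub (@natural_filtration_enlarged_past _ _ _ _ _ X B (p k)) mc.
split => //; first exact: measurable_wrt_fun Gc.
by move=> /pa pa'; exact: measurable_wrt_sub (sigma_enlarged_past_mono pa') Gc.
Qed.

Let pk (k : 'I_(step_size H)) : 0 <= p k <= t.
Proof. by apply: step_time_bounds; exact: ltnW. Qed.

Let pk1 (k : 'I_(step_size H)) : 0 <= p k.+1 <= t.
Proof. exact: step_time_bounds. Qed.

Let ppk (k : 'I_(step_size H)) : p k <= p k.+1.
Proof. by have [_ /(_ _ (ltn_ord k))] := admH. Qed.

Lemma step_block_full (k : 'I_(step_size H)) : block (step_coef H k) (p k) (p k.+1).
Proof. by apply: step_coef_block => //; rewrite ppk andbT; case/andP: (pk k). Qed.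

(** If u < p k, the left end becomes u and so does the right one, and the coefficient, not yet known
    at u, is exempt from adaptedness. *)
Lemma step_block_before u (k : 'I_(step_size H)) : 0 <= u ->
  block (step_coef H k) (Num.min (p k) u) (Num.min (p k.+1) u).
Proof.
move=> u0; have /andP[k0 _] := pk k; apply: step_coef_block.
  by rewrite le_min k0 u0/= le_min !ge_min lexx orbT ppk.
by have [//|uk] := leP (p k) u; rewrite lt_min ltxx andbF.
Qed.

Lemma step_block_after u (k : 'I_(step_size H)) :
  block (step_coef H k) (Num.max (p k) u) (Num.max (p k.+1) u).
Proof.
have /andP[k0 _] := pk k; apply: step_coef_block.
  by rewrite le_max k0/= ge_max !le_max lexx orbT ppk.
by rewrite le_max lexx.
Qed.

Lemma step_integral_split u w : step_integral B H w =
  block_integral B (fun k : 'I_(step_size H) => step_coef H k)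
    (fun k => Num.min (p k) u) (fun k => Num.min (p k.+1) u) w +
  block_integral B (fun k : 'I_(step_size H) => step_coef H k)
    (fun k => Num.max (p k) u) (fun k => Num.max (p k.+1) u) w.
Proof.
rewrite /step_integral /block_integral -big_split/=; apply: eq_bigr => k _.
rewrite -mulrDr; congr (_ * _).
(* Minimum and maximum are x and u in some order, so the position of u relative to the partition
   never has to be located. *)
have E x : B x w = B (Num.min x u) w + B (Num.max x u) w - B u w.
  by case: (leP x u) => _; ring.
by rewrite (E (p k)) (E (p k.+1)); ring.
Qed.

Lemma step_eval_joint : jointly_measurable (step_eval H).
Proof.
apply: measurable_sum => k; apply: measurable_funM.
  have [_ m _ _] := step_block_full k.
  exact: (measurableT_comp m measurable_snd).
rewrite (_ : (fun z : R * T => _) = (\1_(`]p k, p k.+1]) : R -> R) \o fst).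
  by apply: measurableT_comp => //; exact: measurable_indic.
by apply/funext => z /=; rewrite indicE mem_setE in_itv.
Qed.

Lemma step_integral_Lfun2 : step_integral B H \in Lfun P 2%:E.
Proof. exact: (block_integral_Lfun2 hB step_block_full). Qed.

Lemma step_isometry :
  (\int[P]_w (step_integral B H w ^+ 2)%:E = time_sqr P t (step_eval H))%E.
Proof.
apply: (block_isometry mX hB hXB step_block_full) => k.
by case/andP: (pk1 k).
Qed.

End step.

(** No block starts before t, so V xi_i is known at the left end of its interval and is orthogonal
    to the increment. *)
Lemma block_integral_orth {I : finType} (xi : I -> T -> R) (a b : I -> R) t (V : T -> R) :
  (forall i, block (xi i) (a i) (b i)) -> (forall i, t <= a i) ->
  measurable_wrt (G t) V -> V \in Lfun P 2%:E ->
  \int[P]_w (block_integral B xi a b w * V w) = 0.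
Proof.
move=> blk ta GV V2.
under eq_Rintegral do rewrite /block_integral mulr_suml.
rewrite Rintegral_sum//; last first.
  by move=> i; apply: Lfun2_mul => //; exact: elementary_block_Lfun2.
apply: big1 => i _; have [ab mi Gi [C iC]] := blk i.
have /andP[_] := ab; rewrite le_eqVlt => /predU1P[->|altb].
  by under eq_Rintegral do rewrite subrr mulr0 mul0r; rewrite Rintegral_cst// mul0r.
have GVi : measurable_wrt (G (a i)) (fun w => V w * xi i w).
  apply: measurable_wrtM; last exact: Gi.
  exact: measurable_wrt_sub (sigma_enlarged_past_mono (ta i)) GV.
have iVi : P.-integrable setT (EFin \o (fun w => V w * xi i w)).
  by apply: Lfun2_mul => //; exact: bounded_Lfun2 mi iC.
have [_ <- _ _] := increment_orth mX hB hXB ab GVi iVi.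
by apply: eq_Rintegral => w _; ring.
Qed.

Variables (h : R -> T -> R) (Ch : R).
Hypotheses (jh : jointly_measurable h) (hC : forall s w, `|h s w| <= Ch).

Lemma ito_approx t (I : {RV P >-> R}) (e : R) : is_ito_integral nf B h t I -> 0 < e ->
  exists H, [/\ admissible_step nf t H,
    (time_sqr P t (fun s w => (step_eval H s w - h s w)%R) < e%:E)%E &
    (\int[P]_w ((step_integral B H w - I w) ^+ 2)%:E < e%:E)%E].
Proof.
move=> [H [adm c1 c2]] e0.
have small (u : (\bar R)^nat) : u @ \oo --> 0%E -> \forall m \near \oo, (u m < e%:E)%E.
  move=> /(_ [set x | (x < e%:E)%E]); apply.
  by apply: open_nbhs_nbhs; split; [exact: open_ereal_lt_ereal|rewrite /= lte_fin].
have [m [m1 m2]] : exists m,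
    (\int[mu]_(s in `[0%R, t])
      'E_P[fun w => ((step_eval (H m) s w - h s w) ^+ 2)%R] < e%:E)%E /\
    ('E_P[fun w => ((step_integral B (H m) w - I w) ^+ 2)%R] < e%:E)%E.
  apply: (@filter_ex _ \oo); apply: filterI; [exact: small c1|exact: small c2].
exists (H m); split => //; rewrite unlock in m1 m2 => //.
Qed.

(** An approximant with both squared errors below 1 has squared norm at most 2 + 2 Ch^2 t, so the
    integral has at most 2 + 2 (2 + 2 Ch^2 t). The Gronwall step only requires a bound in terms of
    [Ch] and [t], so the sharper Ch^2 t is not pursued. *)
Lemma ito_sqr_bound t (I : {RV P >-> R}) : 0 <= t -> is_ito_integral nf B h t I ->
  (\int[P]_w (I w ^+ 2)%:E <= (6 + 4 * (Ch ^+ 2 * t))%:E)%E.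
Proof.
move=> t0 hI; have [H [adm c1 c2]] := ito_approx hI ltr01.
have jH := step_eval_joint adm.
have jHh : jointly_measurable (fun s w => step_eval H s w - h s w).
  exact: measurable_funB.
have mS : measurable_fun setT (step_integral B H).
  exact: Lfun_measurable (step_integral_Lfun2 adm).
have e1 : (time_sqr P t (step_eval H) <= (2 + 2 * (Ch ^+ 2 * t))%:E)%E.
  apply: le_trans (time_sqr_le2 P jH jHh jh _) _; first by move=> s w _; ring.
  have -> : ((2 + 2 * (Ch ^+ 2 * t))%:E = 2%:E * 1%:E + 2%:E * (Ch ^+ 2 * t)%:E)%E.
    by rewrite -!EFinM -EFinD mulr1.
  rewrite leeD// lee_wpmul2l//; first exact: ltW.
  exact: time_sqr_bounded.
have : (\int[P]_w (I w ^+ 2)%:E <=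
    2%:E * \int[P]_w ((step_integral B H w - I w) ^+ 2)%:E +
    2%:E * \int[P]_w (step_integral B H w ^+ 2)%:E)%E.
  apply: ge0_integral_le2 => //.
  - by apply/measurable_EFinP; exact: measurable_funX.
  - by apply/measurable_EFinP; apply: measurable_funX; exact: measurable_funB.
  - by apply/measurable_EFinP; exact: measurable_funX.
  - by move=> w; rewrite lee_fin sqr_ge0.
  - by move=> w; rewrite lee_fin sqr_ge0.
  - by move=> w; rewrite lee_fin sqr_ge0.
  move=> w _; rewrite -!EFinM -EFinD lee_fin.
  rewrite -[X in 2 * X]sqrrN opprB;
  have := sqrD_le2 (I w - step_integral B H w) (step_integral B H w).
  by rewrite subrK.
move=> /le_trans; apply.
rewrite (step_isometry adm).
apply: (@le_trans _ _ (2%:E * 1%:E + 2%:E * (2 + 2 * (Ch ^+ 2 * t))%:E)%E).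
  by rewrite leeD// lee_wpmul2l// ltW.
by rewrite -!EFinM -EFinD lee_fin; lra.
Qed.

Lemma ito_Lfun2 t (I : {RV P >-> R}) : 0 <= t -> is_ito_integral nf B h t I ->
  (I : T -> R) \in Lfun P 2%:E.
Proof.
move=> t0 hI; apply: Lfun2_lty => //.
exact: le_lt_trans (ito_sqr_bound t0 hI) (ltry _).
Qed.

Lemma Rintegral_sqr_le2 (f g k : T -> R) :
  f \in Lfun P 2%:E -> g \in Lfun P 2%:E -> k \in Lfun P 2%:E ->
  (forall w, f w = g w + k w) ->
  \int[P]_w (f w ^+ 2) <= 2 * \int[P]_w (g w ^+ 2) + 2 * \int[P]_w (k w ^+ 2).
Proof.
move=> f2 g2 k2 E; rewrite -!RintegralZl//; try exact: Lfun2_integrable_sqr.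
rewrite -RintegralD//; try (by apply: integrable_EFinZ => //; exact: Lfun2_integrable_sqr).
apply: le_Rintegral => //.
- exact: Lfun2_integrable_sqr.
- by apply: integrable_EFinD => //; apply: integrable_EFinZ => //; exact: Lfun2_integrable_sqr.
- by move=> w _; rewrite E sqrD_le2.
Qed.

(* The approximations of the two integrals are compared on [0, t] through the
   isometry; the part of the later one living on (t, t'] is orthogonal to V. *)
Lemma ito_increment_orth t t' (I I' : {RV P >-> R}) (V : T -> R) :
  0 <= t -> t <= t' -> is_ito_integral nf B h t I -> is_ito_integral nf B h t' I' ->
  measurable_wrt (G t) V -> V \in Lfun P 2%:E ->
  \int[P]_w ((I' w - I w) * V w) = 0.
Proof.
move=> t0 tt' hI hI' GV V2.
have I2 := ito_Lfun2 t0 hI.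
have I'2 := ito_Lfun2 (le_trans t0 tt') hI'.
set J := \int[P]_w _; set v := \int[P]_w (V w ^+ 2).
have v0 : 0 <= v by apply: Rintegral_ge0 => w _; exact: sqr_ge0.
(* 16 e is 2 (4 e) + 2 (4 e): each of [D] and [W] below is a sum of two terms whose squared errors
   are below e, for [D] through the isometry. *)
suff key e : 0 < e -> J ^+ 2 <= 16 * e * v.
  apply/eqP; rewrite -sqrf_eq0 eq_le sqr_ge0 andbT.
  apply/ler_addgt0Pr => e e0; rewrite add0r.
  have v1 : 0 < 16 * (v + 1) by rewrite mulr_gt0// ltr_wpDl.
  have e1 : 0 < e / (16 * (v + 1)) by rewrite divr_gt0.
  apply: le_trans (key _ e1) _.
  have -> : 16 * (e / (16 * (v + 1))) * v = e * (v / (v + 1)).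
    by field; rewrite gt_eqF// ltr_wpDl.
  rewrite ger_pMr// ler_pdivrMr ?mul1r ?lerDl//; by rewrite ltr_wpDl.
move=> e0.
have [H [admH H1 H2]] := ito_approx hI' e0.
have [K [admK K1 K2]] := ito_approx hI e0.
pose xiH (k : 'I_(step_size H)) := step_coef H k.
pose aH (k : 'I_(step_size H)) := Num.min (step_time H k) t.
pose bH (k : 'I_(step_size H)) := Num.min (step_time H k.+1) t.
pose before := block_integral B xiH aH bH.
pose aH' (k : 'I_(step_size H)) := Num.max (step_time H k) t.
pose bH' (k : 'I_(step_size H)) := Num.max (step_time H k.+1) t.
pose after := block_integral B xiH aH' bH'.
have SH w : step_integral B H w = before w + after w by exact: step_integral_split.
have blkH k : block (xiH k) (aH k) (bH k) := step_block_before admH k t0.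
have blkH' k : block (xiH k) (aH' k) (bH' k) := step_block_after admH t k.
have after0 : \int[P]_w (after w * V w) = 0.
  by apply: block_integral_orth blkH' _ GV V2 => k; rewrite le_max lexx orbT.
have SH2 := step_integral_Lfun2 admH.
have SK2 := step_integral_Lfun2 admK.
have before2 : before \in Lfun P 2%:E := block_integral_Lfun2 hB blkH.
have after2 : after \in Lfun P 2%:E := block_integral_Lfun2 hB blkH'.
(* Both terms approximate the integral over [0, t], by different step processes; [W] collects the
   errors against [I'] and [I]. *)
pose D w := before w - step_integral B K w.
have D2 : D \in Lfun P 2%:E by exact: Lfun2_sub.
pose U w := step_integral B H w - I' w.
pose U' w := I w - step_integral B K w.
have U2 : U \in Lfun P 2%:E by exact: Lfun2_sub.
have U'2 : U' \in Lfun P 2%:E by exact: Lfun2_sub.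
pose W w := U w + U' w.
have W2 : W \in Lfun P 2%:E by exact: Lfun2_add.
pose A w := D w - W w.
have A2 : A \in Lfun P 2%:E by exact: Lfun2_sub.
have AE w : I' w - I w = A w + after w.
  by rewrite /A /D /W /U /U' SH; ring.
have JE : J = \int[P]_w (A w * V w).
  rewrite -[RHS]addr0 -[X in _ + X]after0 -RintegralD//; try exact: Lfun2_mul.
  by apply: eq_Rintegral => w _; rewrite AE mulrDl.
rewrite JE.
apply: (@le_trans _ _ (\int[P]_w (A w ^+ 2) * v)).
  by apply: cauchy_schwarz_Rintegral => //;
    [exact: Lfun2_integrable_sqr|exact: Lfun2_integrable_sqr|exact: Lfun2_mul].
rewrite ler_wpM2r//.
have Rlt (f : T -> R) c : f \in Lfun P 2%:E ->
    (\int[P]_w (f w ^+ 2)%:E <= c%:E)%E -> \int[P]_w (f w ^+ 2) <= c.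
  move=> f2 fc; rewrite -lee_fin /Rintegral fineK//.
  by apply: integrable_fin_num => //; exact: Lfun2_integrable_sqr.
have Ue : \int[P]_w (U w ^+ 2) <= e by apply: Rlt => //; exact: ltW.
have U'e : \int[P]_w (U' w ^+ 2) <= e.
  apply: Rlt => //; apply: le_trans (ltW K2); rewrite le_eqVlt; apply/orP; left.
  by apply/eqP; apply: eq_integral => w _; rewrite /U' -sqrrN opprB.
have We : \int[P]_w (W w ^+ 2) <= 4 * e.
  apply: le_trans (Rintegral_sqr_le2 W2 U2 U'2 (fun=> erefl)) _; lra.
have NW2 : (fun w => - W w) \in Lfun P 2%:E.
  exact: (Lfun_oppr_closed W2).
have De : \int[P]_w (D w ^+ 2) <= 4 * e.
  apply: Rlt => //.
  (* The difference becomes one block integral over the disjoint union of the index sets, with the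
     sign moved into the coefficients. *)
  pose xi (k : 'I_(step_size H) + 'I_(step_size K)) := match k with
    | inl k => xiH k | inr k => fun w => - step_coef K k w end.
  pose a (k : 'I_(step_size H) + 'I_(step_size K)) := match k with
    | inl k => aH k | inr k => step_time K k end.
  pose b (k : 'I_(step_size H) + 'I_(step_size K)) := match k with
    | inl k => bH k | inr k => step_time K k.+1 end.
  have blk k : block (xi k) (a k) (b k).
    case: k => k; first exact: blkH.
    have [ab mk Gk [C kC]] := step_block_full admK k.
    split => //; first exact: measurable_funN.
      by move=> /Gk /measurable_wrtP mw; apply/measurable_wrtP; exact: measurable_funN.
    by exists C => w; rewrite normrN.
  have bt k : b k <= t.
    case: k => k /=; first by rewrite /bH ge_min lexx orbT.
    by have /andP[] := step_time_bounds admK (ltn_ord k).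
  have DE w : D w = block_integral B xi a b w.
    rewrite /block_integral big_sumType/= /D; congr (_ + _).
    by rewrite /step_integral -sumrN; apply: eq_bigr => k _; rewrite mulNr.
  under eq_integral do rewrite DE.
  rewrite (block_isometry mX hB hXB blk bt).
  have jH := step_eval_joint admH; have jK := step_eval_joint admK.
  have -> : (\int[mu]_(s in `[0%R, t]) \int[P]_w (block_eval xi a b s w ^+ 2)%:E =
      time_sqr P t (fun s w => (step_eval H s w - step_eval K s w)%R))%E.
    apply: eq_integral => s; rewrite inE/= in_itv/= => /andP[s0 st].
    apply: eq_integral => w _; congr (_ ^+ 2)%:E.
    rewrite /block_eval big_sumType/=; congr (_ + _).
      apply: eq_bigr => k _; rewrite /xiH /aH /bH; congr (_ * _%:R).
      (* For s <= t, truncating the intervals at t does not change which of them contain s. *)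
      by rewrite gt_min le_min st andbT [t < s]ltNge st orbF.
    by rewrite /step_eval -sumrN; apply: eq_bigr => k _; rewrite mulNr.
  have j1 : jointly_measurable (fun s w => step_eval H s w - h s w).
    exact: measurable_funB.
  have j2 : jointly_measurable (fun s w => h s w - step_eval K s w).
    exact: measurable_funB.
  have j3 : jointly_measurable (fun s w => step_eval H s w - step_eval K s w).
    exact: measurable_funB.
  apply: le_trans (time_sqr_le2 P j3 j1 j2 _) _; first by move=> s w _; ring.
  have -> : (4 * e)%:E = (2%:E * e%:E + 2%:E * e%:E)%E.
    by rewrite -!EFinM -EFinD; congr EFin; ring.
  rewrite leeD// lee_wpmul2l//.
    exact: le_trans (time_sqr_mono P j1 tt') (ltW H1).
  apply: le_trans (ltW K1); rewrite le_eqVlt; apply/orP; left; apply/eqP.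
  apply: eq_integral => s _; apply: eq_integral => w _.
  by rewrite -sqrrN opprB.
have -> : 16 * e = 2 * (4 * e) + 2 * (4 * e) by ring.
apply: le_trans (Rintegral_sqr_le2 A2 D2 NW2 (fun=> erefl)) _.
rewrite lerD ?ler_wpM2l//.
by under eq_Rintegral do rewrite sqrrN.
Qed.

End ito_integral.

(** * The Markov property *)

Section markov.
Context {R : realType} {d} {T : measurableType d} (P : probability T R).
Context {n : nat} (Q : 'M[R]_n) (X : R -> T -> 'I_n) (B : R -> {RV P >-> R}).
Hypothesis hX : is_markov_chain P Q X.
Hypothesis hXB : independent_classes P (sigma_states `[0, +oo[ X)
  (sigma_real `[0, +oo[ B).

Let mX (t : R) i : 0 <= t -> measurable (X t @^-1` [set i]).
Proof. by have [m _ _] := hX; exact: m. Qed.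

Local Notation p i j h := (expmx (h *: Q) i j).

(** The constraints may be unordered, repeated or contradictory, so that intersection is simply
    concatenation. *)
Definition state_cylinder (L : seq (R * 'I_n)) : set T :=
  [set w | forall x, x \in L -> X x.1 w = x.2].

Definition state_cylinders (s : R) : set (set T) :=
  [set E | exists2 L, (forall x, x \in L -> 0 <= x.1 <= s) & E = state_cylinder L].

Lemma state_cylinder_cat L L' :
  state_cylinder (L ++ L') = state_cylinder L `&` state_cylinder L'.
Proof.
apply/seteqP; split => [w h|w [h h'] x].
  by split => x xL; apply: h; rewrite mem_cat xL ?orbT.
by rewrite mem_cat => /orP[/h|/h'].
Qed.

Lemma state_cylinders_setI s : setI_closed (state_cylinders s).
Proof.
move=> _ _ [L hL ->] [L' hL' ->]; exists (L ++ L').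
  by move=> x; rewrite mem_cat => /orP[/hL|/hL'].
by rewrite state_cylinder_cat.
Qed.

Lemma sigma_states_state (s : R) (Y : set 'I_n) : 0 <= s ->
  sigma_states `[0, +oo[ X (X s @^-1` Y).
Proof.
move=> s0; apply: sub_sigma_algebra; apply: process_event_state.
by rewrite /= in_itv/= s0.
Qed.

Lemma sigma_states_cylinder L : (forall x, x \in L -> 0 <= x.1) ->
  sigma_states `[0, +oo[ X (state_cylinder L).
Proof.
elim: L => [_|x L IH hL].
  rewrite (_ : state_cylinder [::] = setT); first exact: g_sigma_algebraT.
  by apply/seteqP; split.
rewrite -cat1s state_cylinder_cat; apply: g_sigma_algebra_setI_closed.
  rewrite (_ : state_cylinder [:: x] = X x.1 @^-1` [set x.2]).
    by apply: sigma_states_state; apply: hL; rewrite mem_head.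
  apply/seteqP; split => w /=; first by move=> /(_ x (mem_head _ _)).
  by move=> E y; rewrite inE => /eqP ->.
by apply: IH => y yL; apply: hL; rewrite inE yL orbT.
Qed.

(** The atom of [w0] for the states at the times in [L]. A nonempty cylinder is the atom of any of
    its points, so only a list of times remains and consistency of the constraints need not be
    checked. *)
Definition agree_at (w0 : T) (L : seq R) : set T :=
  [set w | forall r, r \in L -> X r w = X r w0].

(** Once the times are sorted without repetition the last one is s, so adding the time s + h
    multiplies the finite-dimensional probability by a single transition factor. *)
Lemma markov_atom (w0 : T) (L : seq R) (s h : R) j : s \in L ->
  (forall r, r \in L -> 0 <= r <= s) -> 0 < h ->
  P (agree_at w0 L `&` X (s + h) @^-1` [set j]) =
  ((p (X s w0) j h)%:E * P (agree_at w0 L))%E.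
Proof.
move=> sL Ls h0.
pose L' := sort <=%R (undup L).
have memL r : (r \in L') = (r \in L) by rewrite mem_sort mem_undup.
have srt : sorted <%R L' by rewrite sort_lt_sorted undup_uniq.
have [m sz] : exists m, size L' = m.+1.
  by move: sL; rewrite -memL; case: (L') => // a l _; exists (size l).
(* The default of [nth] is s + h, so the index m + 1, one past the end of the list, already gives
   the additional time. *)
pose tau k := nth (s + h) L' k.
have taum1 : tau m.+1 = s + h by rewrite /tau nth_default// sz.
have tauL k : (k <= m)%N -> tau k \in L by move=> km; rewrite -memL mem_nth// sz.
have tauS k : (k < m)%N -> tau k < tau k.+1.
  by move=> km; apply: (sortedP _ srt); rewrite sz.
have taum : tau m = s.
  apply/eqP; rewrite eq_le; have /andP[_ ->] := Ls _ (tauL m (leqnn _)).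
  rewrite /=; have : s \in L' by rewrite memL.
  move=> /(nthP (s + h))[k]; rewrite sz ltnS => km <-.
  have : forall l, (k + l <= m)%N -> tau k <= tau (k + l)%N.
    elim=> [|l IH]; first by rewrite addn0.
    by rewrite addnS => kl; exact: le_trans (IH (ltnW kl)) (ltW (tauS _ kl)).
  by move=> /(_ (m - k)%N); rewrite subnKC//; apply.
have tau0 : 0 <= tau 0%N by have /andP[] := Ls _ (tauL 0%N (leq0n _)).
have tauS' k : (k < m.+1)%N -> tau k < tau k.+1.
  rewrite ltnS leq_eqVlt => /predU1P[->|]; last exact: tauS.
  by rewrite taum taum1 ltrDl.
pose iota0 k := X (tau k) w0.
pose iota1 k := if (k <= m)%N then X (tau k) w0 else j.
have [_ fdd _] := hX.
have E0 : agree_at w0 L = [set w | forall k, (k <= m)%N -> X (tau k) w = iota0 k].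
  apply/seteqP; split => w hw.
    by move=> k km; apply: hw; exact: tauL.
  move=> r; rewrite -memL => /(nthP (s + h))[k]; rewrite sz ltnS => km <-.
  exact: hw.
have E1 : agree_at w0 L `&` X (s + h) @^-1` [set j] =
    [set w | forall k, (k <= m.+1)%N -> X (tau k) w = iota1 k].
  rewrite E0; apply/seteqP; split => [w /= [hw wj] k|w /= hw].
    rewrite leq_eqVlt => /predU1P[->|]; first by rewrite taum1 /iota1 ltnn.
    by rewrite ltnS => km; rewrite /iota1 km hw.
  split; first by move=> k km; rewrite hw ?leqW// /iota1 km.
  by have := hw m.+1 (leqnn _); rewrite taum1 /iota1 ltnn.
rewrite E1 E0 fdd// fdd// big_ord_recr/= taum taum1 addrAC subrr add0r.
rewrite [iota1 m.+1]/iota1 ltnn [iota1 m]/iota1 leqnn taum EFinM.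
rewrite [iota1 0%N]/iota1 leq0n -[iota0 0%N]/(X (tau 0%N) w0) muleA muleC.
congr (_ * (_ * _%:E))%E; apply: eq_bigr => k _.
by rewrite /iota1 /iota0 (ltnW (ltn_ord k)) ltn_ord.
Qed.

Lemma markov_cylinder (s h : R) i j E : 0 <= s -> 0 <= h -> state_cylinders s E ->
  P (E `&` (X s @^-1` [set i] `&` X (s + h) @^-1` [set j])) =
  ((p i j h)%:E * P (E `&` X s @^-1` [set i]))%E.
Proof.
(* A zero lag is treated apart, since the finite-dimensional distributions are given for strictly
   increasing times. *)
move=> s0; rewrite le_eqVlt => /predU1P[<- _|h0 [L Ls ->]].
  rewrite addr0 scale0r expmx0 mxE; have [->|ij] := eqVneq i j.
    by rewrite setIid mul1e.
  rewrite mul0e (_ : _ `&` _ = set0) ?measure0//.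
  apply/seteqP; split => // w /= [_ [E1 E2]].
  by move: ij; rewrite -E1 -E2 eqxx.
rewrite setIA.
have [->|/set0P[w0 [w0L w0i]]] := eqVneq (state_cylinder L `&` X s @^-1` [set i]) set0.
  by rewrite set0I measure0 mule0.
have -> : state_cylinder L `&` X s @^-1` [set i] = agree_at w0 (s :: map fst L).
  apply/seteqP; split => [w [wL wi] r|w hw].
    rewrite inE => /predU1P[->|/mapP[x xL ->]]; first by rewrite wi w0i.
    by rewrite wL// w0L.
  split; last by rewrite /= hw ?mem_head// w0i.
  by move=> x xL; rewrite hw ?w0L// inE map_f// orbT.
rewrite markov_atom ?mem_head//; first by rewrite w0i.
by move=> r; rewrite inE => /predU1P[->|/mapP[x /Ls xL ->]//]; rewrite s0 lexx.
Qed.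

(** All of [B] is included, not only its past: independence factors it out of the Markov identity,
    and the natural filtration is still contained. *)
Definition markov_past (s : R) : set (set T) :=
  setI_classes (state_cylinders s) (sigma_real `[0, +oo[ B).

Lemma state_cylinders_sigma s : state_cylinders s `<=` sigma_states `[0, +oo[ X.
Proof.
by move=> _ [L Ls ->]; apply: sigma_states_cylinder => x /Ls/andP[].
Qed.

Let sX : sigma_states `[0, +oo[ X `<=` measurable.
Proof.
by apply: sigma_states_measurable => t i /=; rewrite in_itv/= andbT; exact: mX.
Qed.

Lemma markov_past_measurable s : markov_past s `<=` measurable.
Proof.
move=> _ [A [C [/state_cylinders_sigma/sX mA /sigma_real_measurable mC ->]]].
exact: measurableI.
Qed.

Lemma natural_filtration_markov_past s :
  natural_filtration X B s `<=` <<s markov_past s >>.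
Proof.
apply: smallest_sub; first exact: smallest_sigma_algebra.
have cT : state_cylinders s setT by exists [::] => //; apply/seteqP; split.
move=> _ [[r /= + [Y _ <-]]|[r /= + [Y mY <-]]]; rewrite in_itv/= => rs; rewrite setTI.
  rewrite (_ : X r @^-1` Y = \bigcup_(i in Y) (X r @^-1` [set i])); last first.
    by apply/seteqP; split => [w Yw|w [i Yi /= ->]//]; exists (X r w).
  apply: (@fin_bigcup_measurable _ (g_sigma_algebraType (markov_past s))) => // i _.
  apply: sub_sigma_algebra; exists (X r @^-1` [set i]), setT; split => //.
  - exists [:: (r, i)]; first by move=> x; rewrite inE => /eqP ->.
    apply/seteqP; split => w /=; last by move=> /(_ (r, i) (mem_head _ _)).
    by move=> E x; rewrite inE => /eqP ->.
  - exact: g_sigma_algebraT.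
  - by rewrite setIT.
apply: sub_sigma_algebra; exists setT, (B r @^-1` Y); split => //.
- apply: sub_sigma_algebra; apply: process_event_real => //=.
  by rewrite in_itv/=; case/andP: rs => ->.
- by rewrite setTI.
Qed.

Lemma markov_sigma (s h : R) i j E : 0 <= s -> 0 <= h ->
  <<s markov_past s >> E ->
  P (E `&` (X s @^-1` [set i] `&` X (s + h) @^-1` [set j])) =
  ((p i j h)%:E * P (E `&` X s @^-1` [set i]))%E.
Proof.
move=> s0 h0; have sh0 : 0 <= s + h by exact: addr_ge0.
apply: (@g_sigma_algebra_agree _ _ _ P (markov_past s)).
- exact: markov_past_measurable.
- apply: setI_classes_closed; [exact: state_cylinders_setI|].
  exact: g_sigma_algebra_setI_closed.
- by apply: measurableI; exact: mX.
- exact: mX.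
- have := @markov_cylinder s h i j setT s0 h0; rewrite !setTI; apply.
  by exists [::] => //; apply/seteqP; split.
move=> _ [A [C [cA hC ->]]].
have sA := state_cylinders_sigma cA.
have sE Y : sigma_states `[0, +oo[ X Y -> P (A `&` C `&` Y) = (P (A `&` Y) * P C)%E.
  move=> sY; rewrite setIAC hXB//; exact: g_sigma_algebra_setI_closed.
rewrite sE; last by apply: g_sigma_algebra_setI_closed; exact: sigma_states_state.
by rewrite sE ?markov_cylinder ?muleA//; exact: sigma_states_state.
Qed.

Lemma markov_property (s h : R) i j (V : T -> R) : 0 <= s -> 0 <= h ->
  measurable_wrt (natural_filtration X B s) V -> P.-integrable setT (EFin \o V) ->
  \int[P]_w (V w * state_indicator X s i w * state_indicator X (s + h) j w) =
  p i j h * \int[P]_w (V w * state_indicator X s i w).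
Proof.
move=> s0 h0 mV iV; have sh0 : 0 <= s + h by exact: addr_ge0.
have mA : measurable (X s @^-1` [set i] `&` X (s + h) @^-1` [set j]).
  by apply: measurableI; exact: mX.
have := @Rintegral_agree _ _ _ P _ (@markov_past_measurable s) _ _ (p i j h) V mA
  (mX i s0) (fun E GE => markov_sigma i j s0 h0 GE)
  (measurable_wrt_sub (@natural_filtration_markov_past s) mV) iV.
rewrite Rintegral_mkcond [in X in _ = _ * X]Rintegral_mkcond => H.
transitivity (\int[P]_w (V \_ (X s @^-1` [set i] `&` X (s + h) @^-1` [set j])) w).
  apply: eq_Rintegral => w _; rewrite patchE /state_indicator.
  case: ifPn; rewrite ?inE ?notin_setE/=.
    by move=> [-> ->]; rewrite !eqxx !mulr1.
  by case: eqP => [e1|]; case: eqP => [e2|]; rewrite ?mulr0 ?mul0r// => -[].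
rewrite H; congr (_ * _); apply: eq_Rintegral => w _.
rewrite patchE /state_indicator; case: ifPn; rewrite ?inE ?notin_setE/=.
  by move=> ->; rewrite eqxx mulr1.
by case: eqP; rewrite ?mulr0.
Qed.

End markov.

(** * Fubini over time *)

Lemma lebesgue_measure_shift {R : realType} (t : R) (A : set R) : measurable A ->
  pushforward lebesgue_measure ((fun x => t + x) : _ -> measurableTypeR R) A =
  lebesgue_measure A.
Proof.
have mt : measurable_fun setT ((fun x => t + x) : R -> measurableTypeR R).
  exact: measurable_funD.
move=> mA; apply/esym/lebesgue_measure_unique => //= _ [[a b]] _ <-.
rewrite /pushforward (_ : _ @^-1` _ = `]a - t, b - t]%classic); last first.
  by apply/seteqP; split => x /=; rewrite !in_itv/= ltrBlDl lerBrDl.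
by rewrite !lebesgue_measure_itv/= !lte_fin ltrBlDr subrK -!EFinB; case: ifPn => // _;
  congr EFin; ring.
Qed.

Lemma Rintegral_itv_shift {R : realType} (t u K : R) (F : R -> R) :
  measurable_fun setT F -> (forall r, 0 <= r <= u -> `|F (t + r)| <= K) ->
  \int[lebesgue_measure]_(r in `[t, t + u]) F r =
  \int[lebesgue_measure]_(r in `[0, u]) F (t + r).
Proof.
move=> mF FK.
have mt : measurable_fun setT ((fun x => t + x) : measurableTypeR R -> measurableTypeR R).
  exact: measurable_funD.
have E : ((fun x => t + x) : _ -> measurableTypeR R) @^-1` `[t, t + u]%classic = `[0, u]%classic.
  by apply/seteqP; split => x /=; rewrite !in_itv/= lerD2l lerDl.
have mEF : measurable_fun setT (EFin \o F : measurableTypeR R -> \bar R).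
  exact/measurable_EFinP.
have iF : lebesgue_measure.-integrable
    (((fun x => t + x) : measurableTypeR R -> measurableTypeR R) @^-1` `[t, t + u])
    ((EFin \o F) \o (fun x => t + x)).
  rewrite E; apply: (@integrable_itv_bounded _ _ _ K (fun x => F (t + x))) => //.
  by apply: measurable_funTS; exact: (measurableT_comp mF mt).
have := @integral_pushforward _ _ _ _ _ _ mt lebesgue_measure `[t, t + u]
  (EFin \o F) mEF iF (measurable_itv _).
rewrite E => H; rewrite /Rintegral.
have -> : (\int[lebesgue_measure]_(r in `[t, (t + u)%R]) (F r)%:E =
  \int[pushforward lebesgue_measure
    ((fun x => (t + x)%R) : measurableTypeR R -> measurableTypeR R)]_(r in `[t, (t + u)%R]) (F r)%:E)%E.
  by apply: eq_measure_integral => A mA _; exact/esym/lebesgue_measure_shift.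
by congr fine.
Qed.

Section ae_tools.
Context {R : realType} {d} {T : measurableType d} (P : probability T R).

Lemma ae_Rintegral (f g : T -> R) : measurable_fun setT f -> measurable_fun setT g ->
  {ae P, forall w, f w = g w} -> \int[P]_w f w = \int[P]_w g w.
Proof.
move=> mf mg fg; rewrite /Rintegral; congr fine.
apply: ae_eq_integral => //; try exact/measurable_EFinP.
by apply: filterS fg => w /= -> _.
Qed.

Lemma ae_Lfun2 (f g : T -> R) : measurable_fun setT g ->
  {ae P, forall w, f w = g w} -> f \in Lfun P 2%:E -> g \in Lfun P 2%:E.
Proof.
move=> mg fg f2; apply: Lfun2_lty => //.
have mf := Lfun_measurable f2.
rewrite -(@ae_eq_integral _ _ _ P setT _ (fun w => (f w ^+ 2)%:E))//.
- exact: Lfun2_sqr_lty.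
- by apply/measurable_EFinP; exact: measurable_funX.
- by apply/measurable_EFinP; exact: measurable_funX.
- by apply: filterS fg => w /= -> _.
Qed.

End ae_tools.

Section time_fubini.
Context {R : realType} {d} {T : measurableType d} (P : probability T R).
Local Notation mu := lebesgue_measure.

(** The time window enters as an indicator factor because the theorems of Tonelli and Fubini are
    applied on the whole product space. *)
Lemma jointly_measurable_itv (a b : R) (f : R -> T -> R) : jointly_measurable f ->
  measurable_fun setT (fun z : R * T => ((\1_(`[a, b]) : R -> R) z.1 * f z.1 z.2)%:E).
Proof.
move=> mf; apply/measurable_EFinP; apply: measurable_funM => //.
by apply: (measurableT_comp _ measurable_fst); exact: measurable_indic.
Qed.

Lemma integral_itv_indic (a b : R) (f : R -> R) :
  (\int[mu]_(s in `[a, b]) (f s)%:E = \int[mu]_s ((\1_(`[a, b]) : R -> R) s * f s)%:E)%E.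
Proof.
rewrite integral_mkcond; apply: eq_integral => s _.
by rewrite patchE indicE; case: ifPn => _; rewrite ?mul1r ?mul0r.
Qed.

Lemma iterated_integral_itv_indic (a b : R) (f : R -> T -> R) :
  (\int[mu]_(s in `[a, b]) \int[P]_w (f s w)%:E =
   \int[mu]_s \int[P]_w ((\1_(`[a, b]) : R -> R) s * f s w)%:E)%E.
Proof.
rewrite integral_mkcond; apply: eq_integral => s _.
rewrite patchE indicE; case: ifPn => _.
  by apply: eq_integral => w _; rewrite mul1r.
by rewrite (eq_integral (cst 0%E)) ?integral0// => w _; rewrite mul0r.
Qed.

Lemma indic_itv_ge0 (a b : R) (f : R -> T -> R) : (forall s w, 0 <= f s w) ->
  forall z : R * T, (0 <= ((\1_(`[a, b]) : R -> R) z.1 * f z.1 z.2)%:E)%E.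
Proof. by move=> f0 z; rewrite lee_fin mulr_ge0. Qed.

Lemma tonelli_itv (a b : R) (f : R -> T -> R) : jointly_measurable f ->
  (forall s w, 0 <= f s w) ->
  (\int[mu]_(s in `[a, b]) \int[P]_w (f s w)%:E =
   \int[P]_w \int[mu]_(s in `[a, b]) (f s w)%:E)%E.
Proof.
move=> mf f0; rewrite iterated_integral_itv_indic.
under [RHS]eq_integral do rewrite integral_itv_indic.
exact: (@fubini_tonelli _ _ _ _ _ mu P
  (fun z : R * T => ((\1_(`[a, b]) : R -> R) z.1 * f z.1 z.2)%:E)
  (jointly_measurable_itv a b mf) (indic_itv_ge0 a b f0)).
Qed.

Lemma measurable_time_integral (a b : R) (f : R -> T -> R) : jointly_measurable f ->
  (forall s w, 0 <= f s w) ->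
  measurable_fun setT (fun w => \int[mu]_(s in `[a, b]) (f s w)%:E)%E.
Proof.
move=> mf f0; under eq_fun do rewrite integral_itv_indic.
apply: (@measurable_fun_fubini_tonelli_G _ _ _ _ _ mu
  (fun z : R * T => ((\1_(`[a, b]) : R -> R) z.1 * f z.1 z.2)%:E)).
  exact: jointly_measurable_itv.
exact: indic_itv_ge0.
Qed.

(** A bound on E|f(s)| uniform over a bounded window gives integrability on the product.
    Integrability is asked of every path, so that the real-valued inner integral is nowhere a
    default value. *)
Lemma fubini_itv (a b C : R) (f : R -> T -> R) : jointly_measurable f ->
  (forall s, (a <= s <= b)%R -> \int[P]_w `|(f s w)%:E| <= C%:E)%E ->
  (forall w, mu.-integrable `[a, b] (EFin \o f ^~ w)) ->
  P.-integrable setT (EFin \o (fun w => \int[mu]_(s in `[a, b]) f s w)) /\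
  \int[P]_w (\int[mu]_(s in `[a, b]) f s w) =
  \int[mu]_(s in `[a, b]) (\int[P]_w f s w).
Proof.
move=> mf fC fi.
pose F (z : R * T) := ((\1_(`[a, b]) : R -> R) z.1 * f z.1 z.2)%:E.
have mF : measurable_fun setT F by exact: jointly_measurable_itv.
have iF : (mu \x P)%E.-integrable setT F.
  apply/integrable12ltyP => //.
  have -> : (\int[mu]_s \int[P]_w `|F (s, w)| =
      \int[mu]_(s in `[a, b]) \int[P]_w (`|f s w|%R)%:E)%E.
    rewrite iterated_integral_itv_indic; apply: eq_integral => s _.
    apply: eq_integral => w _ /=; rewrite normrM ger0_norm//.
  apply: (@le_lt_trans _ _ (\int[mu]_(s in `[a, b]) `|C|%:E)%E).
    apply: ge0_le_integral => //.
    - by move=> s _; apply: integral_ge0.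
    - apply: measurable_funTS.
      apply: (measurable_fun_fubini_tonelli_F (fun z : R * T => (`|f z.1 z.2|)%:E)) => //.
      by apply/measurable_EFinP; exact: measurableT_comp.
    - move=> s /=; rewrite in_itv/= => /fC sC.
      by apply: (le_trans sC); rewrite lee_fin ler_norm.
  rewrite integral_cst//= lebesgue_measure_itv/= lte_fin; case: ifPn => _.
    by rewrite -EFinB -EFinM ltry.
  by rewrite mule0 ltry.
have fin w : (\int[mu]_(s in `[a, b]) (f s w)%:E)%E \is a fin_num.
  by apply: integrable_fin_num => //; exact: fi.
have FG w : (\int[mu]_s F (s, w))%E = (\int[mu]_(s in `[a, b]) f s w)%:E.
  by rewrite /Rintegral fineK// integral_itv_indic.
have iG : P.-integrable setT (fun w => \int[mu]_s F (s, w))%E.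
  apply/integrableP; split; first exact: (measurable_fubini_G iF).
  apply: le_lt_trans ((integrable21ltyP mu P mF).1 iF).
  have mFw w : measurable_fun setT (fun s => F (s, w)).
    have mp : measurable_fun setT (fun s : R => (s, w)) by exact: measurable_fun_pair.
    exact: (measurableT_comp mF mp).
  apply: ge0_le_integral => //.
  - by apply: measurableT_comp => //; exact: (measurable_fubini_G iF).
  - apply: (@measurable_fun_fubini_tonelli_G _ _ _ _ _ mu (abse \o F)) => //.
    exact: measurableT_comp.
    by move=> z; exact: abse_ge0.
  - by move=> w _; exact: (le_abse_integral mu measurableT (mFw w)).
split.
  by apply: eq_integrable iG => // w _; rewrite FG.
rewrite /Rintegral; congr fine.
transitivity (\int[P]_w \int[mu]_s F (s, w))%E.
  by apply: eq_integral => w _; rewrite FG.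
rewrite -(Fubini iF).
rewrite [RHS]integral_mkcond; apply: eq_integral => s _; rewrite patchE /F /=.
case: ifPn => sab.
  have sab' : a <= s <= b by move: sab; rewrite inE/= in_itv.
  rewrite /= fineK.
    by apply: eq_integral => w _; rewrite indicE sab mul1r.
  apply: integrable_fin_num => //; apply/integrableP; split.
    by apply/measurable_EFinP; exact: jointly_measurable_section.
  exact: le_lt_trans (fC s sab') (ltry _).
by rewrite (eq_integral (cst 0%E)) ?integral0// => w _; rewrite indicE (negbTE sab) mul0r.
Qed.

End time_fubini.

(** * The Markov-modulated Ornstein-Uhlenbeck process *)

Section regular_version.
Context {R : realType} {d} {T : measurableType d} (N : set T) (mN : measurable N).

(** Path regularity is known off a null set and for nonnegative times. The value 0 elsewhere makes
    every path right-continuous on the whole line, as joint measurability requires. *)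
Definition regular_version (Phi : R -> T -> R) (r : R) (w : T) : R :=
  if (0 <= r) && (w \notin N) then Phi r w else 0.

Lemma regular_version_joint (Phi : R -> T -> R) :
  (forall r, 0 <= r -> measurable_fun setT (Phi r)) ->
  (forall w r, ~ N w -> 0 <= r -> Phi s w @[s --> r^'+] --> Phi r w) ->
  jointly_measurable (regular_version Phi).
Proof.
move=> mPhi cPhi; apply: right_continuous_measurable_prod => [r|w r].
  have [r0|r0] := leP 0 r; last first.
    rewrite (_ : regular_version Phi r = cst 0)//.
    by apply/funext => w; rewrite /regular_version leNgt r0.
  rewrite (_ : regular_version Phi r = fun w => (\1_(~` N) : T -> R) w * Phi r w).
    apply: measurable_funM; last exact: mPhi.
    by apply: measurable_indic; exact: measurableC.
  apply/funext => w; rewrite /regular_version r0 indicE in_setC/=.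
  by case: ifPn => _; rewrite ?mul1r ?mul0r.
have [wN|wN] := boolP (w \in N).
  rewrite (_ : regular_version Phi ^~ w = cst 0); last first.
    by apply/funext => s; rewrite /regular_version wN andbF.
  by rewrite [X in _ --> X](_ : _ = 0) ?/regular_version ?wN ?andbF//; exact: cvg_cst.
have [r0|r0] := leP 0 r.
  have -> : regular_version Phi r w = Phi r w by rewrite /regular_version r0 wN.
  apply: cvg_trans (cPhi w r _ r0); last by rewrite notin_setE in wN.
  apply: near_eq_cvg; near=> s; rewrite /regular_version wN andbT.
  by rewrite (le_trans r0)// ltW.
have -> : regular_version Phi r w = 0 by rewrite /regular_version leNgt r0.
apply: cvg_near_cst; near=> s.
rewrite /regular_version leNgt (_ : s < 0)//.
Unshelve. all: by end_near. Qed.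

End regular_version.

Section mmou.
Context {R : realType} {d} {T : measurableType d} (P : probability T R).
Context {n : nat} (Q : 'M[R]_n) (alpha gamma sigma : 'rV[R]_n) (m0 : R).
Context (X : R -> T -> 'I_n) (B M : R -> {RV P >-> R}).
Hypothesis hX : is_markov_chain P Q X.
Hypothesis hB : is_brownian_motion B.
Hypothesis hXB : independent_classes P (sigma_states `[0, +oo[ X)
  (sigma_real `[0, +oo[ B).
Hypothesis hM : is_mmou X B alpha gamma sigma m0 M.

Local Notation mu := lebesgue_measure.
Local Notation nf := (natural_filtration X B).

Let mX (t : R) i : 0 <= t -> measurable (X t @^-1` [set i]).
Proof. by have [m _ _] := hX; exact: m. Qed.

Lemma measurable_state_indicator (r : R) i : 0 <= r ->
  measurable_fun setT (state_indicator X r i : T -> R).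
Proof.
move=> r0; rewrite (_ : state_indicator X r i = \1_(X r @^-1` [set i])).
  by apply: measurable_indic; exact: mX.
apply/funext => w; rewrite /state_indicator indicE.
by congr (nat_of_bool _)%:R; apply/eqP/idP => [E|E]; [exact: mem_set|exact: set_mem E].
Qed.

Lemma exists_regular_set : exists N : set T, [/\ measurable N, P N = 0%E &
  forall w, ~ N w -> cadlag_states (X ^~ w) /\
    {within `[0, +oo[, continuous (fun t : R => M t w)}].
Proof.
have [_ _ cX] := hX; have [cM _ _] := hM.
have [N [mN PN sN]] := filterI cX cM.
exists N; split => // w Nw; apply: contrapT => h.
by apply: Nw; apply: sN => -[h1 h2]; exact: h.
Qed.

Section regular.
Variables (N : set T) (mN : measurable N) (PN : P N = 0%E).
Hypothesis reg : forall w, ~ N w -> cadlag_states (X ^~ w) /\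
    {within `[0, +oo[, continuous (fun t : R => M t w)}.

Definition reg_state i := regular_version N (fun r => state_indicator X r i).
Definition reg_M := regular_version N (fun r => M r : T -> R).

Lemma reg_stateE i r w : 0 <= r -> ~ N w -> reg_state i r w = state_indicator X r i w.
Proof. by move=> r0 Nw; rewrite /reg_state /regular_version r0 memNset. Qed.

Lemma reg_ME r w : 0 <= r -> ~ N w -> reg_M r w = M r w.
Proof. by move=> r0 Nw; rewrite /reg_M /regular_version r0 memNset. Qed.

Lemma reg_state_norm_le1 i r w : `|reg_state i r w| <= 1.
Proof.
rewrite /reg_state /regular_version; case: ifPn => _; last by rewrite normr0.
by rewrite /state_indicator ger0_norm// lern1 leq_b1.
Qed.

Lemma reg_state_joint i : jointly_measurable (reg_state i).
Proof.
apply: regular_version_joint => // [r|w r Nw r0].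
  exact: measurable_state_indicator.
have [[cr _] _] := reg Nw.
apply: cvg_near_cst; near=> s.
by rewrite /state_indicator; congr (_ == _)%:R; near: s; exact: cr.
Unshelve. all: by end_near. Qed.

Lemma reg_M_joint : jointly_measurable reg_M.
Proof.
apply: regular_version_joint => // w r Nw r0.
have [_ /subspace_continuousP /(_ r)] := reg Nw.
rewrite /= in_itv/= r0 => /(_ isT) cr.
apply: cvg_trans cr; apply: cvg_app => U HU.
have {}HU : nbhs r (fun x => `[0, +oo[%classic x -> U x) by exact: HU.
suff : nbhs r (fun x => r < x -> U x) by [].
apply: filterS HU => s hs rs; apply: hs => /=.
by rewrite in_itv/= andbT (le_trans r0)// ltW.
Qed.

(** The bound depends on the path. It makes all time integrals finite before anything is known about
    moments. *)
Lemma reg_M_bounded w t : exists2 K : R, 0 <= K & forall r, 0 <= r <= t -> `|reg_M r w| <= K.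
Proof.
have [wN|wN] := boolP (w \in N).
  by exists 0 => // r _; rewrite /reg_M /regular_version wN andbF normr0.
rewrite notin_setE in wN; have [_ cM] := reg wN.
have /compact_bounded[K [_ HK]] : compact ((fun r => M r w) @` `[0, t]).
  apply: continuous_compact; last exact: segment_compact.
  apply: continuous_subspaceW cM => r /=; rewrite !in_itv/= => /andP[-> _]//.
exists (`|K| + 1); first by rewrite addr_ge0.
move=> r /[dup] rt /andP[r0 _]; rewrite reg_ME//; apply: HK; last by exists r.
by rewrite (le_lt_trans (ler_norm _))// ltrDl.
Qed.

(** Summing over states, instead of evaluating coefficients at [X r w], expresses the integrands
    through jointly measurable processes. *)
Definition drift r w : R := \sum_i reg_state i r w * (alpha 0 i - gamma 0 i * reg_M r w).
Definition volatility r w : R := \sum_i sigma 0 i * reg_state i r w.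

Lemma sum_state_indicator (f : 'I_n -> R) r w :
  \sum_i state_indicator X r i w * f i = f (X r w).
Proof.
rewrite (bigD1 (X r w))//= /state_indicator eqxx mul1r big1 ?addr0// => i iX.
by rewrite eq_sym (negbTE iX) mul0r.
Qed.

Lemma driftE r w : 0 <= r -> ~ N w ->
  drift r w = alpha 0 (X r w) - gamma 0 (X r w) * M r w.
Proof.
move=> r0 Nw; rewrite -(sum_state_indicator (fun i => alpha 0 i - gamma 0 i * M r w)).
by apply: eq_bigr => i _; rewrite reg_stateE// reg_ME.
Qed.

Lemma volatilityE r w : 0 <= r -> ~ N w -> volatility r w = sigma 0 (X r w).
Proof.
move=> r0 Nw; rewrite -(sum_state_indicator (fun i => sigma 0 i)).
by apply: eq_bigr => i _; rewrite reg_stateE// mulrC.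
Qed.

Lemma drift_joint : jointly_measurable drift.
Proof.
apply: measurable_sum => i; apply: measurable_funM; first exact: reg_state_joint.
apply: measurable_funB => //; apply: measurable_funM => //; exact: reg_M_joint.
Qed.

Lemma volatility_joint : jointly_measurable volatility.
Proof.
by apply: measurable_sum => i; apply: measurable_funM => //; exact: reg_state_joint.
Qed.

Local Notation ca := (\sum_i `|alpha 0 i|).
Local Notation cg := (\sum_i `|gamma 0 i|).
Local Notation cs := (\sum_i `|sigma 0 i|).

Lemma volatility_bounded r w : `|volatility r w| <= cs.
Proof.
rewrite (le_trans (ler_norm_sum _ _ _))//; apply: ler_sum => i _.
by rewrite normrM ler_piMr// reg_state_norm_le1.
Qed.

Lemma drift_le r w : `|drift r w| <= ca + cg * `|reg_M r w|.
Proof.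
rewrite (le_trans (ler_norm_sum _ _ _))// mulr_suml -big_split/=.
apply: ler_sum => i _; rewrite normrM.
apply: (@le_trans _ _ `|alpha 0 i - gamma 0 i * reg_M r w|).
  by rewrite ler_piMl// reg_state_norm_le1.
by rewrite (le_trans (ler_normB _ _))// normrM.
Qed.

Lemma path_measurable (f : R -> T -> R) w : jointly_measurable f ->
  measurable_fun setT (f ^~ w).
Proof.
move=> mf; have mp : measurable_fun setT (fun s : R => (s, w)) by exact: measurable_fun_pair.
exact: (measurableT_comp mf mp).
Qed.

Lemma drift_path_bounded w t : exists2 K : R, 0 <= K &
  forall r, 0 <= r <= t -> `|drift r w| <= K.
Proof.
have [K K0 HK] := reg_M_bounded w t.
exists (ca + cg * K); first by rewrite addr_ge0 ?mulr_ge0 ?sumr_ge0.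
move=> r rt; rewrite (le_trans (drift_le r w))// lerD2l ler_wpM2l ?sumr_ge0//.
exact: HK.
Qed.

Lemma drift_path_integrable w a b : 0 <= a -> mu.-integrable `[a, b] (EFin \o drift ^~ w).
Proof.
move=> a0; have [K _ HK] := drift_path_bounded w b.
apply: (@integrable_itv_bounded _ _ _ K).
  by apply: measurable_funTS; apply: path_measurable; exact: drift_joint.
by move=> r /andP[ar rb]; rewrite HK// rb (le_trans a0).
Qed.

Lemma ae_regular (f g : T -> R) : (forall w, ~ N w -> f w = g w) ->
  {ae P, forall w, f w = g w}.
Proof. by move=> fg; exists N; split => // w /= h; apply: contrapT => /fg. Qed.

(** The estimates on Ito integrals ask for a jointly measurable integrand bounded everywhere, so
    sigma_X is traded for [volatility]. At each time the two agree almost surely, so the same step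
    processes converge to both. *)
Lemma mmou_equation t : 0 <= t -> exists I : {RV P >-> R},
  is_ito_integral nf B volatility t I /\
  {ae P, forall w, M t w = m0 + \int[mu]_(s in `[0, t]) drift s w + I w}.
Proof.
move=> t0; have [_ _ /(_ t t0)[I [[H [adm c1 c2]] eqM]]] := hM.
exists I; split.
  exists H; split => //.
  suff -> : (fun k => \int[mu]_(s in `[0%R, t])
      'E_P[fun w => ((step_eval (H k) s w - volatility s w) ^+ 2)%R])%E =
    (fun k => \int[mu]_(s in `[0%R, t])
      'E_P[fun w => ((step_eval (H k) s w - sigma 0%R (X s w)) ^+ 2)%R])%E by [].
  apply/funext => k; apply: eq_integral => s; rewrite inE/= in_itv/= => /andP[s0 _].
  have mH := jointly_measurable_section s (step_eval_joint mX (adm k)).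
  rewrite unlock; apply: ae_eq_integral => //.
  - apply/measurable_EFinP; apply: measurable_funX; apply: measurable_funB => //.
    exact: (jointly_measurable_section s volatility_joint).
  - apply/measurable_EFinP; apply: measurable_funX; apply: measurable_funB => //.
    rewrite (_ : (fun w => _) = fun w => \sum_i state_indicator X s i w * sigma 0 i).
      apply: measurable_sum => i; apply: measurable_funM => //.
      exact: measurable_state_indicator.
    by apply/funext => w; rewrite sum_state_indicator.
  - have := ae_regular (fun w Nw => volatilityE s0 Nw).
    by apply: filterS => w /= -> _.
have NA : {ae P, forall w, ~ N w}.
  by exists N; split => // w /= h; apply: contrapT => /h.
apply: filterS2 NA eqM => w Nw ->; congr (_ + _ + _).
apply: eq_Rintegral => s; rewrite inE/= in_itv/= => /andP[s0 _].
by rewrite driftE.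
Qed.


Lemma integrable_path_sqr w a b : 0 <= a ->
  mu.-integrable `[a, b] (EFin \o (fun r => reg_M r w ^+ 2)).
Proof.
move=> a0; have [K K0 HK] := reg_M_bounded w b.
apply: (@integrable_itv_bounded _ _ _ (K ^+ 2)).
  apply: measurable_funTS; apply: measurable_funX.
  by apply: path_measurable; exact: reg_M_joint.
move=> r /andP[ar rb]; rewrite normrX ler_pXn2r ?nnegrE//.
by rewrite HK// rb (le_trans a0).
Qed.

(** Cauchy-Schwarz against the constant 1 costs a factor s, and drift^2 <= 2 ca^2 + 2 cg^2 M^2. The
    explicit factors s are then enlarged to t, which makes the constants uniform on [0, t]. *)
Lemma drift_integral_sqr_le w s t : 0 <= s <= t ->
  (\int[mu]_(r in `[0, s]) drift r w) ^+ 2 <=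
  2 * ca ^+ 2 * t ^+ 2 + 2 * cg ^+ 2 * t * \int[mu]_(r in `[0, s]) (reg_M r w ^+ 2).
Proof.
move=> /andP[s0 st]; have t0 := le_trans s0 st.
have iM := @integrable_path_sqr w 0 s (lexx 0).
have ic (c : R) : mu.-integrable `[0, s] (EFin \o (fun _ : R => c)).
  by apply: (@integrable_itv_bounded _ _ _ `|c|) => // r _.
have [K K0 HK] := drift_path_bounded w s.
have iq2 : mu.-integrable `[0, s] (EFin \o (fun r => drift r w ^+ 2)).
  apply: (@integrable_itv_bounded _ _ _ (K ^+ 2)).
    apply: measurable_funTS; apply: measurable_funX.
    by apply: path_measurable; exact: drift_joint.
  by move=> r rs; rewrite normrX ler_pXn2r ?nnegrE// HK.
have iq := @drift_path_integrable w 0 s (lexx 0).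
have i1 : mu.-integrable `[0, s] (EFin \o (fun _ : R => (1 : R) ^+ 2)) := ic _.
have iq1 : mu.-integrable `[0, s] (EFin \o (fun r => drift r w * 1)).
  by apply: eq_integrable iq => // r _ /=; rewrite mulr1.
have := @cauchy_schwarz_Rintegral _ _ _ mu `[0, s] (drift ^~ w) (fun=> 1)
  (measurable_itv _) iq2 i1 iq1.
under eq_Rintegral do rewrite mulr1.
rewrite [X in _ <= _ * X]Rintegral_cst//= lebesgue_measure_itv/= expr1n mul1r lte_fin.
have -> : fine (if 0 < s then (s%:E - 0%:E)%E else 0%E) = s.
  case: ifPn => [_|]; first by rewrite -EFinB subr0.
  by rewrite -leNgt => s0'; apply/le_anti; rewrite /= s0 s0'.
move=> /le_trans; apply.
have q2le : \int[mu]_(r in `[0, s]) (drift r w ^+ 2) <=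
    2 * ca ^+ 2 * s + 2 * cg ^+ 2 * \int[mu]_(r in `[0, s]) (reg_M r w ^+ 2).
  have -> : 2 * ca ^+ 2 * s = \int[mu]_(r in `[0, s]) (2 * ca ^+ 2).
    rewrite Rintegral_cst//= lebesgue_measure_itv/= lte_fin.
    case: ifPn => [_|]; first by rewrite -EFinB subr0.
    by rewrite -leNgt => s0'; congr (_ * _); apply/le_anti; rewrite /= s0 s0'.
  rewrite -RintegralZl// -RintegralD//; last exact: integrable_EFinZ.
  apply: le_Rintegral => //.
    by apply: integrable_EFinD => //; exact: integrable_EFinZ.
  move=> r _; have := drift_le r w.
  rewrite -(@ler_pXn2r _ 2) ?nnegrE ?addr_ge0 ?mulr_ge0 ?sumr_ge0//.
  rewrite real_normK ?num_real// => /le_trans; apply.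
  apply: le_trans (sqrD_le2 _ _) _.
  by rewrite exprMn real_normK ?num_real// !mulrA.
have I0 : 0 <= \int[mu]_(r in `[0, s]) (reg_M r w ^+ 2).
  by apply: Rintegral_ge0 => r _; exact: sqr_ge0.
apply: le_trans (ler_wpM2r s0 q2le) _.
rewrite mulrDl lerD//.
  rewrite -[leLHS]mulrA -expr2; apply: ler_wpM2l; first by rewrite mulr_ge0 ?sqr_ge0.
  by rewrite ler_pXn2r ?nnegrE.
rewrite mulrAC; apply: ler_wpM2r => //; apply: ler_wpM2l => //.
by rewrite mulr_ge0 ?sqr_ge0.
Qed.

Lemma reg_M_section r : measurable_fun setT (reg_M r).
Proof. exact: jointly_measurable_section reg_M_joint. Qed.

(** * Finiteness of the second moment of M *)

Section sqr_bound.
Variables (t : R) (t0 : 0 <= t).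

(* On the event [truncation k] the time integral of M^2 is bounded, which
   makes the second moment a priori finite there. *)
Definition truncation (k : nat) : set T :=
  ~` N `&` [set w | (\int[mu]_(r in `[0%R, t]) (reg_M r w ^+ 2)%:E <= k%:R%:E)%E].

(** The constants of the Gronwall inequality come from (m0 + x + I)^2 <= 3 m0^2 + 3 x^2 + 3 I^2,
    with the drift integral x bounded by [drift_integral_sqr_le] and E[I^2] by [ito_sqr_bound]. The
    1 makes the rate positive. *)
Let bb := 6 * cg ^+ 2 * t + 1.
Let aa := 3 * m0 ^+ 2 + 6 * ca ^+ 2 * t ^+ 2 + 3 * (6 + 4 * (cs ^+ 2 * t)).

Let bb0 : 0 < bb.
Proof. by have g2 := sqr_ge0 cg; rewrite ltr_wpDl// mulr_ge0// mulr_ge0. Qed.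

Let aa0 : 0 <= aa.
Proof.
have a2 := sqr_ge0 ca; have m2 := sqr_ge0 m0; have s2 := sqr_ge0 cs.
have t2 := sqr_ge0 t.
apply: addr_ge0; first by apply: addr_ge0; apply: mulr_ge0 => //; exact: mulr_ge0.
by apply: mulr_ge0 => //; apply: addr_ge0 => //; apply: mulr_ge0 => //; exact: mulr_ge0.
Qed.

Let sqr_M_joint : jointly_measurable (fun r w => reg_M r w ^+ 2).
Proof. exact: measurable_funX reg_M_joint. Qed.

Lemma measurable_truncation k : measurable (truncation k).
Proof.
apply: measurableI; first exact: measurableC.
rewrite -[X in measurable X]setTI.
apply: emeasurable_fun_infty_c => //.
by apply: measurable_time_integral => // r w; exact: sqr_ge0.
Qed.

Let F k r w := (\1_(truncation k) : T -> R) w * reg_M r w ^+ 2.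

Let F0 k r w : 0 <= F k r w.
Proof. by rewrite mulr_ge0// sqr_ge0. Qed.

Let jF k : jointly_measurable (F k).
Proof.
apply: measurable_funM; last exact: sqr_M_joint.
apply: (measurableT_comp _ measurable_snd).
by apply: measurable_indic; exact: measurable_truncation.
Qed.

Let Phi k s := (\int[P]_w (F k s w)%:E)%E.

Let Phi0 k s : (0 <= Phi k s)%E.
Proof. by apply: integral_ge0 => w _; rewrite lee_fin F0. Qed.

Let mPhi k : measurable_fun setT (Phi k).
Proof.
apply: (measurable_fun_fubini_tonelli_F (fun z : R * T => (F k z.1 z.2)%:E)).
  by apply/measurable_EFinP; exact: jF.
by move=> z; rewrite lee_fin F0.
Qed.

Let intPhi k s : (\int[mu]_(r in `[0%R, s]) Phi k r =
  \int[P]_w \int[mu]_(r in `[0%R, s]) (F k r w)%:E)%E.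
Proof. exact: tonelli_itv. Qed.

Let timeF k s w : (\int[mu]_(r in `[0%R, s]) (F k r w)%:E =
  ((\1_(truncation k) : T -> R) w * \int[mu]_(r in `[0, s]) (reg_M r w ^+ 2))%:E)%E.
Proof.
have iM := @integrable_path_sqr w 0 s (lexx 0).
rewrite -RintegralZl// fineK//; apply: integrable_fin_num => //.
exact: integrable_EFinZ.
Qed.

Let intPhi_le k s : 0 <= s <= t -> (\int[mu]_(r in `[0%R, s]) Phi k r <= k%:R%:E)%E.
Proof.
move=> /andP[s0 st]; rewrite intPhi.
apply: (@le_trans _ _ (\int[P]_w (cst k%:R%:E w))%E); last first.
  by rewrite integral_cst//= probability_setT mule1.
apply: ge0_le_integral => //.
- by move=> w _; apply: integral_ge0 => r _; rewrite lee_fin F0.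
- exact: measurable_time_integral.
move=> w _; rewrite timeF indicE.
have [|_] := boolP (w \in truncation k); last by rewrite mul0r lee_fin.
rewrite inE => -[_ /= hk]; rewrite mul1r.
have iM := @integrable_path_sqr w 0 s (lexx 0).
rewrite /Rintegral fineK; last exact: integrable_fin_num.
apply: le_trans hk; apply: ge0_subset_integral => //.
- apply/measurable_EFinP; apply: measurable_funTS.
  exact: path_measurable sqr_M_joint.
- by move=> r _; rewrite lee_fin sqr_ge0.
- by apply: subset_itvl; rewrite bnd_simp.
Qed.

(** The truncation event looks at the path up to t, so it is not known at earlier times and does not
    fit the isometry. Its indicator is dropped from the Ito term, which is bounded on the whole
    space, and kept on the drift term, where it produces the integral of [Phi]. *)
Let Phi_le k s : 0 <= s <= t ->
  (Phi k s <= aa%:E + bb%:E * \int[mu]_(r in `[0%R, s]) Phi k r)%E.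
Proof.
move=> /[dup] st01 /andP[s0 st]; rewrite intPhi.
have [I [hI eqM]] := mmou_equation s0.
have cs0 : 0 <= cs ^+ 2 := sqr_ge0 _.
have I2 : (\int[P]_w (I w ^+ 2)%:E <= (6 + 4 * (cs ^+ 2 * t))%:E)%E.
  apply: le_trans (ito_sqr_bound mX hB hXB volatility_joint volatility_bounded s0 hI) _.
  by rewrite lee_fin lerD2l !ler_wpM2l.
pose c := 3 * m0 ^+ 2 + 6 * ca ^+ 2 * t ^+ 2.
have c0 : 0 <= c.
  have a2 := sqr_ge0 ca; have m2 := sqr_ge0 m0; have t2 := sqr_ge0 t.
  by apply: addr_ge0; apply: mulr_ge0 => //; exact: mulr_ge0.
have mT := measurable_time_integral 0 s (jF k) (F0 k).
have T0 w : (0 <= \int[mu]_(r in `[0%R, s]) (F k r w)%:E)%E.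
  by apply: integral_ge0 => r _; rewrite lee_fin F0.
have mI2 : measurable_fun setT (fun w => (3 * I w ^+ 2)%:E).
  by apply/measurable_EFinP; apply: measurable_funM => //; exact: measurable_funX.
apply: (@le_trans _ _ (\int[P]_w ((c%:E + (3 * I w ^+ 2)%:E) +
    bb%:E * \int[mu]_(r in `[0%R, s]) (F k r w)%:E))%E).
  apply: ae_ge0_le_integral => //.
  - by move=> w _; rewrite lee_fin F0.
  - by apply/measurable_EFinP; exact: (jointly_measurable_section s (jF k)).
  - move=> w _; apply: adde_ge0; last by apply: mule_ge0 => //; rewrite lee_fin ltW.
    by apply: adde_ge0; rewrite lee_fin// mulr_ge0// sqr_ge0.
  - apply: emeasurable_funD; last exact: measurable_funeM.
    exact: emeasurable_funD.
  have NA : {ae P, forall w, ~ N w}.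
    by exists N; split => // w /= h; apply: contrapT => /h.
  apply: filterS2 NA eqM => w Nw Mw _.
  rewrite timeF -!EFinM -!EFinD lee_fin /F.
  set x := \int[mu]_(r in `[0, s]) drift r w in Mw.
  set y := \int[mu]_(r in `[0, s]) (reg_M r w ^+ 2).
  have xy : x ^+ 2 <= 2 * ca ^+ 2 * t ^+ 2 + 2 * cg ^+ 2 * t * y.
    exact: drift_integral_sqr_le.
  have y0 : 0 <= y by apply: Rintegral_ge0 => r _; exact: sqr_ge0.
  have cI : 0 <= c + 3 * I w ^+ 2 by rewrite addr_ge0// mulr_ge0// sqr_ge0.
  rewrite indicE; have [_|_] := boolP (w \in truncation k); last first.
    by rewrite !mul0r mulr0 addr0.
  rewrite !mul1r reg_ME// Mw.
  have s3 : (m0 + x + I w) ^+ 2 <= 3 * m0 ^+ 2 + 3 * x ^+ 2 + 3 * I w ^+ 2.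
    rewrite -subr_ge0; have -> : 3 * m0 ^+ 2 + 3 * x ^+ 2 + 3 * I w ^+ 2 -
      (m0 + x + I w) ^+ 2 = (m0 - x) ^+ 2 + (m0 - I w) ^+ 2 + (x - I w) ^+ 2 by ring.
    by rewrite !addr_ge0// sqr_ge0.
  apply: le_trans s3 _.
  have -> : c + 3 * I w ^+ 2 + bb * y = 3 * m0 ^+ 2 +
      3 * (2 * ca ^+ 2 * t ^+ 2 + 2 * cg ^+ 2 * t * y) + y + 3 * I w ^+ 2.
    by rewrite /c /bb; ring.
  move: xy y0; set u := _ + 2 * cg ^+ 2 * t * y.
  by move=> xy y0; lra.
rewrite ge0_integralD//; try (by apply: measurable_funeM);
  try (by apply: emeasurable_funD);
  try (by move=> w _; rewrite mule_ge0// lee_fin ltW);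
  try (by move=> w _; rewrite adde_ge0// lee_fin// mulr_ge0// sqr_ge0).
rewrite ge0_integralZl//; last by rewrite lee_fin ltW.
rewrite leeD2r//.
rewrite ge0_integralD//; last first.
  by move=> w _; rewrite lee_fin mulr_ge0// sqr_ge0.
rewrite integral_cst//= probability_setT mule1.
have -> : (\int[P]_w (3 * I w ^+ 2)%:E = 3%:E * \int[P]_w (I w ^+ 2)%:E)%E.
  rewrite -ge0_integralZl//.
    by apply/measurable_EFinP; exact: measurable_funX.
  by move=> w _; rewrite lee_fin sqr_ge0.
have -> : (aa%:E = c%:E + 3%:E * (6 + 4 * (cs ^+ 2 * t))%:E)%E by rewrite -EFinM -EFinD.
by apply: leeD => //; apply: lee_wpmul2l.
Qed.

Lemma truncated_sqr_bound k s : 0 <= s <= t ->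
  (\int[P]_(w in truncation k) (reg_M s w ^+ 2)%:E <=
   (2 * aa * expR (2 * bb * t))%:E)%E.
Proof.
move=> st; have /andP[s0 st'] := st.
have -> : (\int[P]_(w in truncation k) (reg_M s w ^+ 2)%:E = Phi k s)%E.
  rewrite integral_mkcond; apply: eq_integral => w _.
  by rewrite patchE /F indicE; case: ifPn => _; rewrite ?mul1r ?mul0r.
(* One use of [intPhi_le] makes [Phi] bounded. This bound depends on k but serves only as the a
   priori bound in Gronwall's inequality, so it leaves no trace in the result. *)
pose K := aa + bb * k%:R.
have PhiK r : 0 <= r <= t -> (Phi k r <= K%:E)%E.
  move=> rt; apply: le_trans (Phi_le k rt) _.
  have -> : (K%:E = aa%:E + bb%:E * k%:R%:E)%E by rewrite -EFinM -EFinD.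
  apply: leeD => //; apply: lee_wpmul2l; first by rewrite lee_fin ltW.
  exact: intPhi_le.
have Phi_fin r : 0 <= r <= t -> Phi k r \is a fin_num.
  by move=> rt; rewrite ge0_fin_numE// (le_lt_trans (PhiK r rt))// ltry.
pose phi r := fine (Phi k r).
have phiE r : 0 <= r <= t -> Phi k r = (phi r)%:E by move=> rt; rewrite fineK// Phi_fin.
have mphi : measurable_fun setT phi.
  by apply: (measurableT_comp (@fine_measurable R setT _)) => //.
rewrite phiE// lee_fin.
apply: (@le_trans _ _ (2 * aa * expR (2 * bb * s))).
  apply: (@gronwall _ phi aa bb K t) => //.
  - exact: measurable_funTS.
  - move=> r rt; rewrite -lee_fin -phiE// Phi0/=.
    by rewrite -lee_fin -phiE// PhiK.
  move=> r /[dup] rt /andP[r0 rt']; rewrite -lee_fin -phiE//.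
  apply: le_trans (Phi_le k rt) _.
  have -> : ((aa + bb * \int[mu]_(v in `[0, r]) phi v)%R%:E =
      aa%:E + bb%:E * (\int[mu]_(v in `[0, r]) phi v)%R%:E)%E by rewrite -EFinM -EFinD.
  apply: leeD => //; apply: lee_wpmul2l; first by rewrite lee_fin ltW.
  rewrite /Rintegral fineK.
    rewrite le_eqVlt; apply/orP; left; apply/eqP; apply: eq_integral => v.
    rewrite inE/= in_itv/= => /andP[v0 vr]; rewrite phiE// v0 (le_trans vr)//.
  apply: integrable_fin_num => //; apply: (@integrable_itv_bounded _ _ _ K).
    exact: measurable_funTS.
  move=> v /andP[v0 vr].
  have vt : 0 <= v <= t by rewrite v0 (le_trans vr).
  by rewrite ger0_norm -lee_fin -phiE// PhiK.
rewrite ler_wpM2l ?mulr_ge0// ler_expR ler_wpM2l// mulr_ge0// ltW//.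
Qed.

Lemma bigcup_truncation : \bigcup_k truncation k = ~` N.
Proof.
apply/seteqP; split => [w [k _ []]//|w Nw].
have iM := @integrable_path_sqr w 0 t (lexx 0).
have J0 : (\int[mu]_(r in `[0%R, t]) (reg_M r w ^+ 2)%:E)%E \is a fin_num.
  exact: integrable_fin_num.
exists (Num.bound (\int[mu]_(r in `[0, t]) (reg_M r w ^+ 2))) => //; split => //=.
rewrite -(fineK J0) lee_fin; apply/ltW/archi_boundP.
by apply: Rintegral_ge0 => r _; exact: sqr_ge0.
Qed.

Lemma reg_M_sqr_bound : exists C : R, forall s, 0 <= s <= t ->
  (\int[P]_w (reg_M s w ^+ 2)%:E <= C%:E)%E.
Proof.
exists (2 * aa * expR (2 * bb * t)) => s st.
have -> : (\int[P]_w (reg_M s w ^+ 2)%:E =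
    \int[P]_(w in \bigcup_k truncation k) (reg_M s w ^+ 2)%:E)%E.
  rewrite bigcup_truncation [RHS]integral_mkcond; apply: eq_integral => w _.
  rewrite patchE in_setC; case: ifPn => //; rewrite negbK => wN.
  by rewrite /reg_M /regular_version wN andbF expr0n.
have mM2 : measurable_fun setT (fun w => (reg_M s w ^+ 2)%:E).
  by apply/measurable_EFinP; apply: measurable_funX; exact: reg_M_section.
have nd : nondecreasing_seq truncation.
  move=> k l kl; apply/subsetPset => w [Nw /= h]; split => //=.
  by rewrite (le_trans h)// lee_fin ler_nat.
have cvgI := @ge0_nondecreasing_set_cvg_integral _ _ _ truncation
  (fun w => (reg_M s w ^+ 2)%:E) P nd measurable_truncation
  (fun k => measurable_funTS mM2)
  (fun k w _ => sqr_ge0 (reg_M s w) : (0 <= (reg_M s w ^+ 2)%:E)%E).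
rewrite -(cvg_lim _ cvgI)//; apply: lime_le; first by apply/cvg_ex; eexists; exact: cvgI.
by near=> k; exact: truncated_sqr_bound.
Unshelve. all: by end_near. Qed.

End sqr_bound.

Lemma mmou_sqr_bound t : 0 <= t -> exists2 C : R, 0 <= C & forall s, 0 <= s <= t ->
  (M s : T -> R) \in Lfun P 2%:E /\ \int[P]_w (M s w ^+ 2) <= C.
Proof.
move=> t0; have [C HC] := reg_M_sqr_bound t0.
exists `|C| => // s /[dup] st /andP[s0 _].
have E : (\int[P]_w (M s w ^+ 2)%:E = \int[P]_w (reg_M s w ^+ 2)%:E)%E.
  apply: ae_eq_integral => //.
  - by apply/measurable_EFinP; exact: measurable_funX.
  - by apply/measurable_EFinP; apply: measurable_funX; exact: reg_M_section.
  - by have := ae_regular (fun w Nw => reg_ME s0 Nw); apply: filterS => w /= -> _.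
have M2 : (M s : T -> R) \in Lfun P 2%:E.
  by apply: Lfun2_lty => //; rewrite E (le_lt_trans (HC s st))// ltry.
split => //; rewrite -lee_fin /Rintegral fineK.
  by rewrite E (le_trans (HC s st))// lee_fin ler_norm.
by apply: integrable_fin_num => //; exact: Lfun2_integrable_sqr.
Qed.

Lemma mmou_Lfun2 t : 0 <= t -> (M t : T -> R) \in Lfun P 2%:E.
Proof.
move=> t0; have [C _ /(_ t)] := mmou_sqr_bound t0.
by rewrite t0 lexx => /(_ isT)[].
Qed.

(** Adaptedness of [M] holds up to null sets, whereas the Markov identity is tested against
    functions measurable in the exact sense. *)
Lemma adapted_version t : 0 <= t -> exists f : T -> R,
  [/\ measurable_wrt (nf t) f, f \in Lfun P 2%:E & {ae P, forall w, M t w = f w}].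
Proof.
move=> t0; have [_ /(_ t t0)[f [mf Mf]] _] := hM.
have mf' : measurable_fun setT f.
  apply: (@measurable_wrt_fun _ _ _ P _ X B mX t).
  exact: measurable_wrt_sub (@natural_filtration_enlarged_past _ _ _ _ _ X B t) mf.
exists f; split => //; exact: ae_Lfun2 Mf (mmou_Lfun2 t0).
Qed.

Lemma state_indicator_norm_le1 r i w : `|state_indicator X r i w : R| <= 1.
Proof. by rewrite /state_indicator ger0_norm// lern1 leq_b1. Qed.

Lemma integrable_mul_state V r i : 0 <= r -> P.-integrable setT (EFin \o V) ->
  P.-integrable setT (EFin \o (fun w => V w * state_indicator X r i w)).
Proof.
move=> r0 iV; apply: (le_integrable _ _ _ iV) => //.
  apply/measurable_EFinP; apply: measurable_funM; last exact: measurable_state_indicator.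
  by apply/measurable_EFinP; exact: measurable_int iV.
by move=> w _; rewrite lee_fin normrM ler_piMr// state_indicator_norm_le1.
Qed.

Lemma sum_state_indicator1 r w : \sum_i state_indicator X r i w = 1 :> R.
Proof.
rewrite -[RHS](sum_state_indicator (fun=> 1) r w).
by apply: eq_bigr => i _; rewrite mulr1.
Qed.

Lemma markov_sum (s h : R) j (V : T -> R) : 0 <= s -> 0 <= h ->
  measurable_wrt (nf s) V -> P.-integrable setT (EFin \o V) ->
  \int[P]_w (V w * state_indicator X (s + h) j w) =
  \sum_i expmx (h *: Q) i j * \int[P]_w (V w * state_indicator X s i w).
Proof.
move=> s0 h0 mV iV.
under [RHS]eq_bigr do rewrite -(markov_property hX hXB)//.
rewrite -Rintegral_sum//; last first.
  move=> i; apply: integrable_mul_state; first exact: addr_ge0.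
  exact: integrable_mul_state.
apply: eq_Rintegral => w _; rewrite -mulr_suml -mulr_sumr.
by rewrite sum_state_indicator1 mulr1.
Qed.

Lemma natural_filtration_mono s t : s <= t -> nf s `<=` nf t.
Proof.
move=> st; have sub : `[0, s]%classic `<=` `[0, t]%classic.
  by apply: subset_itvl; rewrite bnd_simp.
apply: sub_sigma_algebra2 => E [[r rs hE]|[r rs hE]]; [left|right];
  by exists r => //; exact: sub.
Qed.

Lemma measurable_Rintegral_section (f : R -> T -> R) : jointly_measurable f ->
  measurable_fun setT (fun s => \int[P]_w f s w).
Proof.
move=> mf; pose f' (z : R * T) := (f z.1 z.2)%:E.
have mf' : measurable_fun setT f' by exact/measurable_EFinP.
apply: (measurableT_comp (@fine_measurable R setT _)) => //.
under eq_fun do rewrite integralE.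
apply: emeasurable_funB.
  rewrite (_ : (fun _ => _) = fubini_F P (f'^\+)%E).
    apply: measurable_fun_fubini_tonelli_F => //; exact: measurable_funepos.
  by apply/funext => s; apply: eq_integral => w _; rewrite !funeposE.
rewrite (_ : (fun _ => _) = fubini_F P (f'^\-)%E).
  apply: measurable_fun_fubini_tonelli_F => //; exact: measurable_funeneg.
by apply/funext => s; apply: eq_integral => w _; rewrite !funenegE.
Qed.

(** * Equations for the moments tested against V *)

Section covariance_equation.
Variables (t : R) (t0 : 0 <= t) (V : T -> R).
Hypotheses (mV : measurable_wrt (nf t) V) (V2 : V \in Lfun P 2%:E).

Definition state_moment i u : R := \int[P]_w (V w * state_indicator X (t + u) i w).
Definition modulated_moment i u : R := \int[P]_w (V w * modulated X M (t + u) i w).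

Local Notation p i j u := (expmx (u *: Q) i j).

Let iV : P.-integrable setT (EFin \o V) := Lfun2_integrable V2.

Lemma state_moment_markov j u : 0 <= u ->
  state_moment j u = \sum_i p i j u * state_moment i 0.
Proof.
by move=> u0; rewrite /state_moment markov_sum//; apply: eq_bigr => i _; rewrite addr0.
Qed.

Lemma mul_state_Lfun2 (W : T -> R) r i : 0 <= r -> W \in Lfun P 2%:E ->
  (fun w => W w * state_indicator X r i w) \in Lfun P 2%:E.
Proof.
move=> r0 W2; rewrite (_ : (fun w => _) = (fun w => state_indicator X r i w * W w)).
  apply: (@Lfun2_bounded_mul _ _ _ _ _ _ 1) => //.
    exact: measurable_state_indicator.
  exact: state_indicator_norm_le1.
by apply/funext => w; rewrite mulrC.
Qed.

Lemma modulated_moment_bounded U : exists K : R, forall i u, 0 <= u <= U ->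
  `|modulated_moment i u| <= K.
Proof.
have [C C0 HC] := @mmou_sqr_bound (t + `|U|) (addr_ge0 t0 (normr_ge0 U)).
(* This comes from |V M| <= V^2 + M^2 and the moment bound up to t + |U|. *)
exists (\int[P]_w (V w ^+ 2) + C) => i u /andP[u0 uU].
have tu : 0 <= t + u <= t + `|U|.
  by rewrite addr_ge0//= lerD2l (le_trans uU)// ler_norm.
have tu0 : 0 <= t + u by case/andP: tu.
have [M2 MC] := HC _ tu.
have i1 := Lfun2_integrable_sqr V2; have i2 := Lfun2_integrable_sqr M2.
have i3 : P.-integrable setT (EFin \o (fun w => V w * modulated X M (t + u) i w)).
  apply: Lfun2_mul => //; rewrite /modulated.
  apply: (@Lfun2_bounded_mul _ _ _ _ _ _ 1) => //; first exact: measurable_state_indicator.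
  exact: state_indicator_norm_le1.
rewrite (le_trans (le_normr_Rintegral _ _))//.
apply: (@le_trans _ _ (\int[P]_w (V w ^+ 2 + M (t + u) w ^+ 2))).
  apply: le_Rintegral => //; first by apply: integrable_norm.
    exact: integrable_EFinD.
  move=> w _; rewrite /modulated !normrM.
  apply: (@le_trans _ _ (`|V w| * `|M (t + u) w|)).
    by rewrite ler_wpM2l// ler_piMl// state_indicator_norm_le1.
  rewrite -(real_normK (num_real (V w))) -(real_normK (num_real (M (t + u) w))).
  have := sqr_ge0 (`|V w| - `|M (t + u) w|).
  by have := normr_ge0 (V w); have := normr_ge0 (M (t + u) w); nra.
by rewrite RintegralD// lerD2l.
Qed.

Lemma jointly_measurable_mul_fst (W : T -> R) (f : R -> T -> R) :
  measurable_fun setT W -> jointly_measurable f ->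
  jointly_measurable (fun r w => W w * f r w).
Proof.
move=> mW mf; apply: measurable_funM => //.
exact: (measurableT_comp mW measurable_snd).
Qed.

Lemma measurable_modulated_moment i (U : R) : measurable_fun `[0, U] (modulated_moment i).
Proof.
pose f r w := V w * (reg_state i r w * reg_M r w).
have mf : jointly_measurable f.
  apply: jointly_measurable_mul_fst; first exact: Lfun_measurable V2.
  by apply: measurable_funM; [exact: reg_state_joint|exact: reg_M_joint].
have ms : measurable_fun setT (fun u : R => \int[P]_w f (t + u) w).
  have mt : measurable_fun setT (fun u : R => t + u) by exact: measurable_funD.
  exact: (measurableT_comp (measurable_Rintegral_section mf) mt).
apply: (@eq_measurable_fun _ _ _ _ _ (fun u : R => \int[P]_w f (t + u) w)).
  move=> u; rewrite inE/= in_itv/= => /andP[u0 _].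
  have tu0 : 0 <= t + u by exact: addr_ge0.
  apply: ae_Rintegral.
  - exact: jointly_measurable_section.
  - apply: measurable_funM; first exact: Lfun_measurable V2.
    by apply: measurable_funM => //; exact: measurable_state_indicator.
  - by apply: ae_regular => w Nw; rewrite /f reg_stateE// reg_ME.
exact: measurable_funTS.
Qed.

(** Since V is known at t, the product V (alpha_i - gamma_i M(t + r)) is, up to a null set, known at
    t + r; the Markov property from t + r over the lag u - r then applies on each event {X(t + r) =
    i}. *)
Lemma drift_moment j u r : 0 <= r <= u ->
  \int[P]_w (V w * state_indicator X (t + u) j w * drift (t + r) w) =
  \sum_i p i j (u - r) *
    (alpha 0 i * state_moment i r - gamma 0 i * modulated_moment i r).
Proof.
move=> /andP[r0 ru].
have tr0 : 0 <= t + r by exact: addr_ge0.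
have tu0 : 0 <= t + u by rewrite addr_ge0// (le_trans r0).
have ur0 : 0 <= u - r by rewrite subr_ge0.
have [f [mf f2 Mf]] := adapted_version tr0.
have NA : {ae P, forall w, ~ N w}.
  by exists N; split => // w /= h; apply: contrapT => /h.
have mVT := Lfun_measurable V2; have mfT := Lfun_measurable f2.
have mZ i q : 0 <= q -> measurable_fun setT (state_indicator X q i : T -> R).
  exact: measurable_state_indicator.
pose W i w := V w * (alpha 0 i - gamma 0 i * f w).
have mV' : measurable_wrt (nf (t + r)) V.
  by apply: measurable_wrt_sub mV; apply: natural_filtration_mono; rewrite lerDl.
have mW i : measurable_wrt (nf (t + r)) (W i).
  apply: measurable_wrtM => //; apply/measurable_wrtP.
  apply: measurable_funB => //; apply: measurable_funM => //.
  exact/measurable_wrtP.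
have aff2 i : (fun w => alpha 0 i - gamma 0 i * f w) \in Lfun P 2%:E.
  apply: Lfun2_sub.
    by apply: (@bounded_Lfun2 _ _ _ _ _ `|alpha 0 i|).
  by apply: (@Lfun2_bounded_mul _ _ _ _ f (cst (gamma 0 i)) `|gamma 0 i|).
have iW i : P.-integrable setT (EFin \o W i) by exact: Lfun2_mul.
transitivity (\int[P]_w (\sum_i W i w * state_indicator X (t + r) i w *
    state_indicator X (t + r + (u - r)) j w)).
  have -> : t + r + (u - r) = t + u by ring.
  apply: ae_Rintegral.
  - apply: measurable_funM; first by apply: measurable_funM => //; exact: mZ.
    exact: (jointly_measurable_section (t + r) drift_joint).
  - apply: measurable_sum => i; apply: measurable_funM; last exact: mZ.
    apply: measurable_funM; last exact: mZ.
    by apply/measurable_EFinP; exact: measurable_int (iW i).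
  apply: filterS2 NA Mf => w Nw Mw.
  rewrite /drift mulr_sumr; apply: eq_bigr => i _.
  by rewrite reg_stateE// reg_ME// Mw /W; ring.
rewrite Rintegral_sum//; last first.
  move=> i; apply: integrable_mul_state; first by rewrite addr_ge0.
  exact: integrable_mul_state.
apply: eq_bigr => i _; rewrite (markov_property hX hXB)//; congr (_ * _).
have iVZ : P.-integrable setT (EFin \o (fun w => V w * state_indicator X (t + r) i w)).
  exact: integrable_mul_state.
have iVM : P.-integrable setT (EFin \o (fun w => V w * modulated X M (t + r) i w)).
  apply: Lfun2_mul => //; rewrite /modulated.
  apply: (@Lfun2_bounded_mul _ _ _ _ _ _ 1); [exact: mZ|exact: state_indicator_norm_le1|].
  exact: mmou_Lfun2.
rewrite /state_moment /modulated_moment -!RintegralZl// -RintegralB//;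
  try exact: integrable_EFinZ.
apply: ae_Rintegral.
- apply: measurable_funM; last exact: mZ.
  by apply/measurable_EFinP; exact: measurable_int (iW i).
- apply: measurable_funB; apply: measurable_funM => //; apply: measurable_funM => //.
    exact: mZ.
  by apply: measurable_funM => //; exact: mZ.
by apply: filterS Mf => w Mw; rewrite /W /modulated Mw; ring.
Qed.

Lemma modulated_moment_duhamel j u : 0 <= u ->
  modulated_moment j u = \sum_i p i j u * modulated_moment i 0 +
  \int[mu]_(r in `[0, u]) (\sum_i p i j (u - r) *
    (alpha 0 i * state_moment i r - gamma 0 i * modulated_moment i r)).
Proof.
move=> u0; have tu0 : 0 <= t + u by exact: addr_ge0.
have ttu : t <= t + u by rewrite lerDl.
have [I [hI eqI]] := mmou_equation t0.
have [I' [hI' eqI']] := mmou_equation tu0.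
have mVT := Lfun_measurable V2.
have mZ i q : 0 <= q -> measurable_fun setT (state_indicator X q i : T -> R).
  exact: measurable_state_indicator.
(* Although it involves X at t + u, this is known in the enlarged past at t, which holds the whole
   path of [X]. *)
pose W w := V w * state_indicator X (t + u) j w.
have W2 : W \in Lfun P 2%:E by exact: mul_state_Lfun2.
have mWT := Lfun_measurable W2.
have GW : measurable_wrt <<s enlarged_past X B t >> W.
  apply: measurable_wrtM; last exact: state_wrt_enlarged_past.
  exact: measurable_wrt_sub (@natural_filtration_enlarged_past _ _ _ _ _ X B t) mV.
have I2 := ito_Lfun2 mX hB hXB volatility_joint volatility_bounded t0 hI.
have I'2 := ito_Lfun2 mX hB hXB volatility_joint volatility_bounded tu0 hI'.
have orth := ito_increment_orth mX hB hXB volatility_joint volatility_bounded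
  t0 ttu hI hI' GW W2.
pose D w := \int[mu]_(r in `[t, t + u]) drift r w.
have splitD w : \int[mu]_(r in `[0, t + u]) drift r w =
    \int[mu]_(r in `[0, t]) drift r w + D w.
  have := @Rintegral_itvB R (drift ^~ w) (BLeft 0) (BRight (t + u)) t
    (@drift_path_integrable w 0 (t + u) (lexx 0)).
  rewrite !bnd_simp => /(_ t0 ttu) h.
  rewrite /D -Rintegral_itv_obnd_cbnd; last first.
    apply: integrableS (@drift_path_integrable w t (t + u) t0) => //.
    by apply: subset_itvr; rewrite bnd_simp.
  by rewrite -h [RHS]addrC subrK.
have eqM : {ae P, forall w, M (t + u) w = M t w + D w + (I' w - I w)}.
  by apply: filterS2 eqI eqI' => w -> ->; rewrite splitD; ring.
pose f r w := W w * drift r w.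
have jf : jointly_measurable f by apply: jointly_measurable_mul_fst => //; exact: drift_joint.
have [C C0 HC] := mmou_sqr_bound tu0.
(* From |W drift| <= W^2 + drift^2 and drift^2 <= 2 ca^2 + 2 cg^2 M^2: a bound uniform in time, as
   [fubini_itv] requires. *)
pose K := \int[P]_w (W w ^+ 2) + (2 * ca ^+ 2 + 2 * cg ^+ 2 * C).
have f_bound s : 0 <= s <= t + u -> (\int[P]_w `|(f s w)%:E| <= K%:E)%E.
  move=> st; have [M2 MC] := HC s st; have /andP[s0 _] := st.
  have i1 := Lfun2_integrable_sqr W2; have i2 := Lfun2_integrable_sqr M2.
  have ic : P.-integrable setT (EFin \o (fun _ : T => 2 * ca ^+ 2)).
    by apply: Lfun2_integrable; apply: (@bounded_Lfun2 _ _ _ _ _ `|2 * ca ^+ 2|).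
  have i3 : P.-integrable setT (EFin \o (fun w => 2 * ca ^+ 2 + 2 * cg ^+ 2 * M s w ^+ 2)).
    by apply: integrable_EFinD => //; exact: integrable_EFinZ.
  have i4 := integrable_EFinD measurableT i1 i3.
  apply: (@le_trans _ _ (\int[P]_w (W w ^+ 2 +
      (2 * ca ^+ 2 + 2 * cg ^+ 2 * M s w ^+ 2))%:E)%E).
    apply: ae_ge0_le_integral => //.
    - apply: measurableT_comp => //; apply/measurable_EFinP.
      exact: (jointly_measurable_section s jf).
    - move=> w _; rewrite lee_fin.
      by rewrite !addr_ge0 ?sqr_ge0// mulr_ge0// ?sqr_ge0// mulr_ge0// sqr_ge0.
    - exact: measurable_int i4.
    have := ae_regular (fun w Nw => reg_ME s0 Nw).
    apply: filterS => w /= <- _; rewrite lee_fin /f normrM.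
    have dM : drift s w ^+ 2 <= 2 * ca ^+ 2 + 2 * cg ^+ 2 * reg_M s w ^+ 2.
      rewrite -(real_normK (num_real (drift s w))) -(real_normK (num_real (reg_M s w))).
      apply: (@le_trans _ _ ((ca + cg * `|reg_M s w|) ^+ 2)).
        have h := drift_le s w; have h0 := normr_ge0 (drift s w).
        by rewrite lerXn2r// nnegrE// (le_trans h0).
      by apply: le_trans (sqrD_le2 _ _) _; rewrite lerD2l exprMn !mulrA.
    apply: (@le_trans _ _ (W w ^+ 2 + drift s w ^+ 2)); last by rewrite lerD2l.
    rewrite -(real_normK (num_real (W w))) -(real_normK (num_real (drift s w))).
    have := sqr_ge0 (`|W w| - `|drift s w|).
    by have := normr_ge0 (W w); have := normr_ge0 (drift s w); nra.
  have -> : (\int[P]_w (W w ^+ 2 + (2 * ca ^+ 2 + 2 * cg ^+ 2 * M s w ^+ 2))%:E =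
    (\int[P]_w (W w ^+ 2 + (2 * ca ^+ 2 + 2 * cg ^+ 2 * M s w ^+ 2))%R)%:E)%E.
    by rewrite /Rintegral fineK//; exact: integrable_fin_num.
  rewrite lee_fin RintegralD// lerD2l RintegralD//; last exact: integrable_EFinZ.
  rewrite Rintegral_cst//; have -> : fine (P setT) = 1 by rewrite probability_setT.
  rewrite mulr1 lerD2l RintegralZl//.
  by rewrite ler_wpM2l// mulr_ge0// sqr_ge0.
have f_path w : mu.-integrable `[t, t + u] (EFin \o f ^~ w).
  by apply: integrable_EFinZ => //; exact: drift_path_integrable.
have f_bound' s : t <= s <= t + u -> (\int[P]_w `|(f s w)%:E| <= K%:E)%E.
  by move=> /andP[ts su]; apply: f_bound; rewrite su (le_trans t0).
have [iD ED] := fubini_itv jf f_bound' f_path.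
have DE w : \int[mu]_(s in `[t, t + u]) f s w = W w * D w.
  by rewrite RintegralZl//; exact: drift_path_integrable.
have iWD : P.-integrable setT (EFin \o (fun w => W w * D w)).
  by apply: eq_integrable iD => // w _ /=; rewrite DE.
have iWM : P.-integrable setT (EFin \o (fun w => W w * M t w)).
  by apply: Lfun2_mul => //; exact: mmou_Lfun2.
have iWI : P.-integrable setT (EFin \o (fun w => (I' w - I w) * W w)).
  by apply: Lfun2_mul => //; exact: Lfun2_sub.
have step1 : modulated_moment j u = \int[P]_w (W w * M t w) + \int[P]_w (W w * D w).
  rewrite -[RHS]addr0 -[X in _ + X]orth -RintegralD// -RintegralD//; last first.
    exact: integrable_EFinD.
  apply: ae_Rintegral.
  - apply: measurable_funM => //; apply: measurable_funM => //; exact: mZ.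
  - have mDM : measurable_fun setT (fun w => W w * M t w + W w * D w + (I' w - I w) * W w).
      apply/measurable_EFinP; apply: measurable_int.
      by apply: (integrable_EFinD _ (integrable_EFinD _ iWM iWD) iWI).
    exact: mDM.
  by apply: filterS eqM => w Mw; rewrite /modulated Mw /W; ring.
rewrite step1; congr (_ + _).
  (* The first term is the Markov property from t over the lag u, applied to V M(t). *)
  have [h [mh h2 Mh]] := adapted_version t0.
  have mhT := Lfun_measurable h2.
  have mVh : measurable_wrt (nf t) (fun w => V w * h w) by exact: measurable_wrtM.
  have iVh : P.-integrable setT (EFin \o (fun w => V w * h w)) by exact: Lfun2_mul.
  transitivity (\int[P]_w (V w * h w * state_indicator X (t + u) j w)).
    apply: ae_Rintegral.
    - exact: measurable_funM.
    - by apply: measurable_funM; [exact: measurable_funM|exact: mZ].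
    - by apply: filterS Mh => w ->; rewrite /W; ring.
  rewrite markov_sum//; apply: eq_bigr => i _; congr (_ * _).
  rewrite /modulated_moment addr0; apply: ae_Rintegral.
  - by apply: measurable_funM; [exact: measurable_funM|exact: mZ].
  - by apply: measurable_funM => //; apply: measurable_funM => //; exact: mZ.
  - by apply: filterS Mh => w Mw; rewrite /modulated Mw; ring.
(* For the second term, expectation and time integral are exchanged and time is shifted by t, after
   which [drift_moment] evaluates the integrand. *)
transitivity (\int[mu]_(s in `[t, t + u]) (\int[P]_w f s w)).
  by rewrite -ED; apply: eq_Rintegral => w _; rewrite DE.
rewrite (@Rintegral_itv_shift _ t u K)//; last 2 first.
- exact: measurable_Rintegral_section.
- move=> r /andP[r0 ru].
  have tr : 0 <= t + r <= t + u by rewrite addr_ge0//= lerD2l.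
  have if' : P.-integrable setT (EFin \o f (t + r)).
    apply/integrableP; split.
      by apply/measurable_EFinP; exact: jointly_measurable_section.
    exact: le_lt_trans (f_bound _ tr) (ltry _).
  rewrite -lee_fin EFin_normr_Rintegral//.
  apply: le_trans (f_bound _ tr).
  by apply: le_abse_integral => //; exact: measurable_int if'.
apply: eq_Rintegral => r; rewrite inE/= in_itv/= => ru.
exact: drift_moment.
Qed.

Lemma covariance_system u : 0 <= u ->
  col_mx (\col_i state_moment i u) (\col_i modulated_moment i u) =
  expmx (u *: mmou_matrix Q alpha gamma) *m
    col_mx (\col_i state_moment i 0) (\col_i modulated_moment i 0).
Proof.
move=> u0; have [K HK] := modulated_moment_bounded u.
apply: (@mmou_duhamel_unique _ _ Q alpha gamma state_moment modulated_moment u K).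
- by move=> j r /andP[r0 _]; exact: state_moment_markov.
- by move=> i; exact: measurable_modulated_moment.
- exact: HK.
- by move=> j r /andP[r0 _]; exact: modulated_moment_duhamel.
- by rewrite u0 lexx.
Qed.

End covariance_equation.

End regular.
End mmou.

(** Centring one factor is enough, because a centred variable has zero expectation against the mean
    of the other. The covariance becomes linear in [U] against one fixed function, the form of the
    moment equations. *)
Lemma cov_centered_version {d} {T : measurableType d} {R : realType}
    (P : probability T R) (U W f : T -> R) :
  U \in Lfun P 2%:E -> W \in Lfun P 2%:E -> f \in Lfun P 2%:E ->
  {ae P, forall w, W w = f w} ->
  cov P U W = \int[P]_w ((f w - \int[P]_v W v) * U w).
Proof.
move=> U2 W2 f2 Wf; have iU := Lfun2_integrable U2; have iW := Lfun2_integrable W2.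
have mU := Lfun_measurable U2; have mW := Lfun_measurable W2.
have mf := Lfun_measurable f2.
have fin_setT : fine (P setT) = 1 by rewrite probability_setT.
have cst2 (a : R) : (fun _ : T => a) \in Lfun P 2%:E.
  by apply: (@bounded_Lfun2 _ _ _ _ _ `|a|).
set c := \int[P]_v W v; set a := \int[P]_v U v.
have Wc2 : (fun w => W w - c) \in Lfun P 2%:E by exact: Lfun2_sub.
have iWc := Lfun2_integrable Wc2.
have iWcU := Lfun2_mul Wc2 U2.
transitivity (\int[P]_w ((W w - c) * U w - a * (W w - c))).
  rewrite /cov covariance.unlock !expectation.unlock /Rintegral; congr fine.
  apply: eq_integral => w _; congr EFin.
  by rewrite [LHS](_ : _ = (U w - a) * (W w - c))//; ring.
rewrite RintegralB//; last exact: integrable_EFinZ.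
rewrite RintegralZl// RintegralB//; last exact: Lfun2_integrable.
rewrite Rintegral_cst// fin_setT mulr1 subrr mulr0 subr0.
apply: ae_Rintegral.
- by apply: measurable_funM => //; exact: measurable_funB.
- by apply: measurable_funM => //; exact: measurable_funB.
- by apply: filterS Wf => w ->.
Qed.

Unset Implicit Arguments.

Theorem mainTheorem7 (R : realType) (d : measure_display)
    (T : measurableType d) (P : probability T R) (n : nat)
    (Q : 'M[R]_n) (alpha gamma sigma : 'rV[R]_n) (m0 : R)
    (X : R -> T -> 'I_n) (B M : R -> {RV P >-> R})
    (hQ : is_generator Q)
    (hgamma : forall i, 0 < gamma 0 i)
    (hX : is_markov_chain P Q X)
    (hB : is_brownian_motion B)
    (hXB : independent_classes P (sigma_states `[0, +oo[ X)
             (sigma_real `[0, +oo[ B))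
    (hM : is_mmou X B alpha gamma sigma m0 M) :
  (* second moments are finite, so that all covariances below exist *)
  (forall t : R, 0 <= t -> (M t : T -> R) \in Lfun P 2%:E) /\
  (forall t u : R, 0 <= t -> 0 <= u ->
    col_mx (cov_vec P (state_indicator X (t + u)) (M t))
           (cov_vec P (modulated X M (t + u)) (M t)) =
      expmx (u *: mmou_matrix Q alpha gamma) *m
        col_mx (cov_vec P (state_indicator X t) (M t))
               (cov_vec P (modulated X M t) (M t)) /\
    cov P (M t) (M (t + u)) =
      ((const_mx 1 : 'rV[R]_n) *m cov_vec P (modulated X M (t + u)) (M t)) 0 0).
Proof.
have [N [mN PN reg]] := exists_regular_set hX hM.
have M2 t : 0 <= t -> (M t : T -> R) \in Lfun P 2%:E.
  exact: (mmou_Lfun2 hX hB hXB hM mN PN reg).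
split => // t u t0 u0; have tu0 : 0 <= t + u by exact: addr_ge0.
have mX (r : R) i : 0 <= r -> measurable (X r @^-1` [set i]) by case: hX => + _ _; exact.
have [f [mf f2 Mf]] := adapted_version hX hB hXB hM mN PN reg t0.
(* Exactly measurable for the natural filtration, and almost surely equal to M(t) - E M(t). *)
pose V w := f w - \int[P]_v M t v.
have mV : measurable_wrt (natural_filtration X B t) V.
  by apply/measurable_wrtP; apply: measurable_funB => //; apply/measurable_wrtP.
have V2 : V \in Lfun P 2%:E.
  by apply: Lfun2_sub => //; apply: (@bounded_Lfun2 _ _ _ _ _ `|\int[P]_v M t v|).
have covE U : U \in Lfun P 2%:E -> cov P U (M t) = \int[P]_w (V w * U w).
  by move=> U2; apply: cov_centered_version => //; exact: M2.
have Z2 r i : 0 <= r -> (state_indicator X r i : T -> R) \in Lfun P 2%:E.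
  move=> r0; apply: (@bounded_Lfun2 _ _ _ _ _ 1);
    first exact: measurable_state_indicator hX _ _ _.
  exact: state_indicator_norm_le1.
have Y2 r i : 0 <= r -> (modulated X M r i : T -> R) \in Lfun P 2%:E.
  move=> r0; apply: (@Lfun2_bounded_mul _ _ _ _ _ _ 1).
  - exact: measurable_state_indicator hX _ _ _.
  - exact: state_indicator_norm_le1.
  - exact: M2.
have covZ r : 0 <= r -> cov_vec P (state_indicator X (t + r)) (M t) =
    \col_i state_moment P X t V i r.
  by move=> r0; apply/colP => i; rewrite !mxE covE// Z2// addr_ge0.
have covY r : 0 <= r -> cov_vec P (modulated X M (t + r)) (M t) =
    \col_i modulated_moment X M t V i r.
  by move=> r0; apply/colP => i; rewrite !mxE covE// Y2// addr_ge0.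
split.
  have := covZ 0 (lexx 0); have := covY 0 (lexx 0); rewrite addr0 => -> ->.
  rewrite covZ// covY//.
  exact: (covariance_system hX hB hXB hM mN PN reg t0 mV V2).
(* By symmetry M(t) is the centred factor here too; summing Y_i(t + u) over i returns M(t + u),
   because exactly one indicator is 1. *)
rewrite /cov covarianceC -/(cov _ _ _) covE ?M2// [RHS]mxE.
under [RHS]eq_bigr do rewrite !mxE mul1r covE ?Y2//.
rewrite -Rintegral_sum//; last by move=> i; apply: Lfun2_mul => //; exact: Y2.
apply: eq_Rintegral => w _; rewrite -mulr_sumr -mulr_suml.
by rewrite sum_state_indicator1 mul1r.
Qed.
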